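(* The functional $\overline{F}$ is the relaxation of the functional $F$ in $H^2$, that is, for any $3$--network $\Gamma$ of class $H^2$, $$ \overline{F}(\Gamma)=\inf\Big\{\liminf_{n\to\infty}F(\Gamma_n)\;:\;\Gamma_n\rightharpoonup\Gamma \text{ weakly in } H^2,\ \text{with each } \Gamma_n \text{ a Theta--network}\Big\}, $$ where the infimum of the empty set is $+\infty$.
   Context: Curves are parametrized on $[0,1]$ with constant speed equal to their length $L(\gamma)$; a curve of length zero is constant. A curve is regular if $|\partial_x\gamma|\ne0$ on $[0,1]$; then $\tau=\partial_x\gamma/|\partial_x\gamma|$ is its unit tangent. A $3$--network of class $H^2$ is a union of three curves $\gamma^1,\gamma^2,\gamma^3:[0,1]\to\mathbb{R}^2$ of class $H^2$ meeting at two triple junctions: $\gamma^1(0)=\gamma^2(0)=\gamma^3(0)$ and $\gamma^1(1)=\gamma^2(1)=\gamma^3(1)$. Lengths are allowed to be zero (no regularity is required). Weak convergence $\Gamma_n\rightharpoonup\Gamma$ in $H^2$ means $\gamma^i_n\rightharpoonup\gamma^i$ weakly in $H^2(0,1;\mathbb{R}^2)$ for $i=1,2,3$. A Theta--network is a $3$--network of class $H^2$ whose three curves are regular and form angles of $120$ degrees at both junctions: $\sum_{i=1}^3\tau^i(0)=0$ and $\sum_{i=1}^3\tau^i(1)=0$. The curves may intersect and self-intersect. A ''degenerate'' Theta--network is a $3$--network consisting of two regular curves $\gamma^1,\gamma^2$ of class $H^2$, forming angles in pairs of $120$ and $60$ degrees, and of a curve $\gamma^3$ of length zero. Explicitly (up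 to relabeling the curves): $\gamma^3$ is constant equal to $P$, $\gamma^1(0)=\gamma^1(1)=\gamma^2(0)=\gamma^2(1)=P$, and, with the orientations inherited from the network, the vectors $\tau^1(0),\tau^2(0)$ form an angle of $120$ degrees and $\{\tau^1(0),\tau^2(0)\}=\{\tau^1(1),\tau^2(1)\}$. For a Theta--network, $F(\Gamma)=\sum_{i=1}^3\Big(\frac{1}{L^3(\gamma^i)}\int_0^1|\gamma^i_{xx}|^2\,\mathrm{d}x+L(\gamma^i)\Big)$, which equals $\sum_{i=1}^3\int_{\gamma^i}((k^i)^2+1)\,\mathrm{d}s^i$, with $k^i$ the scalar curvature and $s^i$ the arclength. The functional $\overline{F}$ on $3$--networks of class $H^2$ is: $\overline{F}(\Gamma)=F(\Gamma)$ if $\Gamma$ is a Theta--network; $\overline{F}(\Gamma)=\sum_{i=1}^2\Big(\frac{1}{L^3(\gamma^i)}\int_0^1|\gamma^i_{xx}|^2\,\mathrm{d}x+L(\gamma^i)\Big)$ (sum over the two curves of positive length) if $\Gamma$ is a ''degenerate'' Theta--network; $\overline{F}(\Gamma)=+\infty$ otherwise. *)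

(* Defs.v *)
From HB Require Import structures.
From mathcomp Require Import all_boot all_order all_algebra perm.
From mathcomp Require Import all_classical all_reals all_analysis.

Set Implicit Arguments.
Unset Strict Implicit.
Unset Printing Implicit Defensive.

Import Order.TTheory GRing.Theory Num.Theory.
Import numFieldNormedType.Exports.

Local Open Scope classical_set_scope.
Local Open Scope ring_scope.

Section Sobolev.
Variable R : realType.
Implicit Types f g phi : R -> R.

Local Notation mu := (@lebesgue_measure R).

(* Throughout, a function on [0,1] is a function on R whose values outside
   [0,1] are irrelevant. *)

Definition L2 f : Prop := (f \_ `]0, 1[) \in Lfun mu 2%:E.

(* C^1 functions with compact support in ]0,1[ *)
Definition test_function phi : Prop :=
  [/\ forall x, derivable phi x 1,
      continuous (derive1 phi) &
      exists a b : R, [/\ 0 < a, b < 1 &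
        forall x, x \notin `[a, b] -> phi x = 0] ].

Definition weak_derivative f g : Prop :=
  forall phi, test_function phi ->
    \int[mu]_(x in `]0, 1[) (f x * derive1 phi x)
    = - \int[mu]_(x in `]0, 1[) (g x * phi x).

(* Elements of the Sobolev space H^2(0,1) are identified with their
   continuous representative on [0,1]. *)
Definition H2 f : Prop :=
  {within `[0, 1], continuous f} /\
  exists f1 f2, [/\ L2 f1, L2 f2, weak_derivative f f1 & weak_derivative f1 f2].

(* For f in H^2, [deriv1 f] is the continuous representative of the weak
   derivative, unique on [0,1] (so it equals the classical derivative,
   one-sided at 0 and 1), and [deriv2 f] is the second weak derivative,
   unique almost everywhere on ]0,1[. *)
Definition deriv1 f : R -> R :=
  xget (cst 0) [set g : R -> R | {within `[0, 1], continuous g} /\ weak_derivative f g].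

Definition deriv2 f : R -> R :=
  xget (cst 0) [set g : R -> R | L2 g /\ weak_derivative (deriv1 f) g].

End Sobolev.

Section Curves.
Variable R : realType.

Local Notation mu := (@lebesgue_measure R).

Definition dotp (u v : 'rV[R]_2) : R := \sum_j u 0 j * v 0 j.

(* Euclidean norm; the library's norm on 'rV[R]_2 is the max norm. *)
Definition enorm (u : 'rV[R]_2) : R := Num.sqrt (dotp u u).

Definition angle (u v : 'rV[R]_2) : R :=
  acos (dotp u v / (enorm u * enorm v)).

Definition curve := R -> 'rV[R]_2.

Implicit Types gamma : curve.

Definition curve_H2 gamma : Prop := forall j, H2 (fun x => gamma x 0 j).

Definition dx gamma : curve := fun x =>
  \row_j deriv1 (fun y => gamma y 0 j) x.

Definition dxx gamma : curve := fun x =>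
  \row_j deriv2 (fun y => gamma y 0 j) x.

Definition norm_H2 gamma : R :=
  Num.sqrt (\int[mu]_(x in `]0, 1[)
    (enorm (gamma x) ^+ 2 + enorm (dx gamma x) ^+ 2
     + enorm (dxx gamma x) ^+ 2)).

(* Continuous linear functionals on H^2(0,1;R^2) *)
Definition dual_H2 (l : curve -> R) : Prop :=
  (forall (a : R) gamma1 gamma2, curve_H2 gamma1 -> curve_H2 gamma2 ->
     l (fun x => a *: gamma1 x + gamma2 x) = a * l gamma1 + l gamma2) /\
  (exists C : R, forall gamma, curve_H2 gamma -> `|l gamma| <= C * norm_H2 gamma).

Definition weak_cvg_H2 (gamma_ : nat -> curve) gamma : Prop :=
  forall l, dual_H2 l -> l (gamma_ n) @[n --> \oo] --> l gamma.

Definition len gamma : R := \int[mu]_(x in `]0, 1[) enorm (dx gamma x).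

Definition constant_speed gamma : Prop :=
  forall x, x \in `[0, 1] -> enorm (dx gamma x) = len gamma.

Definition regular gamma : Prop :=
  forall x, x \in `[0, 1] -> enorm (dx gamma x) != 0.

Definition tangent gamma : curve := fun x =>
  (enorm (dx gamma x))^-1 *: dx gamma x.

Definition energy gamma : R :=
  (len gamma ^+ 3)^-1 * \int[mu]_(x in `]0, 1[) (enorm (dxx gamma x) ^+ 2)
  + len gamma.

End Curves.

Section Networks.
Variable R : realType.

Definition triple := 'I_3 -> curve R.

Implicit Types Gamma : triple.

Definition network3 Gamma : Prop :=
  [/\ forall i, curve_H2 (Gamma i),
      forall i, constant_speed (Gamma i),
      forall i j, Gamma i 0 = Gamma j 0 &
      forall i j, Gamma i 1 = Gamma j 1].

Definition theta_network Gamma : Prop :=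
  [/\ network3 Gamma,
      forall i, regular (Gamma i),
      \sum_i tangent (Gamma i) 0 = 0 &
      \sum_i tangent (Gamma i) 1 = 0].

(* The permutation s relabels the curves. *)
Definition degenerate_theta_network Gamma : Prop :=
  network3 Gamma /\
  exists (s : 'S_3) (P : 'rV[R]_2),
    let gamma1 := Gamma (s (inord 0)) in
    let gamma2 := Gamma (s (inord 1)) in
    let gamma3 := Gamma (s (inord 2)) in
    [/\ regular gamma1 /\ regular gamma2,
        forall x, x \in `[0, 1] -> gamma3 x = P,
        [/\ gamma1 0 = P, gamma1 1 = P, gamma2 0 = P & gamma2 1 = P],
        angle (tangent gamma1 0) (tangent gamma2 0) = 2 * pi / 3 &
        [set tangent gamma1 0; tangent gamma2 0]
        = [set tangent gamma1 1; tangent gamma2 1] ].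

Definition F Gamma : R := \sum_i energy (Gamma i).

Definition Fbar Gamma : \bar R :=
  if `[< theta_network Gamma >] then (F Gamma)%:E
  else if `[< degenerate_theta_network Gamma >] then
    (\sum_(i | 0 < len (Gamma i)) energy (Gamma i))%:E
  else +oo%E.

Definition weak_cvg_network (Gamma_ : nat -> triple) Gamma : Prop :=
  forall i, weak_cvg_H2 (fun n => Gamma_ n i) (Gamma i).

(* The infimum of the empty set is +oo. *)
Definition relaxation Gamma : \bar R :=
  ereal_inf [set limn_einf (fun n => (F (Gamma_ n))%:E) | Gamma_ in
    [set Gamma_ : nat -> triple |
      weak_cvg_network Gamma_ Gamma /\ forall n, theta_network (Gamma_ n)] ].

End Networks.

(* Main.v *)
Require Import Defs.
From HB Require Import structures.
From mathcomp Require Import all_boot all_order all_algebra perm.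
From mathcomp Require Import all_classical all_reals all_analysis.
From mathcomp Require Import measurable_realfun.
From mathcomp Require Import ring lra.

(* Liminf inequality.  Point evaluations of the derivative and the pairings of
   the second derivative with a fixed L2 function are continuous functionals on
   H2, so lengths and tangents converge along a weakly convergent sequence, and
   the bending energy is bounded below by its linearization at the limit, which
   converges.  If the energies are bounded, a curve of length L has tangent
   oscillation O(sqrt L), so a short curve is nearly straight.  Two short curves
   of a Theta-network would have nearly parallel chords, although their tangents
   form an angle of 120 degrees.  Hence at most one length vanishes in the limit;
   if one does, its two end tangents have the same limit, so the unordered pair
   of the other two tangents is the same at both ends: the limit is degenerate.

   Recovery sequence for a degenerate network.  Each closed curve is opened by a
   small vector e w, with w opposite to the sum of the two tangents, by keeping
   its speed and rotating its unit tangent T by an angle a p + b q, where p and q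
   are test functions; the end tangents do not move.  To first order in (a, b)
   the displacement is an invertible linear map for suitable p and q, and a
   contraction argument solves for (a, b) exactly.  The third curve is the
   segment of length e in direction w. *)

(** [deriv1] and [deriv2] are picked by [xget] among weak derivatives, so nothing can be computed
    from them directly. The du Bois-Reymond lemma identifies the pick, and all later computations
    use [primitive_of]: a function is its value at 0 plus an integral. In the lower bound the
    obstacle is the factor L^-3: the linearized energy converges only for a curve whose length stays
    positive. The other energies are bounded below by zero. Energies are known to be bounded only
    along a subsequence, whence the hypotheses that hold for infinitely many indices. In the
    recovery sequence the constraints must hold exactly for every n, not just in the limit: constant
    speed, common endpoints, angles. Two scalar equations remain after rotating the tangent, namely
    the displacement of the endpoint, and two parameters a, b solve them. A straight third curve is
    possible because equality of the unordered pairs of tangents forces the same third direction at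
    both ends; having no bending, it escapes the factor L^-3 and costs only its length. *)

Set Implicit Arguments.
Unset Strict Implicit.
Unset Printing Implicit Defensive.

Import Order.TTheory GRing.Theory Num.Theory.
Import numFieldNormedType.Exports.

Local Open Scope classical_set_scope.
Local Open Scope ring_scope.

(** * Integrals on the unit interval *)

Section Integrals.
Variable R : realType.
Implicit Types (f g m : R -> R) (c M x : R).

Local Notation mu := (@lebesgue_measure R).
Local Notation I01 := (`]0, 1[%classic : set R).

Definition itg f : Prop := mu.-integrable `]0, 1[ (EFin \o f).
Definition int01 f : R := \int[mu]_(x in `]0, 1[) f x.

Lemma itg_meas f : itg f -> measurable_fun I01 f.
Proof. by move=> /integrableP[/measurable_EFinP]. Qed.

Lemma itg_bounded f M : measurable_fun I01 f ->
  (forall x : R, 0 < x < 1 -> `|f x| <= M) -> itg f.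
Proof.
move=> mf bf; apply: measurable_bounded_integrable => //.
  by rewrite /= lebesgue_measure_itv/= lte01 ltry.
exists M; split; rewrite ?num_real// => N MN x /=; rewrite in_itv/= => /bf.
by move=> /le_trans; apply; exact: ltW.
Qed.

Lemma itg_cst c : itg (fun=> c).
Proof. by apply: (@itg_bounded _ `|c|). Qed.

Lemma itgD f g : itg f -> itg g -> itg (fun x => f x + g x).
Proof. by move=> /integrableD /[apply]; exact. Qed.

Lemma itgB f g : itg f -> itg g -> itg (fun x => f x - g x).
Proof. by move=> /integrableB /[apply]; exact. Qed.

Lemma itgZ c f : itg f -> itg (fun x => c * f x).
Proof. by move=> fi; exact: (integrableZl _ c fi). Qed.

Lemma itg_norm f : itg f -> itg (fun x => `|f x|).
Proof. by move=> /integrable_norm; exact. Qed.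

Lemma itgM m f M : measurable_fun I01 m ->
  (forall x : R, 0 < x < 1 -> `|m x| <= M) -> itg f -> itg (fun x => m x * f x).
Proof.
move=> mm bm fi; have bm' : [bounded m x | x in I01].
  exists M; split; rewrite ?num_real// => N MN x /=; rewrite in_itv/= => /bm.
  by move=> /le_trans; apply; exact: ltW.
have H := integrableMr (mu:=mu) (measurable_itv _) mm bm' fi.
by apply: eq_integrable H.
Qed.

Lemma itg_le f g : measurable_fun I01 f ->
  (forall x : R, 0 < x < 1 -> `|f x| <= g x) -> itg g -> itg f.
Proof.
move=> mf fg; apply: le_integrable => //; first exact/measurable_EFinP.
move=> x /=; rewrite in_itv/= => /fg H; rewrite lee_fin (le_trans H)//.
exact: ler_norm.
Qed.

Lemma eq_int01 f g : (forall x : R, 0 < x < 1 -> f x = g x) -> int01 f = int01 g.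
Proof. by move=> fg; apply: eq_Rintegral => x /set_mem/=; rewrite in_itv/= => /fg. Qed.

Lemma eq_itg f g : (forall x : R, 0 < x < 1 -> f x = g x) -> itg f -> itg g.
Proof.
move=> fg fi; apply: eq_integrable fi => // x /set_mem/=.
by rewrite in_itv/= => /fg ->.
Qed.

Lemma int01D f g : itg f -> itg g -> int01 (fun x => f x + g x) = int01 f + int01 g.
Proof. by move=> fi gi; exact: RintegralD. Qed.

Lemma int01B f g : itg f -> itg g -> int01 (fun x => f x - g x) = int01 f - int01 g.
Proof. by move=> fi gi; exact: RintegralB. Qed.

Lemma int01Z c f : itg f -> int01 (fun x => c * f x) = c * int01 f.
Proof. by move=> fi; exact: RintegralZl. Qed.

Lemma int01_cst c : int01 (fun=> c) = c.
Proof.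
by rewrite /int01 Rintegral_cst//= lebesgue_measure_itv/= lte01 sube0 mulr1.
Qed.

Lemma le_int01 f g : itg f -> itg g -> (forall x : R, 0 < x < 1 -> f x <= g x) ->
  int01 f <= int01 g.
Proof.
move=> fi gi fg; apply: le_Rintegral => // x /=; rewrite in_itv/= => /fg.
Qed.

Lemma int01_ge0 f : (forall x : R, 0 < x < 1 -> 0 <= f x) -> 0 <= int01 f.
Proof. by move=> f0; apply: Rintegral_ge0 => x /=; rewrite in_itv/= => /f0. Qed.

Lemma norm_int01 f : itg f -> `|int01 f| <= int01 (fun x => `|f x|).
Proof. by move=> fi; exact: le_normr_Rintegral. Qed.

Definition ae01 f g : Prop := {ae mu, forall x, I01 x -> f x = g x}.

Lemma ae_int01 f g : measurable_fun I01 f -> measurable_fun I01 g ->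
  ae01 f g -> int01 f = int01 g.
Proof.
move=> mf mg fg; congr fine; apply: ae_eq_integral => //.
- exact/measurable_EFinP.
- exact/measurable_EFinP.
- apply: filterS fg; first exact: (ae_filter_ringOfSetsType mu).
  by move=> x fgx /fgx /= ->.
Qed.

Lemma sub01 : `]0, 1[%classic `<=` (`[0, 1]%classic : set R).
Proof. exact: subset_itv_oo_cc. Qed.

Lemma cont_meas f : {within `[0, 1], continuous f} -> measurable_fun I01 f.
Proof.
move=> cf; apply: (measurable_funS _ sub01) => //.
exact: subspace_continuous_measurable_fun.
Qed.

Lemma cont_bounded f : {within `[0, 1], continuous f} ->
  exists2 M : R, 0 <= M & forall x, 0 <= x <= 1 -> `|f x| <= M.
Proof.
move=> cf.
have /compact_bounded[M [_ mrt]] := continuous_compact cf (@segment_compact R 0 1).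
exists (`|M| + 1) => [|x x01]; first by rewrite addr_ge0.
apply: mrt; first by rewrite ltr_pwDr// ler_norm.
by exists x => //=; rewrite in_itv.
Qed.

Lemma cont_itg f : {within `[0, 1], continuous f} -> itg f.
Proof.
move=> cf; have [M M0 fM] := cont_bounded cf.
apply: (@itg_bounded _ M); first exact: cont_meas.
by move=> x /andP[x0 x1]; apply: fM; rewrite !ltW.
Qed.

(** [L2] speaks of the extension by zero to the whole line and of a real power; squaring commutes
    with that extension, so everything can be read on the open interval. *)
Lemma L2P f : L2 f <-> measurable_fun I01 f /\ itg (fun x => f x ^+ 2).
Proof.
split=> [fL|[mf fi]].
  have mf : measurable_fun I01 f.
    move: (fL); rewrite /L2 inE => /andP[/[!inE]/= + _].
    by move/(measurable_restrictT _ _).2; exact.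
  split=> //; have := Lfun2_integrable_sqr fL.
  move=> H; have {}H : mu.-integrable `]0, 1[ (EFin \o (fun x => (f \_ `]0, 1[) x ^+ 2)).
    by apply: (integrableS (E:=setT) (mu:=mu)).
  apply: eq_integrable H => //= x x01.
  by rewrite patchE x01.
rewrite /L2 inE; apply/andP; split; rewrite inE/=.
  by apply/(measurable_restrictT _ _).1.
rewrite /finite_norm unlock poweR_lty//.
case/integrableP : fi => _ fi.
apply: le_lt_trans fi; rewrite [leRHS]integral_mkcond/=.
apply: ge0_le_integral => //=.
- apply/measurable_EFinP.
  apply: (@measurableT_comp _ _ _ _ _ _ (fun x : R => x `^ 2)%R) => //.
  apply: measurableT_comp => //.
  by apply/(measurable_restrictT _ _).1.
- apply/(measurable_restrictT _ _).1 => //.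
  apply/measurable_EFinP; apply: measurableT_comp => //.
  exact: measurable_funX.
- move=> x _; rewrite !patchE; case: ifP => // _ /=.
    by rewrite lee_fin powR_mulrn// normrX.
  by rewrite normr0 powR0.
Qed.

End Integrals.

(** * Primitives *)

Section Primitive.
Variable R : realType.
Implicit Types (f g phi : R -> R) (a b c M x : R).

Local Notation mu := (@lebesgue_measure R).
Local Notation I01 := (`]0, 1[%classic : set R).

(** Integrating the extension by zero makes this defined for every real x and independent of [g] off
    the open interval, so integrability always reduces to [itg g]. *)
Definition prim g x : R := \int[mu]_(t in `[0, x]) (g \_ I01) t.

Lemma itg_patch g : itg g -> mu.-integrable setT (EFin \o (g \_ I01)).
Proof.
move=> gi; rewrite -restrict_EFin; apply/(integrable_restrict _ _ _ _).1 => //.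
by rewrite setTI.
Qed.

Lemma itg_patchS g (A : set R) : measurable A -> itg g -> mu.-integrable A (EFin \o (g \_ I01)).
Proof. by move=> mA /itg_patch; apply: integrableS. Qed.

Lemma prim0 g : prim g 0 = 0.
Proof. by rewrite /prim set_itv1 Rintegral_set1. Qed.

Lemma prim1 g : prim g 1 = int01 g.
Proof.
rewrite /prim /int01 [RHS]Rintegral_mkcond [LHS]Rintegral_mkcond.
congr fine; apply: eq_integral => x _; congr EFin.
rewrite !patchE; case: ifPn => // /negP; case: ifPn => // /set_mem H [].
by rewrite inE; exact: (@sub01 R).
Qed.

Lemma prim_cont g : itg g -> {within `[0, 1], continuous (prim g)}.
Proof.
by move=> gi; apply: parameterized_integral_continuous => //; exact: itg_patchS.
Qed.

Lemma prim_le g x : itg g -> `|prim g x| <= int01 (fun t => `|g t|).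
Proof.
move=> gi; apply: (le_trans (le_normr_Rintegral _ _)) => //; first exact: itg_patchS.
rewrite /int01 [leLHS]Rintegral_mkcond [leRHS]Rintegral_mkcond.
have gn := itg_norm gi.
apply: le_Rintegral => //.
- have := itg_patchS (measurable_itv `[0, x]) gi => H.
  rewrite -restrict_EFin; apply/(integrable_restrict _ _ _ _).1 => //.
  by rewrite setTI; exact: integrable_norm.
- exact: itg_patch.
- move=> t _; rewrite !patchE; case: ifPn => _; case: ifPn => _ //.
  + by rewrite normr0.
  + exact: normr_ge0.
Qed.

Lemma primD f g x : itg f -> itg g -> prim (fun t => f t + g t) x = prim f x + prim g x.
Proof.
move=> fi gi; rewrite -RintegralD//; [|exact: itg_patchS..].
by apply: eq_Rintegral => t _; rewrite !patchE; case: ifPn => // _; rewrite addr0.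
Qed.

Lemma primZ c f x : itg f -> prim (fun t => c * f t) x = c * prim f x.
Proof.
move=> fi; rewrite -RintegralZl//; last exact: itg_patchS.
by apply: eq_Rintegral => t _; rewrite !patchE; case: ifPn => // _; rewrite mulr0.
Qed.

Lemma prim_ae f g x : itg f -> itg g -> ae01 f g -> prim f x = prim g x.
Proof.
move=> fi gi fg; congr fine; apply: ae_eq_integral => //.
- by have /integrableP[] := itg_patchS (measurable_itv `[0, x]) fi.
- by have /integrableP[] := itg_patchS (measurable_itv `[0, x]) gi.
- apply: filterS fg; first exact: (ae_filter_ringOfSetsType mu).
  move=> t fgt _ /=; rewrite !patchE; case: ifPn => // /set_mem /fgt ->//.
Qed.

Lemma eq_prim f g x : (forall x : R, 0 < x < 1 -> f x = g x) -> prim f x = prim g x.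
Proof.
move=> fg; apply: eq_Rintegral => t _; rewrite !patchE; case: ifPn => // /set_mem/=.
by rewrite in_itv/= => /fg.
Qed.

(** Lebesgue differentiation; this is how equality of primitives is turned back into equality almost
    everywhere. *)
Lemma ae_prim_deriv g : itg g ->
  {ae mu, forall x, I01 x -> derivable (prim g) x 1 /\ derive1 (prim g) x = g x}.
Proof.
move=> gi.
have := @FTC1 R (g \_ I01) (BLeft 0) (fun y => itg_patchS (measurable_itv _) gi).
have loc : locally_integrable [set: R] (g \_ I01) by exact: integrable_locally.
move=> /(_ loc); apply: filterS; first exact: (ae_filter_ringOfSetsType mu).
move=> x /= H x01; move: (x01); rewrite in_itv/= => /andP[x0 x1].
have [|d1 d2] := H; first by rewrite lte_fin.
by split => //; rewrite d2 patchE mem_set.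
Qed.

Lemma cont_patch g x : 0 < x < 1 -> {for x, continuous g} -> {for x, continuous (g \_ I01)}.
Proof.
move=> x01 gx; rewrite /prop_for /continuous_at patchE mem_set; last first.
  by rewrite /= in_itv.
apply: cvg_trans gx; apply: near_eq_cvg; near=> y.
rewrite patchE mem_set//; near: y.
have : open I01 by exact: interval_open.
by rewrite openE; apply; rewrite /= in_itv.
Unshelve. all: by end_near. Qed.

Lemma prim_deriv g x : itg g -> 0 < x < 1 -> {for x, continuous g} ->
  derivable (prim g) x 1 /\ derive1 (prim g) x = g x.
Proof.
move=> gi x01 gx; have /andP[x0 x1] := x01.
have [d1 d2] := @continuous_FTC1_closed R (g \_ I01) 0 x 1 x1
  (itg_patchS (measurable_itv _) gi) x0 (cont_patch x01 gx).
by split => //; rewrite d2 patchE mem_set//= in_itv.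
Qed.

Lemma prim_LR g : itg g -> (forall x, 0 < x < 1 -> {for x, continuous g}) ->
  derivable_oo_LRcontinuous (prim g) 0 1.
Proof.
move=> gi cg; have /(continuous_within_itvP _ ltr01)[_ c0 c1] := prim_cont gi.
by split=> // x; rewrite in_itv/= => x01; have [] := prim_deriv gi x01 (cg _ x01).
Qed.

Lemma int01_cc f : mu.-integrable `[0, 1] (EFin \o f) ->
  \int[mu]_(x in `[0, 1]) f x = int01 f.
Proof.
move=> fi; rewrite /int01 -Rintegral_itv_obnd_cbnd; last first.
  by apply: integrableS fi => //; exact: subset_itv_oc_cc.
rewrite -Rintegral_itv_bndo_bndc//.
by apply: integrableS fi => //; exact: subset_itv_oo_cc.
Qed.

Lemma oo_cc x : 0 < x < 1 -> 0 <= x <= 1.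
Proof. by move=> /andP[x0 x1]; rewrite !ltW. Qed.

Lemma cont_within f : continuous f -> {within `[0, 1], continuous f}.
Proof. by move=> cf; exact: continuous_subspaceT. Qed.

Lemma test_derivable_cont phi : (forall x, derivable phi x 1) -> continuous phi.
Proof. by move=> dphi x; apply: differentiable_continuous; exact/derivable1_diffP. Qed.

Lemma test_function_bounded phi : test_function phi ->
  exists2 M : R, 0 <= M & forall x : R, 0 <= x <= 1 -> `|phi x| <= M /\ `|derive1 phi x| <= M.
Proof.
move=> [dphi cphi' _]; have cphi := test_derivable_cont dphi.
have [M1 M10 H1] := cont_bounded (cont_within cphi).
have [M2 M20 H2] := cont_bounded (cont_within cphi').
exists (M1 + M2) => [|x x01]; first exact: addr_ge0.
split; first by apply: (le_trans (H1 _ x01)); rewrite lerDl.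
by apply: (le_trans (H2 _ x01)); rewrite lerDr.
Qed.

Lemma test_function_end phi : test_function phi -> phi 0 = 0 /\ phi 1 = 0.
Proof.
move=> [_ _ [a [b [a0 b1 ab]]]]; split; apply: ab; rewrite in_itv/= negb_and -!ltNge.
  by rewrite a0.
by rewrite b1 orbT.
Qed.

Lemma prim_weak_cont g : continuous g -> weak_derivative (prim g) g.
Proof.
move=> cg phi tphi; have [dphi cphi' _] := tphi; have cphi := test_derivable_cont dphi.
have [phi0 phi1] := test_function_end tphi.
have cg1 := cont_within cg.
have cp1 := cont_within cphi.
have cp1' := cont_within cphi'.
have gi := cont_itg cg1.
have H := @Rintegration_by_parts R (prim g) phi g (derive1 phi) 0 1 ltr01 cg1 (prim_LR gi (fun x _ => cg x)).
have LRphi : derivable_oo_LRcontinuous phi 0 1.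
  split=> [x _|//|]; [exact: dphi|apply: cvg_at_right_filter|apply: cvg_at_left_filter]; exact: cphi.
have {}H := H (fun x x01 => (prim_deriv gi x01 (cg x)).2) cp1' LRphi (fun x _ => erefl).
move: H; rewrite phi0 phi1 !mulr0 subrr sub0r !int01_cc//.
- apply: continuous_compact_integrable; first exact: segment_compact.
  by move=> x; apply: continuousM; [exact: cg1|exact: cp1].
- apply: continuous_compact_integrable; first exact: segment_compact.
  by move=> x; apply: continuousM; [exact: (prim_cont gi)|exact: cp1'].
Qed.

Lemma norm_int01_le f M : itg f -> (forall x : R, 0 < x < 1 -> `|f x| <= M) ->
  `|int01 f| <= M.
Proof.
move=> fi fM; apply: (le_trans (norm_int01 fi)).
rewrite -[leRHS](int01_cst M); apply: le_int01 => //; last exact: itg_cst.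
exact: itg_norm.
Qed.

Lemma test_meas phi : test_function phi ->
  measurable_fun I01 phi /\ measurable_fun I01 (derive1 phi).
Proof.
move=> [dphi cphi' _]; have cphi := test_derivable_cont dphi.
by split; apply: cont_meas; exact: cont_within.
Qed.

Lemma itg_test g phi : itg g -> test_function phi ->
  itg (fun x => g x * phi x) /\ itg (fun x => g x * derive1 phi x).
Proof.
move=> gi tphi; have [m1 m2] := test_meas tphi.
have [M M0 HM] := test_function_bounded tphi.
split.
- apply: (@eq_itg _ (fun x => phi x * g x)) => [x _|]; first exact: mulrC.
  by apply: (@itgM _ _ _ M) => // x x01; have [] := HM _ (oo_cc x01).
- apply: (@eq_itg _ (fun x => derive1 phi x * g x)) => [x _|]; first exact: mulrC.
  by apply: (@itgM _ _ _ M) => // x x01; have [] := HM _ (oo_cc x01).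
Qed.

(** By density: [g] is approximated in L1 by continuous functions, for which classical integration
    by parts applies, and both sides of the identity are controlled by the L1 distance. *)
Lemma prim_weak g : itg g -> weak_derivative (prim g) g.
Proof.
move=> gi phi tphi; have [M M0 HM] := test_function_bounded tphi.
have I01fin : (mu I01 < +oo)%E by rewrite /= lebesgue_measure_itv/= lte01 ltry.
have [g_ [cg gi_ glim]] :=
  approximation_continuous_integrable (measurable_itv `]0, 1[) I01fin gi.
rewrite -/(int01 (fun x => prim g x * derive1 phi x)) -/(int01 (fun x => g x * phi x)).
apply/eqP; rewrite -subr_eq0 opprK -normr_le0; apply/ler_addgt0Pl => e e0.
rewrite addr0.
(* The two error terms are at most [d * M] each; the added 1 keeps the divisor positive when [M] is
   0. *)
have K0 : 0 < 2 * M + 1 by rewrite ltr_wpDl// mulr_ge0.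
have d1 : int01 (fun z => `|g z - g_ n z|) @[n --> \oo] --> (0:R) by exact: fine_cvg.
have /cvgr_lt/(_ (e / (2 * M + 1)) (divr_gt0 e0 K0)) := d1.
move=> [n _ /(_ _ (leqnn n))/=]; set d := int01 _ => dlt.
have giN : itg (g_ n) by exact: gi_.
have gig : itg (fun x => g x - g_ n x) by exact: itgB.
have Hn := prim_weak_cont (cg n) tphi.
rewrite -/(int01 _) -/(int01 _) in Hn.
have pi := cont_itg (prim_cont gi).
have pin := cont_itg (prim_cont giN).
have [i1 i2] := itg_test gi tphi; have [i3 i4] := itg_test giN tphi.
have [i5 i6] := itg_test pi tphi; have [i7 i8] := itg_test pin tphi.
have [i9 i10] := itg_test gig tphi.
have -> : int01 (fun x => prim g x * derive1 phi x) + int01 (fun x => g x * phi x) =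
    int01 (fun x => prim (fun t => g t - g_ n t) x * derive1 phi x) +
    int01 (fun x => (g x - g_ n x) * phi x).
  have -> : int01 (fun x => prim (fun t => g t - g_ n t) x * derive1 phi x) =
     int01 (fun x => prim g x * derive1 phi x) - int01 (fun x => prim (g_ n) x * derive1 phi x).
    rewrite -int01B//; apply: eq_int01 => x _; rewrite -mulrBl; congr (_ * _).
    rewrite (@eq_prim _ (fun t => g t + -1 * g_ n t)) => [|t _]; last by rewrite mulN1r.
    by rewrite primD ?primZ ?mulN1r//; exact: itgZ.
  have -> : int01 (fun x => (g x - g_ n x) * phi x) =
     int01 (fun x => g x * phi x) - int01 (fun x => g_ n x * phi x).
    by rewrite -int01B//; apply: eq_int01 => x _; rewrite -mulrBl.
  by rewrite Hn; ring.
have d0 : 0 <= d by apply: int01_ge0 => x _; exact: normr_ge0.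
have [_ j1] := itg_test (cont_itg (prim_cont gig)) tphi.
have b1 : `|int01 (fun x => prim (fun t => g t - g_ n t) x * derive1 phi x)| <= d * M.
  apply: norm_int01_le => // x x01; rewrite normrM ler_pM//.
    exact: prim_le.
  by have [] := HM _ (oo_cc x01).
have b2 : `|int01 (fun x => (g x - g_ n x) * phi x)| <= d * M.
  apply: (le_trans (norm_int01 i9)).
  rewrite mulrC -int01Z; last exact: itg_norm.
  apply: le_int01; [exact: itg_norm|by apply: itgZ; exact: itg_norm|].
  move=> x x01; rewrite normrM mulrC ler_wpM2r//.
  by have [] := HM _ (oo_cc x01).
apply: (le_trans (ler_normD _ _)); apply: (le_trans (lerD b1 b2)).
move: dlt; rewrite ltr_pdivlMr// => /ltW; apply: le_trans.
by nra.
Qed.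

Lemma int01_dcvg (u_ : nat -> R -> R) (u g : R -> R) : (forall n, measurable_fun I01 (u_ n)) ->
  measurable_fun I01 u -> itg g ->
  (forall n (x : R), 0 < x < 1 -> `|u_ n x| <= g x) ->
  (forall x : R, 0 < x < 1 -> u_ n x @[n --> \oo] --> (u x : R)) ->
  int01 (u_ n) @[n --> \oo] --> int01 u.
Proof.
move=> mu_ mu' gi ug uu.
have [] := @dominated_convergence _ _ _ mu I01 (measurable_itv _) (fun n x => (u_ n x)%:E)
  (fun x => (u x)%:E) (fun x => (g x)%:E).
- by move=> n; apply/measurable_EFinP; exact: mu_.
- by apply/measurable_EFinP.
- apply: aeW => x; rewrite /= in_itv/= => x01.
  by apply: cvg_EFin; [exact: nearW|exact: uu].
- exact: gi.
- by apply: aeW => x n; rewrite /= in_itv/= => x01; rewrite lee_fin; exact: ug.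
move=> ui _ H; apply: fine_cvg.
rewrite /int01 /Rintegral fineK; last exact: integrable_fin_num.
exact: H.
Qed.

(** The primitive from minus infinity vanishes left of [a] and equals the total integral, zero,
    right of [b]; hence its compact support. This produces test functions with prescribed
    derivative. *)
Lemma test_prim f a b : 0 < a -> b < 1 -> continuous f ->
  (forall x, x \notin `[a, b] -> f x = 0) -> int01 f = 0 ->
  exists2 phi, test_function phi & forall x, derive1 phi x = f x.
Proof.
move=> a0 b1 cf f0 intf.
have fi := cont_itg (cont_within cf).
have fE : f \_ I01 = f.
  apply/funext => x; rewrite patchE; case: ifPn => // /negP xI; rewrite f0//.
  apply/negP; rewrite in_itv/= => /andP[ax xb]; apply: xI; rewrite inE/= in_itv/=.
  by rewrite (lt_le_trans a0)// (le_lt_trans xb).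
have fT : mu.-integrable setT (EFin \o f) by rewrite -fE; exact: itg_patch.
pose phi x : R := \int[mu]_(t in `]-oo, x]) f t.
have dphi x : derivable phi x 1 /\ derive1 phi x = f x.
  apply: (@continuous_FTC1 R f -oo%O x (x + 1)).
  - by rewrite ltrDl.
  - by apply: integrableS fT.
  - by rewrite ltNyr.
  - exact: cf.
exists phi; last by move=> x; have [] := dphi x.
split; first by move=> x; have [] := dphi x.
  by rewrite (_ : derive1 phi = f)//; apply/funext => x; have [] := dphi x.
exists a, b; split=> // x xab; rewrite /phi Rintegral_mkcond.
have [xa|ax] := ltP x a.
  transitivity (\int[mu]_(t in [set: R]) (0:R)); last first.
    by rewrite Rintegral_cst// mul0r.
  apply: eq_Rintegral => t _; rewrite patchE; case: ifPn => // /set_mem/=.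
  rewrite in_itv/= => tx; apply: f0; rewrite in_itv/= negb_and -!ltNge.
  by rewrite (le_lt_trans tx).
have bx : b < x by move: xab; rewrite in_itv/= ax/= ltNge.
rewrite -intf /int01 [RHS]Rintegral_mkcond fE; apply: eq_Rintegral => t _.
rewrite patchE; case: ifPn => // /negP tx; rewrite f0// in_itv/= negb_and -!ltNge.
apply/orP; right; rewrite ltNge; apply/negP => tb; apply: tx.
by rewrite inE/= in_itv/= (le_trans tb)// ltW.
Qed.

End Primitive.

(** * Du Bois-Reymond lemma *)

Section DuBoisReymond.
Variable R : realType.
Implicit Types (f m phi : R -> R) (a b c x : R).

Local Notation mu := (@lebesgue_measure R).
Local Notation I01 := (`]0, 1[%classic : set R).

(** The primitive is locally constant, so its derivative, which is [f] almost everywhere, is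
    zero. *)
Lemma prim_const_ae0 f : itg f ->
  (forall x y : R, 0 < x < 1 -> 0 < y < 1 -> prim f x = prim f y) ->
  ae01 f (cst 0).
Proof.
move=> fi fc; apply: filterS (ae_prim_deriv fi).
  exact: (ae_filter_ringOfSetsType mu).
move=> x /= H x01; have [_ <-] := H x01.
rewrite derive1E (@near_eq_derive _ _ _ _ (cst (prim f x)) x 1) ?derive_cst//.
have oI : open I01 by exact: interval_open.
move: oI; rewrite openE => /(_ _ x01); apply: filterS => y /=.
by rewrite in_itv/= => y01; apply: fc => //; move: x01; rewrite /= in_itv.
Qed.

Lemma cvgn_unique (u : nat -> R) (k l : R) :
  u n @[n --> \oo] --> k -> u n @[n --> \oo] --> l -> k = l.
Proof. by move=> uk ul; exact: (cvg_unique (@Rhausdorff R) uk ul). Qed.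

(** Continuous approximations of the indicator of ]a, b[. Test functions only have a continuous
    derivative, so a trapezoid corrected to mean zero is an admissible derivative; trapezoids stand
    in for mollifiers. *)
Definition trapez a b (n : nat) x : R :=
  Num.min 1 (n%:R * Num.max 0 (Num.min (x - a) (b - x))).

Lemma trapez_cont a b n : continuous (trapez a b n).
Proof.
have c1 : continuous (fun x => x - a) by move=> x; apply: cvgB => //; exact: cvg_cst.
have c2 : continuous (fun x => b - x) by move=> x; apply: cvgB => //; exact: cvg_cst.
have c3 := fun x => @continuous_max R R^o (cst 0) _ x (@cst_continuous _ _ 0 x)
  (@continuous_min R R^o _ _ x (c1 x) (c2 x)).
have c4 : continuous (fun x => n%:R * Num.max 0 (Num.min (x - a) (b - x))).
  move=> x; apply: cvgM; [exact: cvg_cst|exact: c3].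
by move=> x; have := @continuous_min R R^o (cst 1) _ x (@cst_continuous _ _ _ x) (c4 x).
Qed.

Lemma trapez_ge0 a b n x : 0 <= trapez a b n x.
Proof. by rewrite le_min ler01/= mulr_ge0// le_max lexx. Qed.

Lemma trapez_le1 a b n x : trapez a b n x <= 1.
Proof. by rewrite ge_min lexx. Qed.

Lemma trapez_out a b n x : x \notin `]a, b[ -> trapez a b n x = 0.
Proof.
rewrite in_itv/= negb_and -!leNgt => H; rewrite /trapez.
have m0 : Num.min (x - a) (b - x) <= 0 by rewrite ge_min !subr_le0.
by rewrite max_l// mulr0 min_r.
Qed.

Lemma trapez_cvg a b x : trapez a b n x @[n --> \oo] --> (\1_(`]a, b[%classic : set R) x : R).
Proof.
have [xab|xab] := boolP (x \in `]a, b[); last first.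
  rewrite indicE memNset//=; last by apply/negP.
  by apply: cvg_near_cst; apply: nearW => n; exact: trapez_out.
rewrite indicE mem_set//=; apply: cvg_near_cst.
move: xab; rewrite in_itv/= => /andP[ax xb].
have m0 : 0 < Num.min (x - a) (b - x) by rewrite lt_min !subr_gt0 ax.
near=> n; rewrite /trapez max_r ?(ltW m0)// min_l// -ler_pdivrMr// div1r.
near: n; exists (Num.truncn (Num.min (x - a) (b - x))^-1).+1 => // n /= nn.
by rewrite (le_trans (ltW (truncnS_gt _)))// ler_nat.
Unshelve. all: by end_near. Qed.

Lemma trapez_itg a b n : itg (trapez a b n).
Proof. apply: cont_itg; exact/cont_within/trapez_cont. Qed.

Lemma int01_trapez f a b : itg f ->
  int01 (fun x => f x * trapez a b n x) @[n --> \oo] -->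
  int01 (fun x => f x * \1_(`]a, b[%classic : set R) x).
Proof.
move=> fi; apply: (@int01_dcvg _ _ _ (fun x => `|f x|)).
- move=> n; apply: measurable_funM; first exact: itg_meas.
  exact: (itg_meas (trapez_itg _ _ _)).
- apply: measurable_funM; first exact: itg_meas.
  exact: measurable_indic.
- exact: itg_norm.
- move=> n x _; rewrite normrM ler_piMr// ger0_norm ?trapez_ge0//.
  exact: trapez_le1.
- move=> x _; apply: cvgM; [exact: cvg_cst|exact: trapez_cvg].
Qed.

Lemma int01_indic f a b : itg f -> 0 < a -> a <= b -> b < 1 ->
  int01 (fun x => f x * \1_(`]a, b[%classic : set R) x) = prim f b - prim f a.
Proof.
move=> fi a0 ab b1; rewrite /prim Rintegral_itvB; last 3 first.
- exact: itg_patchS.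
- by rewrite bnd_simp ltW.
- by rewrite bnd_simp.
rewrite -Rintegral_itv_bndo_bndc; last exact: itg_patchS.
rewrite /int01 [LHS]Rintegral_mkcond [RHS]Rintegral_mkcond.
apply: eq_Rintegral => x _; rewrite !patchE indicE.
case: ifPn => [/set_mem/=|]; case: ifPn => [/set_mem/=|] //=.
by rewrite mulr1.
by rewrite mulr0.
Qed.

(** These integrals tend to 1/2, so they cannot all vanish. Such a trapezoid serves to correct the
    mean of other functions. *)
Lemma bump_ex : exists n, int01 (trapez 4^-1 (3 / 4) n) != 0.
Proof.
apply: contrapT => H.
have H0 n : int01 (trapez (4^-1 : R) (3 / 4) n) = 0.
  by apply: contrapT => /eqP Hn; apply: H; exists n.
have L1 := @int01_trapez (cst 1) 4^-1 (3/4) (itg_cst 1).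
have L2 : int01 (fun x => cst 1 x * trapez (4^-1 : R) (3 / 4) n x) @[n --> \oo] --> (0 : R).
  apply: cvg_near_cst; apply: nearW => n; rewrite -(H0 n).
  by apply: eq_int01 => x _; rewrite mul1r.
have := cvgn_unique L1 L2.
rewrite (@eq_int01 _ _ (\1_(`]4^-1, 3 / 4[%classic : set R))); last first.
  by move=> x _; rewrite mul1r.
have sub : (`]4^-1, 3 / 4[%classic : set R) `<=` I01.
  by apply: subset_itv; rewrite bnd_simp; lra.
rewrite /int01 /Rintegral integral_indic// setIidl//= lebesgue_measure_itv/= lte_fin.
by rewrite ifT /=; [lra..].
Qed.

(** A trapezoid minus a multiple of a fixed bump has mean zero, hence is the derivative of a test
    function. So [f - k] integrates to zero against every trapezoid, in the limit over every
    interval, and its primitive is constant. *)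
Lemma weak_derivative0 f : itg f -> weak_derivative f (cst 0) ->
  exists k, ae01 f (cst k).
Proof.
move=> fi wf; have [n0 c0] := bump_ex.
set c := trapez _ _ n0 in c0; set I0 := int01 c in c0.
have ci : itg c by exact: trapez_itg.
have fM m a b n : itg m -> itg (fun x => m x * trapez a b n x).
  move=> mi; apply: (@eq_itg _ (fun x => trapez a b n x * m x)) => [x _|].
    exact: mulrC.
  apply: (@itgM _ _ _ 1) => //; first exact: (itg_meas (trapez_itg _ _ _)).
  by move=> x _; rewrite ger0_norm ?trapez_ge0// trapez_le1.
(* [k] is the mean of [f] weighted by the bump [c]. *)
pose k := int01 (fun x => f x * c x) / I0; exists k.
have fki : itg (fun x => f x - k) by apply: itgB => //; exact: itg_cst.
have H a b n : 0 < a -> b < 1 -> int01 (fun x => (f x - k) * trapez a b n x) = 0.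
  move=> a0 b1.
  set t := trapez a b n; have ti : itg t by exact: trapez_itg.
  (* [l] is chosen so that [w] has mean zero. *)
  pose l := int01 t / I0; pose w x := t x - l * c x.
  have [|||||phi tphi dphi] := @test_prim R w (Num.min a 4^-1) (Num.max b (3 / 4)).
  - by rewrite lt_min a0/=; lra.
  - by rewrite gt_max b1/=; lra.
  - move=> x; apply: (@continuousB _ R^o R^o); first exact: trapez_cont.
    by apply: (@continuousM _ R^o (cst l)); [exact: cst_continuous|exact: trapez_cont].
  - move=> x; rewrite in_itv/= => xo; rewrite /w /t /c !trapez_out ?mulr0 ?subr0//.
      apply: contra xo; rewrite in_itv/= => /andP[ax xb].
      by rewrite ge_min le_max (ltW ax) (ltW xb) !orbT.
    apply: contra xo; rewrite in_itv/= => /andP[ax xb].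
    by rewrite ge_min le_max (ltW ax) (ltW xb).
  - by rewrite /w int01B ?int01Z//; [rewrite /l mulfVK// subrr|exact: itgZ].
  have := wf phi tphi; rewrite -!/(int01 _).
  rewrite (@eq_int01 _ (fun x => cst 0 x * phi x) (cst 0)) => [|x _]; last by rewrite mul0r.
  rewrite int01_cst oppr0.
  have e1 : int01 (fun x => f x * derive1 phi x) =
      int01 (fun x => f x * t x) - l * int01 (fun x => f x * c x).
    rewrite -int01Z; last exact: fM.
    rewrite -int01B; [|exact: fM|by apply: itgZ; exact: fM].
    by apply: eq_int01 => x _; rewrite dphi /w; ring.
  rewrite e1 => {e1}e1.
  have e2 : int01 (fun x => (f x - k) * t x) = int01 (fun x => f x * t x) - k * int01 t.
    rewrite -int01Z// -int01B; [|exact: fM|exact: itgZ].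
    by apply: eq_int01 => x _; ring.
  by rewrite e2 -e1 /k /l; ring.
have P a b : 0 < a -> a <= b -> b < 1 ->
    prim (fun x => f x - k) b = prim (fun x => f x - k) a.
  move=> a0 ab b1; apply/eqP; rewrite -subr_eq0 -int01_indic//; apply/eqP.
  have L := @int01_trapez _ a b fki.
  apply: (cvgn_unique L).
  by apply: cvg_near_cst; apply: nearW => n; exact: H.
apply: filterS (prim_const_ae0 fki _).
- exact: (ae_filter_ringOfSetsType mu).
- by move=> x /= fx /fx /eqP; rewrite subr_eq0 => /eqP.
- move=> x y /andP[x0 x1] /andP[y0 y1].
  by have [xy|/ltW yx] := leP x y; [rewrite (P x y)|rewrite (P y x)].
Qed.

End DuBoisReymond.

(** * H2 functions of one variable *)

Section SobolevTheory.
Variable R : realType.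
Implicit Types (f g h m phi : R -> R) (c M x : R).

Local Notation mu := (@lebesgue_measure R).
Local Notation I01 := (`]0, 1[%classic : set R).

Lemma itg_sqr_le h : measurable_fun I01 h -> itg (fun x => h x ^+ 2) -> itg h.
Proof.
move=> mh h2; apply: (@itg_le _ _ (fun x => 1 + h x ^+ 2)) => //.
  move=> x _; rewrite -(real_normK (num_real (h x))).
  by have := sqr_ge0 (`|h x| - 1); have := normr_ge0 (h x); nra.
by apply: itgD => //; exact: itg_cst.
Qed.

Lemma L2_meas h : L2 h -> measurable_fun I01 h.
Proof. by move=> /L2P[]. Qed.

Lemma L2_sqr h : L2 h -> itg (fun x => h x ^+ 2).
Proof. by move=> /L2P[]. Qed.

Lemma L2_itg h : L2 h -> itg h.
Proof. by move=> /L2P[]; exact: itg_sqr_le. Qed.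

Lemma L2M f g : L2 f -> L2 g -> itg (fun x => f x * g x).
Proof.
move=> /L2P[mf f2] /L2P[mg g2].
apply: (@itg_le _ _ (fun x => f x ^+ 2 + g x ^+ 2)).
- exact: measurable_funM.
- move=> x _; rewrite normrM -(real_normK (num_real (f x))) -(real_normK (num_real (g x))).
  have := normr_ge0 (f x); have := normr_ge0 (g x).
  by have := sqr_ge0 (`|f x| - `|g x|); nra.
- exact: itgD.
Qed.

Lemma L2D f g : L2 f -> L2 g -> L2 (fun x => f x + g x).
Proof.
move=> Lf Lg; have := L2M Lf Lg; move: Lf Lg => /L2P[mf f2] /L2P[mg g2] fg.
apply/L2P; split; first exact: measurable_funD.
apply: (@eq_itg _ (fun x => f x ^+ 2 + (2 * (f x * g x) + g x ^+ 2))) => [x _|].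
  by ring.
by apply: itgD => //; apply: itgD => //; exact: itgZ.
Qed.

Lemma L2_bM m f M : measurable_fun I01 m -> (forall x : R, 0 < x < 1 -> `|m x| <= M) ->
  L2 f -> L2 (fun x => m x * f x).
Proof.
move=> mm bm /L2P[mf f2]; apply/L2P; split; first exact: measurable_funM.
apply: (@eq_itg _ (fun x => m x ^+ 2 * f x ^+ 2)) => [x _|]; first by ring.
apply: (@itgM _ _ _ (M ^+ 2)) => //; first exact: measurable_funX.
move=> x x01; have H := bm x x01; rewrite normrX.
by rewrite lerXn2r ?nnegrE// (le_trans _ H).
Qed.

Lemma L2Z c f : L2 f -> L2 (fun x => c * f x).
Proof. by move=> Lf; apply: (@L2_bM _ _ `|c|). Qed.

Lemma L2_bounded f M : measurable_fun I01 f -> (forall x : R, 0 < x < 1 -> `|f x| <= M) -> L2 f.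
Proof.
move=> mf fM; apply/L2P; split => //; apply: (@itg_bounded _ _ (M ^+ 2)).
  exact: measurable_funX.
move=> x x01; have H := fM x x01; rewrite normrX.
by rewrite lerXn2r ?nnegrE// (le_trans _ H).
Qed.

Lemma L2_cont f : {within `[0, 1], continuous f} -> L2 f.
Proof.
move=> cf; have [M M0 fM] := cont_bounded cf.
by apply: (@L2_bounded _ M); [exact: cont_meas|move=> x /oo_cc; exact: fM].
Qed.

Lemma L2B f g : L2 f -> L2 g -> L2 (fun x => f x - g x).
Proof.
move=> Lf Lg; have := L2D Lf (L2Z (-1) Lg).
by under eq_fun do rewrite mulN1r.
Qed.

Lemma ae01_sym f g : ae01 f g -> ae01 g f.
Proof.
by apply: filterS; [exact: (ae_filter_ringOfSetsType mu)|move=> x H /H].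
Qed.

Lemma ae01_trans f g h : ae01 f g -> ae01 g h -> ae01 f h.
Proof.
apply: filterS2; [exact: (ae_filter_ringOfSetsType mu)|].
by move=> x H1 H2 xI; rewrite H1// H2.
Qed.

(** The primitive is identically zero, so differentiating it at interior points gives 0; the
    endpoints follow by continuity. *)
Lemma cont_ae0 f : {within `[0, 1], continuous f} -> ae01 f (cst 0) ->
  forall x : R, 0 <= x <= 1 -> f x = 0.
Proof.
move=> cf f0; have fi := cont_itg cf.
have pf x : prim f x = 0.
  rewrite (prim_ae x fi (itg_cst 0) f0) (@eq_prim _ _ (fun=> 0 * 0)) => [|//]; last first.
    by move=> *; rewrite mul0r.
  by rewrite (primZ 0 x (itg_cst 0)) mul0r.
have /(continuous_within_itvP _ ltr01)[ci c0 c1] := cf.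
have f01 (x : R) : 0 < x < 1 -> f x = 0.
  move=> x01; have [_ <-] := prim_deriv fi x01 (ci x x01).
  have -> : prim f = cst 0 by apply/funext.
  exact: derive1_cst.
move=> x /andP[]; rewrite le_eqVlt => /predU1P[<- _|x0].
  apply: (cvg_unique (@Rhausdorff R) c0); apply: cvg_near_cst.
  near=> y; apply: f01; apply/andP; split; near: y; first exact: nbhs_right_gt.
  exact: nbhs_right_lt.
rewrite le_eqVlt => /predU1P[->|x1]; last by rewrite f01// x0.
apply: (cvg_unique (@Rhausdorff R) c1); apply: cvg_near_cst.
near=> y; apply: f01; apply/andP; split; near: y; first exact: nbhs_left_gt.
exact: nbhs_left_lt.
Unshelve. all: by end_near. Qed.

(** Working form of differentiation: absolute continuity on [0, 1] with derivative [g]. Unlike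
    [weak_derivative], it gives pointwise values and combines linearly without test functions. *)
Definition primitive_of f g := forall x : R, 0 <= x <= 1 -> f x = f 0 + prim g x.

Lemma primitive_cont f g : itg g -> primitive_of f g -> {within `[0, 1], continuous f}.
Proof.
move=> gi fg.
have c : {within `[0, 1], continuous (fun x => f 0 + prim g x)}.
  by move=> x; apply: cvgD; [exact: cvg_cst|exact: (prim_cont gi)].
apply: (subspace_eq_continuous _ c) => x; rewrite inE/= in_itv/= => x01.
by rewrite /from_subspace /= [RHS]fg.
Qed.

Lemma int01_test_deriv phi : test_function phi -> int01 (derive1 phi) = 0.
Proof.
move=> tphi; have /(_ phi tphi) := @prim_weak R (cst 0) (itg_cst 0).
have [dphi cphi' _] := tphi; have cphi := test_derivable_cont dphi.
have [p0 p1] := test_function_end tphi.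
have LRphi : derivable_oo_LRcontinuous phi 0 1.
  split=> [x _|//|]; [exact: dphi|apply: cvg_at_right_filter|apply: cvg_at_left_filter];
    exact: cphi.
move=> _.
have := continuous_FTC2 ltr01 (cont_within cphi') LRphi (fun x _ => erefl).
rewrite p0 p1 sube0 => H; rewrite -int01_cc ?/Rintegral ?H//.
apply: continuous_compact_integrable; first exact: segment_compact.
exact: cont_within.
Qed.

Lemma primitive_weak f g : itg g -> primitive_of f g -> weak_derivative f g.
Proof.
move=> gi fg phi tphi; rewrite -!/(int01 _).
have [i1 i2] := itg_test (cont_itg (prim_cont gi)) tphi.
have [_ m2] := itg_test (itg_cst 1) tphi.
rewrite (@eq_int01 _ _ (fun x => f 0 * (1 * derive1 phi x) + prim g x * derive1 phi x)).
  rewrite int01D//; last exact: itgZ.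
  rewrite int01Z// (@eq_int01 _ _ (derive1 phi)); last by move=> x _; rewrite mul1r.
  by rewrite int01_test_deriv// mulr0 add0r; exact: prim_weak.
by move=> x /oo_cc /fg ->; rewrite mulrDl mul1r.
Qed.

(** [f - prim g] has zero weak derivative, hence is constant almost everywhere and, by continuity,
    everywhere; the value at 0 gives the constant. *)
Lemma weak_primitive f g : {within `[0, 1], continuous f} -> itg g ->
  weak_derivative f g -> primitive_of f g.
Proof.
move=> cf gi wf; have cp := prim_cont gi; have pi := cont_itg cp; have fi := cont_itg cf.
have di : itg (fun x => f x - prim g x) by exact: itgB.
have cd : {within `[0, 1], continuous (fun x => f x - prim g x)}.
  by move=> x; apply: cvgB; [exact: cf|exact: cp].
have [|k dk] := weak_derivative0 di.
  move=> phi tphi; rewrite -!/(int01 _).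
  have [_ i2] := itg_test fi tphi; have [_ i4] := itg_test pi tphi.
  rewrite (@eq_int01 _ _ (fun x => f x * derive1 phi x - prim g x * derive1 phi x)); last first.
    by move=> x _; rewrite mulrBl.
  rewrite int01B// (@eq_int01 _ (fun x => cst 0 x * phi x) (cst 0)); last first.
    by move=> x _; rewrite mul0r.
  have e1 := wf _ tphi; have e2 := prim_weak gi tphi; rewrite -!/(int01 _) in e1 e2.
  by rewrite e1 e2 int01_cst subrr oppr0.
have cdk : {within `[0, 1], continuous (fun x => f x - prim g x - k)}.
  by move=> x; apply: cvgB; [exact: cd|exact: cvg_cst].
have /(cont_ae0 cdk) E : ae01 (fun x => f x - prim g x - k) (cst 0).
  apply: filterS dk; first exact: (ae_filter_ringOfSetsType mu).
  by move=> x H /H ->; rewrite /= subrr.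
move=> x x01; have := E _ x01; have /E : 0 <= (0:R) <= 1 by rewrite lexx ler01.
by rewrite prim0 subr0 => /eqP; rewrite subr_eq0 => /eqP -> /eqP; rewrite !subr_eq0 subr_eq addrC => /eqP.
Qed.

Lemma primitive_unique f g h : itg g -> itg h -> primitive_of f g ->
  primitive_of f h -> ae01 g h.
Proof.
move=> gi hi fg fh.
have /prim_const_ae0 : itg (fun x => g x + -1 * h x) by apply: itgD => //; exact: itgZ.
have E (x : R) : 0 < x < 1 -> prim (fun x => g x + -1 * h x) x = 0.
  move=> /oo_cc x01; rewrite primD ?primZ//; last exact: itgZ.
  by have := fg _ x01; rewrite (fh _ x01) => /addrI ->; rewrite mulN1r subrr.
move=> /(_ (fun x y x01 y01 => etrans (E x x01) (esym (E y y01)))).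
apply: filterS; first exact: (ae_filter_ringOfSetsType mu).
by move=> x /= H /H /eqP; rewrite mulN1r subr_eq0 => /eqP.
Qed.

(** [g] shows that the set from which [deriv1] picks is nonempty, so the pick meets its
    specification; two continuous derivatives agree almost everywhere, hence everywhere on
    [0, 1]. *)
Lemma deriv1P f g : {within `[0, 1], continuous g} -> primitive_of f g ->
  [/\ {within `[0, 1], continuous (deriv1 f)}, primitive_of f (deriv1 f) &
      forall x : R, 0 <= x <= 1 -> deriv1 f x = g x].
Proof.
move=> cg fg; have gi := cont_itg cg.
have [cd wd] : {within `[0, 1], continuous (deriv1 f)} /\ weak_derivative f (deriv1 f).
  by apply: (@xgetPex _ _ [set g : R -> R | {within `[0, 1], continuous g} /\ weak_derivative f g]);
     exists g; split => //; exact: primitive_weak.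
have di := cont_itg cd.
have pd : primitive_of f (deriv1 f).
  by apply: weak_primitive => //; exact: (primitive_cont gi).
split => // x x01.
have cdg : {within `[0, 1], continuous (fun x => deriv1 f x - g x)}.
  by move=> y; apply: cvgB; [exact: cd|exact: cg].
apply/eqP; rewrite -subr_eq0; apply/eqP; move: x x01; apply: cont_ae0 => //.
apply: filterS (primitive_unique di gi pd fg); first exact: (ae_filter_ringOfSetsType mu).
by move=> x H /H ->; rewrite /= subrr.
Qed.

(** Same argument as for [deriv1], but candidates agree only almost everywhere, so later uses of
    [deriv2] stay under an integral sign. *)
Lemma deriv2P f h : {within `[0, 1], continuous (deriv1 f)} -> L2 h ->
  primitive_of (deriv1 f) h ->
  [/\ L2 (deriv2 f), primitive_of (deriv1 f) (deriv2 f) & ae01 (deriv2 f) h].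
Proof.
move=> cd Lh ph; have hi := L2_itg Lh.
have [Ld wd] : L2 (deriv2 f) /\ weak_derivative (deriv1 f) (deriv2 f).
  by apply: (@xgetPex _ _ [set g : R -> R | L2 g /\ weak_derivative (deriv1 f) g]);
     exists h; split => //; exact: primitive_weak.
have di := L2_itg Ld.
have pd : primitive_of (deriv1 f) (deriv2 f) by exact: weak_primitive.
by split => //; exact: (primitive_unique di hi pd ph).
Qed.

Lemma eq_primitive f g f' g' : (forall x : R, 0 <= x <= 1 -> f x = f' x) ->
  (forall x : R, 0 <= x <= 1 -> g x = g' x) -> primitive_of f g -> primitive_of f' g'.
Proof.
move=> ff gg fg x x01; rewrite -ff// -ff ?lexx ?ler01// fg//; congr (_ + _).
by apply: eq_prim => y /oo_cc; exact: gg.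
Qed.

(** Introduction rule: membership in H2 and both derivatives are read off from two nested
    primitives. Every curve constructed below goes through it. *)
Lemma H2I f g h : L2 h -> primitive_of f g -> primitive_of g h ->
  [/\ H2 f, forall x : R, 0 <= x <= 1 -> deriv1 f x = g x & ae01 (deriv2 f) h].
Proof.
move=> Lh fg gh; have hi := L2_itg Lh.
have cg := primitive_cont hi gh; have gi := cont_itg cg.
have [cd pd E] := deriv1P cg fg.
have [|_ _ ae2] := deriv2P cd Lh.
  by apply: (eq_primitive _ _ gh) => // x x01; rewrite E.
split=> //; split; first exact: (primitive_cont gi).
by exists g, h; split=> //; [exact: L2_cont|exact: primitive_weak..].
Qed.

(** The definition gives a first derivative that is only square integrable. It differs from the
    primitive of [f2] by a constant almost everywhere, so it has a continuous representative, and
    the picks of [deriv1] and [deriv2] are legitimate. *)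
Lemma H2E f : H2 f ->
  [/\ {within `[0, 1], continuous (deriv1 f)}, L2 (deriv2 f),
      primitive_of f (deriv1 f) & primitive_of (deriv1 f) (deriv2 f)].
Proof.
move=> [cf [f1 [f2 [L1 L2f w1 w2]]]].
have i1 := L2_itg L1; have i2 := L2_itg L2f.
have di : itg (fun x => f1 x - prim f2 x).
  by apply: itgB => //; apply: cont_itg; exact: prim_cont.
have [|k dk] := weak_derivative0 di.
  move=> phi tphi; rewrite -!/(int01 _).
  have pi := cont_itg (prim_cont i2).
  have [_ j2] := itg_test i1 tphi; have [_ j4] := itg_test pi tphi.
  rewrite (@eq_int01 _ _ (fun x => f1 x * derive1 phi x - prim f2 x * derive1 phi x)); last first.
    by move=> x _; rewrite mulrBl.
  rewrite int01B// (@eq_int01 _ (fun x => cst 0 x * phi x) (cst 0)); last first.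
    by move=> x _; rewrite mul0r.
  have e1 := w2 _ tphi; have e2 := prim_weak i2 tphi; rewrite -!/(int01 _) in e1 e2.
  by rewrite e1 e2 int01_cst subrr oppr0.
pose g x := k + prim f2 x.
have pg : primitive_of g f2 by move=> x _; rewrite /g prim0 addr0.
have f1g : ae01 f1 g.
  apply: filterS dk; first exact: (ae_filter_ringOfSetsType mu).
  by move=> x H /H; rewrite /g /= => <-; rewrite subrK.
have cg := primitive_cont i2 pg; have gi := cont_itg cg.
have fg : primitive_of f g.
  move=> x x01; rewrite (weak_primitive cf i1 w1 x01); congr (_ + _).
  exact: prim_ae.
have [cd pd E] := deriv1P cg fg.
have [|L2d p2 _] := deriv2P cd L2f.
  by apply: (eq_primitive _ _ pg) => // x x01; rewrite E.
by split.
Qed.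

End SobolevTheory.

(** * H2 curves *)

Section CurveTheory.
Variable R : realType.
Implicit Types (f g h : R -> R) (a c x : R) (gamma : curve R) (u v : 'rV[R]_2).

Local Notation mu := (@lebesgue_measure R).

(** Nonnegativity of the polynomial in t given by the integral of (f + t g)^2, at its minimum. *)
Lemma CauchySchwarz01 f g : L2 f -> L2 g ->
  int01 (fun x => f x * g x) ^+ 2 <= int01 (fun x => f x ^+ 2) * int01 (fun x => g x ^+ 2).
Proof.
move=> Lf Lg; have fgi := L2M Lf Lg; have fi := L2_sqr Lf; have gi := L2_sqr Lg.
set A := int01 _; set B := int01 (fun x => f x ^+ 2); set C := int01 (fun x => g x ^+ 2).
have H t : 0 <= B + (2 * t) * A + t ^+ 2 * C.
  have -> : B + (2 * t) * A + t ^+ 2 * C = int01 (fun x => (f x + t * g x) ^+ 2).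
    transitivity (int01 (fun x => f x ^+ 2 + (2 * t) * (f x * g x) + t ^+ 2 * g x ^+ 2)).
      have j1 := itgZ (2 * t) fgi; have j2 := itgZ (t ^+ 2) gi.
      by rewrite int01D//; [rewrite int01D// !int01Z|exact: itgD].
    by apply: eq_int01 => x _; ring.
  by apply: int01_ge0 => x _; exact: sqr_ge0.
have C0 : 0 <= C by apply: int01_ge0 => x _; exact: sqr_ge0.
have [C00|C00] := eqVneq C 0.
  rewrite C00 mulr0; have [->|A0] := eqVneq A 0; first by rewrite expr0n.
  (* When [C] is 0 the polynomial is affine; at this point it would equal -1. *)
  have := H (- (B + 1) / (2 * A)); rewrite C00 mulr0 addr0.
  have -> : 2 * (- (B + 1) / (2 * A)) * A = - (B + 1) by field.
  by rewrite opprD addrA subrr add0r oppr_ge0 leNgt ltr01.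
have Cp : 0 < C by rewrite lt_neqAle eq_sym C00.
have := H (- A / C).
have -> : B + 2 * (- A / C) * A + (- A / C) ^+ 2 * C = (B * C - A ^+ 2) / C by field.
by rewrite pmulr_lge0 ?invr_gt0// subr_ge0.
Qed.

Lemma int01_sqr_le f : L2 f -> int01 f ^+ 2 <= int01 (fun x => f x ^+ 2).
Proof.
move=> Lf; have := CauchySchwarz01 Lf (@L2_bounded _ (cst 1) 1 _ _) => /=.
rewrite expr1n int01_cst mulr1 => H.
rewrite (@eq_int01 _ f (fun x => f x * 1)); last by move=> x _; rewrite mulr1.
by apply: H => // x _; rewrite normr1.
Qed.

Lemma L2_norm f : L2 f -> L2 (fun x => `|f x|).
Proof.
move=> Lf; have mf := L2_meas Lf; apply/L2P; split; first exact: measurableT_comp.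
apply: eq_itg (L2_sqr Lf) => x _; by rewrite real_normK// num_real.
Qed.

Lemma int01_norm_sqr_le f : L2 f -> int01 (fun x => `|f x|) ^+ 2 <= int01 (fun x => f x ^+ 2).
Proof.
move=> Lf; apply: (le_trans (int01_sqr_le (L2_norm Lf))).
rewrite (@eq_int01 _ _ (fun x => f x ^+ 2)) => // x _.
by rewrite real_normK// num_real.
Qed.

Lemma primitive_sqr_le f g x : L2 g -> primitive_of f g -> 0 <= x <= 1 ->
  (f x - f 0) ^+ 2 <= int01 (fun x => g x ^+ 2).
Proof.
move=> Lg fg x01; apply: le_trans (int01_norm_sqr_le Lg).
rewrite fg// addrAC subrr add0r -(real_normK (num_real (prim g x))).
have H := prim_le x (L2_itg Lg).
by rewrite lerXn2r ?nnegrE// (le_trans _ H).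
Qed.

Lemma H2_lin a f g : H2 f -> H2 g ->
  [/\ H2 (fun x => a * f x + g x),
     forall x : R, 0 <= x <= 1 ->
       deriv1 (fun x => a * f x + g x) x = a * deriv1 f x + deriv1 g x &
     ae01 (deriv2 (fun x => a * f x + g x)) (fun x => a * deriv2 f x + deriv2 g x)].
Proof.
move=> /H2E[c1 L1 p1 q1] /H2E[c2 L2' p2 q2].
apply: H2I.
- by apply: L2D => //; exact: L2Z.
- move=> x x01; rewrite p1// p2// primD; [|by apply: itgZ; exact: cont_itg|exact: cont_itg].
  by rewrite primZ; [rewrite mulrDr addrACA|exact: cont_itg].
- move=> x x01; rewrite q1// q2// primD; [|by apply: itgZ; exact: L2_itg|exact: L2_itg].
  by rewrite primZ; [rewrite mulrDr addrACA|exact: L2_itg].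
Qed.

(** * Euclidean structure of the plane and norms of curves *)

Lemma dotpE u v : dotp u v = u 0 0 * v 0 0 + u 0 1 * v 0 1.
Proof.
rewrite /dotp big_ord_recl big_ord1; congr (_ + u 0 _ * v 0 _); exact: val_inj.
Qed.

Lemma rv2P u v : u 0 0 = v 0 0 -> u 0 1 = v 0 1 -> u = v.
Proof.
move=> e0 e1; apply/rowP => j; case: j => -[|[|//]] i.
  by rewrite (_ : Ordinal i = 0)//; exact: val_inj.
by rewrite (_ : Ordinal i = 1)//; exact: val_inj.
Qed.

Lemma enorm_sqr u : enorm u ^+ 2 = dotp u u.
Proof. by rewrite /enorm sqr_sqrtr// dotpE -!expr2 addr_ge0// sqr_ge0. Qed.

Lemma enorm_sqrE u : enorm u ^+ 2 = u 0 0 ^+ 2 + u 0 1 ^+ 2.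
Proof. by rewrite enorm_sqr dotpE -!expr2. Qed.

Lemma enorm_ge0 u : 0 <= enorm u. Proof. exact: sqrtr_ge0. Qed.

Lemma enorm_sumE u : enorm u ^+ 2 = \sum_j u 0 j ^+ 2.
Proof. by rewrite enorm_sqr; apply: eq_bigr => j _; rewrite expr2. Qed.

Lemma coord_le_enorm u j : u 0 j ^+ 2 <= enorm u ^+ 2.
Proof.
rewrite enorm_sumE (bigD1 j)//= lerDl; apply: sumr_ge0 => i _; exact: sqr_ge0.
Qed.

Lemma itg_sum n (F : 'I_n -> R -> R) : (forall i, itg (F i)) ->
  itg (fun x => \sum_i F i x).
Proof.
move=> Fi; have : itg (fun x => \sum_(i <- index_enum 'I_n) F i x).
  elim: (index_enum 'I_n) => [|i s IH].
    by under eq_fun do rewrite big_nil; exact: itg_cst.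
  by under eq_fun do rewrite big_cons; apply: itgD.
exact.
Qed.

Lemma int01_sum n (F : 'I_n -> R -> R) : (forall i, itg (F i)) ->
  int01 (fun x => \sum_i F i x) = \sum_i int01 (F i).
Proof.
move=> Fi; elim: n F Fi => [|n IH] F Fi.
  by under eq_fun do rewrite big_ord0; rewrite int01_cst big_ord0.
under eq_fun do rewrite big_ord_recl.
by rewrite int01D//; [rewrite IH// big_ord_recl|exact: itg_sum].
Qed.

Lemma curve_dxx_itg gamma : curve_H2 gamma ->
  itg (fun x => enorm (dxx gamma x) ^+ 2) /\
  int01 (fun x => enorm (dxx gamma x) ^+ 2) =
    \sum_j int01 (fun x => deriv2 (fun y => gamma y 0 j) x ^+ 2).
Proof.
move=> H; have E x : enorm (dxx gamma x) ^+ 2 = \sum_j deriv2 (fun y => gamma y 0 j) x ^+ 2.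
  by rewrite enorm_sumE; apply: eq_bigr => j _; rewrite mxE.
under eq_fun do rewrite E.
have I j : itg (fun x => deriv2 (fun y => gamma y 0 j) x ^+ 2).
  by have [_ Ld _ _] := H2E (H j); exact: L2_sqr.
by split; [exact: itg_sum|exact: int01_sum].
Qed.

Lemma norm_H2_sqr gamma : curve_H2 gamma ->
  norm_H2 gamma ^+ 2 = \sum_j (int01 (fun x => gamma x 0 j ^+ 2) +
    int01 (fun x => deriv1 (fun y => gamma y 0 j) x ^+ 2) +
    int01 (fun x => deriv2 (fun y => gamma y 0 j) x ^+ 2)).
Proof.
move=> H; rewrite /norm_H2 sqr_sqrtr; last first.
  by apply: int01_ge0 => x _; rewrite !addr_ge0// sqr_ge0.
rewrite -/(int01 _).
transitivity (int01 (fun x => \sum_j (gamma x 0 j ^+ 2 +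
    deriv1 (fun y => gamma y 0 j) x ^+ 2 + deriv2 (fun y => gamma y 0 j) x ^+ 2))).
  apply: eq_int01 => x _; rewrite !enorm_sumE -!big_split/=; apply: eq_bigr => j _.
  by rewrite !mxE.
have I0 j : itg (fun x => gamma x 0 j ^+ 2).
  by have [c _] := H j; exact: L2_sqr (L2_cont c).
have I1 j : itg (fun x => deriv1 (fun y => gamma y 0 j) x ^+ 2).
  by have [c _ _ _] := H2E (H j); exact: L2_sqr (L2_cont c).
have I2 j : itg (fun x => deriv2 (fun y => gamma y 0 j) x ^+ 2).
  by have [_ Ld _ _] := H2E (H j); exact: L2_sqr.
rewrite int01_sum => [|j]; last by apply: itgD => //; exact: itgD.
by apply: eq_bigr => j _; rewrite int01D ?int01D//; exact: itgD.
Qed.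

Lemma norm_H2_ge gamma j : curve_H2 gamma ->
  int01 (fun x => deriv1 (fun y => gamma y 0 j) x ^+ 2) +
    int01 (fun x => deriv2 (fun y => gamma y 0 j) x ^+ 2) <= norm_H2 gamma ^+ 2.
Proof.
move=> H; rewrite norm_H2_sqr// (bigD1 j)//= -addrA -[leLHS]add0r -addrA lerD//.
  by apply: int01_ge0 => x _; exact: sqr_ge0.
rewrite addrA lerDl; apply: sumr_ge0 => i _; rewrite !addr_ge0//; apply: int01_ge0 => x _; exact: sqr_ge0.
Qed.

Lemma sqr_le_2D (s t K : R) : (s - t) ^+ 2 <= K ->
  s ^+ 2 <= 2 * t ^+ 2 + 2 * K /\ t ^+ 2 <= 2 * s ^+ 2 + 2 * K.
Proof. by move=> H; split; have := sqr_ge0 (s - t *+ 2); have := sqr_ge0 (s *+ 2 - t); nra. Qed.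

(** All values of the first derivative are within the L2 norm of the second one from its value at 0;
    averaging over the interval bounds the value at 0 by the norm. *)
Lemma dual_deriv1 (j : 'I_2) x : 0 <= x <= 1 -> dual_H2 (fun gamma => dx gamma x 0 j).
Proof.
move=> x01; split => [a g1 g2 H1 H2|].
  rewrite !mxE; under eq_fun do rewrite !mxE.
  by have [_ E _] := H2_lin a (H1 j) (H2 j); exact: E.
(* With [G] and [K] below, the square of the value is at most 4 G + 6 K, and 6 <= 4^2. *)
exists 4 => gamma H; rewrite mxE.
have [c1 L p q] := H2E (H j).
set g := deriv1 _ in c1 p q *; set h := deriv2 _ in L q.
have N0 : 0 <= norm_H2 gamma by exact: sqrtr_ge0.
rewrite -ler_sqr ?nnegrE ?mulr_ge0// real_normK ?num_real// exprMn.
have := norm_H2_ge j H; rewrite -/g -/h.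
set G := int01 (fun x => g x ^+ 2); set K := int01 (fun x => h x ^+ 2) => GK.
have K0 : 0 <= K by apply: int01_ge0 => y _; exact: sqr_ge0.
have G0 : 0 <= G by apply: int01_ge0 => y _; exact: sqr_ge0.
have hx := primitive_sqr_le L q x01; rewrite -/K in hx.
have h0 : g 0 ^+ 2 <= 2 * G + 2 * K.
  have j1 : itg (fun y => 2 * g y ^+ 2) by apply: itgZ; exact: L2_sqr (L2_cont c1).
  have -> : 2 * G + 2 * K = int01 (fun y => 2 * g y ^+ 2 + 2 * K).
    rewrite int01D//; last exact: itg_cst.
    by rewrite int01Z ?int01_cst//; exact: L2_sqr (L2_cont c1).
  rewrite -(int01_cst (g 0 ^+ 2)); apply: le_int01; first exact: itg_cst.
    by apply: itgD => //; exact: itg_cst.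
  move=> y /oo_cc y01; have := primitive_sqr_le L q y01; rewrite -/K.
  by move=> /sqr_le_2D[].
have [gx _] := sqr_le_2D hx.
clearbody G K; apply: (le_trans gx); move: h0 GK K0 G0.
by move: (g 0 ^+ 2) (norm_H2 gamma ^+ 2) => s t; lra.
Qed.

(** Cauchy-Schwarz gives the bound. [deriv2] is linear only almost everywhere, which suffices under
    the integral. *)
Lemma dual_deriv2 (j : 'I_2) k : L2 k ->
  dual_H2 (fun gamma => int01 (fun x => deriv2 (fun y => gamma y 0 j) x * k x)).
Proof.
move=> Lk; split => [a g1 g2 H1 H2|].
  under [X in deriv2 X]eq_fun do rewrite !mxE.
  have [H3 _ e] := H2_lin a (H1 j) (H2 j).
  have [_ L1 _ _] := H2E (H1 j); have [_ L2' _ _] := H2E (H2 j).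
  have [_ L3 _ _] := H2E H3.
  rewrite -int01Z; last exact: L2M.
  rewrite -int01D; [|by apply: itgZ; exact: L2M|exact: L2M].
  apply: ae_int01.
  - by apply: itg_meas; exact: L2M.
  - by apply: itg_meas; apply: itgD; [apply: itgZ|]; exact: L2M.
  - apply: filterS e; first exact: (ae_filter_ringOfSetsType mu).
    by move=> x H /H ->; rewrite mulrDl mulrA.
exists (Num.sqrt (int01 (fun x => k x ^+ 2))) => gamma H.
have [_ L _ _] := H2E (H j).
have N0 : 0 <= norm_H2 gamma by exact: sqrtr_ge0.
have K0 : 0 <= int01 (fun x => k x ^+ 2) by apply: int01_ge0 => y _; exact: sqr_ge0.
rewrite -ler_sqr ?nnegrE ?mulr_ge0 ?sqrtr_ge0// real_normK ?num_real// exprMn sqr_sqrtr//.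
apply: (le_trans (CauchySchwarz01 L Lk)); rewrite mulrC ler_wpM2l//.
apply: le_trans (norm_H2_ge j H); rewrite lerDr.
by apply: int01_ge0 => y _; exact: sqr_ge0.
Qed.

End CurveTheory.

(** * Lower semicontinuity of the energy *)

Section LowerBound.
Variable R : realType.
Implicit Types (g : R -> R) (c M x : R) (gamma : curve R) (u : 'rV[R]_2).

Lemma cvgn_sum n (u : 'I_n -> nat -> R) (l : 'I_n -> R) (P : pred 'I_n) :
  (forall i, P i -> u i k @[k --> \oo] --> l i) ->
  \sum_(i | P i) u i k @[k --> \oo] --> \sum_(i | P i) l i.
Proof.
move=> H; elim: (index_enum _) => [|i s IH].
  by under eq_fun do rewrite big_nil; rewrite big_nil; exact: cvg_cst.
rewrite big_cons; case: ifPn => Pi.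
  by under eq_fun do rewrite big_cons Pi; apply: cvgD => //; exact: H.
by under eq_fun do rewrite big_cons (negbTE Pi).
Qed.

Lemma cvgn_sqr (u : nat -> R) (l : R) : u n @[n --> \oo] --> l ->
  u n ^+ 2 @[n --> \oo] --> l ^+ 2.
Proof. by move=> ul; rewrite expr2; under eq_fun do rewrite expr2; exact: cvgM. Qed.

Lemma cvgn_cube (u : nat -> R) (l : R) : u n @[n --> \oo] --> l ->
  u n ^+ 3 @[n --> \oo] --> l ^+ 3.
Proof.
by move=> ul; rewrite exprS; under eq_fun do rewrite exprS; apply: cvgM => //; exact: cvgn_sqr.
Qed.

(** Infinitely many indices suffice to pass to the limit; this fits bounds that hold only along a
    subsequence. *)
Lemma cvgn_frequently_le0 (u : nat -> R) (l : R) : u n @[n --> \oo] --> l ->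
  (forall N, exists2 n, (N <= n)%N & u n <= 0) -> l <= 0.
Proof.
move=> ul H; rewrite leNgt; apply/negP => l0.
have /cvgr_gt/(_ 0 l0)[N _ HN] := ul.
by have [n /HN/= + un] := H N; rewrite ltNge un.
Qed.

Lemma len_ge0 gamma : 0 <= len gamma.
Proof. by apply: int01_ge0 => x _; exact: enorm_ge0. Qed.

Lemma oo_in (x : R) : (x \in `[0, 1]) = (0 <= x <= 1).
Proof. by rewrite in_itv. Qed.

Lemma zero01 : 0 <= (0 : R) <= 1. Proof. by rewrite lexx ler01. Qed.
Lemma one01 : 0 <= (1 : R) <= 1. Proof. by rewrite lexx ler01. Qed.

Lemma constant_speed0 gamma : constant_speed gamma -> enorm (dx gamma 0) = len gamma.
Proof. by move=> cs; apply: cs; rewrite oo_in zero01. Qed.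

Lemma energy_ge0 gamma : 0 <= energy gamma.
Proof.
rewrite addr_ge0 ?len_ge0// mulr_ge0 ?invr_ge0 ?exprn_ge0 ?len_ge0//.
by apply: int01_ge0 => x _; exact: sqr_ge0.
Qed.

Definition bending gamma : R := int01 (fun x => enorm (dxx gamma x) ^+ 2).

(** The L2 scalar product of the second derivatives, whose quadratic form is [bending]. *)
Definition bilin gamma1 gamma2 : R := \sum_j
  int01 (fun x => deriv2 (fun y => gamma1 y 0 j) x * deriv2 (fun y => gamma2 y 0 j) x).

Lemma energyE gamma : energy gamma = (len gamma ^+ 3)^-1 * bending gamma + len gamma.
Proof. by []. Qed.

Lemma bendingE gamma : curve_H2 gamma -> bending gamma =
  \sum_j int01 (fun x => deriv2 (fun y => gamma y 0 j) x ^+ 2).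
Proof. by move=> /curve_dxx_itg[]. Qed.

Lemma bending_bilin gamma : curve_H2 gamma -> bending gamma = bilin gamma gamma.
Proof. by move=> /bendingE ->; apply: eq_bigr => j _; apply: eq_int01 => x _; rewrite expr2. Qed.

(** Integrated form of 2 s t - t^2 <= s^2; the left side is affine in the second derivative of
    [gamma1]. *)
Lemma bilin_le gamma1 gamma2 : curve_H2 gamma1 -> curve_H2 gamma2 ->
  2 * bilin gamma1 gamma2 - bending gamma2 <= bending gamma1.
Proof.
move=> H1 H2; rewrite !bendingE// lerBlDr mulr_sumr -big_split/=; apply: ler_sum => j _.
have [_ L1 _ _] := H2E (H1 j); have [_ L2' _ _] := H2E (H2 j).
rewrite -int01Z; last exact: L2M.
rewrite -int01D; [|exact: L2_sqr..].
apply: le_int01; [by apply: itgZ; exact: L2M|by apply: itgD; exact: L2_sqr|].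
move=> x _; move: (deriv2 _ x) (deriv2 _ x) => s t.
by have := sqr_ge0 (s - t); nra.
Qed.

Lemma energy_bound gamma M : 0 < len gamma -> energy gamma <= M ->
  bending gamma <= M * len gamma ^+ 3.
Proof.
move=> L0 EM; rewrite -ler_pdivrMr ?exprn_gt0// mulrC.
by apply: le_trans EM; rewrite lerDl len_ge0.
Qed.

Lemma dxx_coord_le gamma j : curve_H2 gamma ->
  int01 (fun x => deriv2 (fun y => gamma y 0 j) x ^+ 2) <=
  bending gamma.
Proof.
move=> H; rewrite bendingE// (bigD1 j)//= lerDl.
by apply: sumr_ge0 => i _; apply: int01_ge0 => x _; exact: sqr_ge0.
Qed.

(** The second derivative has squared L2 norm at most M L^3. After division by the speed L, each
    coordinate of the tangent moves by at most sqrt (M L). *)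
Lemma dx_oscillation gamma M x j : curve_H2 gamma -> 0 < len gamma -> energy gamma <= M ->
  0 <= x <= 1 -> (dx gamma x 0 j - dx gamma 0 0 j) ^+ 2 <= M * len gamma ^+ 3.
Proof.
move=> H L0 EM x01; apply: le_trans (energy_bound L0 EM).
apply: le_trans (dxx_coord_le j H); rewrite !mxE.
by have [_ L _ q] := H2E (H j); exact: primitive_sqr_le.
Qed.

(** The chord is the mean of the derivative, so it inherits the oscillation bound. For small L the
    error M L^3 is negligible against L^2, the squared norm of the initial derivative. *)
Lemma chord_estimate gamma M j : curve_H2 gamma -> 0 < len gamma -> energy gamma <= M ->
  (gamma 1 0 j - gamma 0 0 j - dx gamma 0 0 j) ^+ 2 <= M * len gamma ^+ 3.
Proof.
move=> H L0 EM; have [c L p q] := H2E (H j).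
have E : gamma 1 0 j - gamma 0 0 j - dx gamma 0 0 j =
  int01 (fun x => dx gamma x 0 j - dx gamma 0 0 j).
  have := p 1 one01; rewrite prim1 => ->; rewrite (addrC (gamma 0 0 j)) addrK.
  rewrite [RHS](@eq_int01 _ _ (fun x => deriv1 (fun y => gamma y 0 j) x - dx gamma 0 0 j)).
    by rewrite int01B ?int01_cst//; [exact: cont_itg|exact: itg_cst].
  by move=> x _; rewrite mxE.
rewrite E.
have Ld : L2 (fun x => dx gamma x 0 j - dx gamma 0 0 j).
  under eq_fun do rewrite mxE.
  by apply: L2_cont => x; apply: cvgB; [exact: c|exact: cvg_cst].
apply: (le_trans (int01_sqr_le Ld)).
rewrite -[leRHS]int01_cst; apply: le_int01; [exact: L2_sqr|exact: itg_cst|].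
by move=> x /oo_cc x01; exact: dx_oscillation.
Qed.

Section WeakConvergence.
Variables (gamma_ : nat -> curve R) (gamma : curve R).
Hypotheses (wc : weak_cvg_H2 gamma_ gamma).

Lemma weak_cvg_dx x j : 0 <= x <= 1 ->
  dx (gamma_ n) x 0 j @[n --> \oo] --> dx gamma x 0 j.
Proof. by move=> x01; exact: (wc (dual_deriv1 j x01)). Qed.

Lemma weak_cvg_speed x : 0 <= x <= 1 ->
  enorm (dx (gamma_ n) x) @[n --> \oo] --> enorm (dx gamma x).
Proof.
move=> x01.
have D : dotp (dx (gamma_ n) x) (dx (gamma_ n) x) @[n --> \oo] --> dotp (dx gamma x) (dx gamma x).
  rewrite dotpE; under eq_fun do rewrite dotpE.
  by apply: cvgD; apply: cvgM; exact: weak_cvg_dx.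
by apply: continuous_cvg D; exact: sqrt_continuous.
Qed.

Hypotheses (cs_ : forall n, constant_speed (gamma_ n)) (cs : constant_speed gamma).

(** Length is an integral, but constant speed makes it the speed at 0, a continuous function of
    point evaluations. *)
Lemma weak_cvg_len : len (gamma_ n) @[n --> \oo] --> len gamma.
Proof.
rewrite -(constant_speed0 cs).
have -> : (fun n => len (gamma_ n)) = (fun n => enorm (dx (gamma_ n) 0)).
  by apply/funext => n; exact: esym (constant_speed0 (cs_ n)).
exact: weak_cvg_speed zero01.
Qed.

Lemma weak_cvg_tangent x j : 0 < len gamma -> 0 <= x <= 1 ->
  tangent (gamma_ n) x 0 j @[n --> \oo] --> tangent gamma x 0 j.
Proof.
move=> L0 x01; have E (g : curve R) : tangent g x 0 j = (enorm (dx g x))^-1 * dx g x 0 j by rewrite mxE.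
rewrite E; under eq_fun do rewrite E.
apply: cvgM; last exact: weak_cvg_dx.
by apply: cvgV; [rewrite cs ?gt_eqF ?oo_in|exact: weak_cvg_speed].
Qed.

Hypotheses (H_ : forall n, curve_H2 (gamma_ n)) (H : curve_H2 gamma).

(* Linearization of the energy at gamma; it converges along weakly convergent
   sequences because it is affine in the second derivative. *)
Definition energy_lb n : R :=
  (len (gamma_ n) ^+ 3)^-1 * (2 * bilin (gamma_ n) gamma - bending gamma) + len (gamma_ n).

Lemma energy_lb_le n : energy_lb n <= energy (gamma_ n).
Proof.
rewrite energyE lerD2r ler_wpM2l ?invr_ge0 ?exprn_ge0 ?len_ge0//.
by apply: bilin_le; [exact: H_|exact: H].
Qed.

Lemma weak_cvg_bilin : bilin (gamma_ n) gamma @[n --> \oo] --> bending gamma.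
Proof.
rewrite (bending_bilin H); apply: (@cvgn_sum _ _ _ xpredT) => j _.
have [_ L _ _] := H2E (H j).
exact: (wc (dual_deriv2 j L)).
Qed.

Lemma energy_lb_cvg : 0 < len gamma -> energy_lb n @[n --> \oo] --> energy gamma.
Proof.
move=> L0; have cl := weak_cvg_len; have cb := weak_cvg_bilin.
rewrite energyE; apply: cvgD; last exact: cl.
have {2}-> : bending gamma = 2 * bending gamma - bending gamma by rewrite mulrDl mul1r addrK.
apply: cvgM; last first.
  by apply: cvgB; [apply: cvgM => //|]; exact: cvg_cst.
apply: cvgV; first by rewrite expf_neq0// gt_eqF.
exact: cvgn_cube.
Qed.

End WeakConvergence.

End LowerBound.

(** * Lengths of the curves of a Theta-network *)

Section NetworkLowerBound.
Variable R : realType.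
Implicit Types (f g h : R -> R) (a b c M x : R) (gamma : curve R) (u v w : 'rV[R]_2) (Gamma : triple R).

Lemma sum_ord3 (V : zmodType) (F : 'I_3 -> V) (i k l : 'I_3) : i != k -> i != l -> k != l ->
  \sum_j F j = F i + F k + F l.
Proof.
move=> ik il kl; rewrite (bigD1 i)//= (bigD1 k)/= 1?eq_sym// (bigD1 l)/=; last first.
  by rewrite ![l == _]eq_sym il kl.
rewrite big1 ?addr0 ?addrA// => j /andP[/andP[ji jk] jl]; exfalso.
move: ik il kl ji jk jl.
by case: i => -[|[|[|//]]] ?; case: k => -[|[|[|//]]] ?; case: l => -[|[|[|//]]] ?;
  case: j => -[|[|[|//]]] ?.
Qed.

Lemma third_ord3 (i k : 'I_3) : i != k -> exists l : 'I_3, i != l /\ k != l.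
Proof.
move=> ik; pose s : seq 'I_3 := [:: inord 0; inord 1; inord 2].
have H : exists l : 'I_3, (i != l) && (k != l).
  apply/existsP; move: ik.
  by case: i => -[|[|[|//]]] ?; case: k => -[|[|[|//]]] ? // _;
   apply/existsP; [exists (inord 2)|exists (inord 1)|exists (inord 2)|exists (inord 0)|exists (inord 1)|exists (inord 0)];
   rewrite -!val_eqE/= !inordK.
by have [l /andP[il kl]] := H; exists l.
Qed.

(** Take the squared norm of w = - (u + v). *)
Lemma unit_dot u v w : dotp u u = 1 -> dotp v v = 1 -> dotp w w = 1 ->
  u + v + w = 0 -> dotp u v = - 2^-1.
Proof.
rewrite !dotpE => u1 v1 w1 /rowP E; have := E 0; have := E 1; rewrite !mxE => e1 e0.
move: e0 e1 u1 v1 w1.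
move: (u 0 0) (u 0 1) (v 0 0) (v 0 1) (w 0 0) (w 0 1) => a b c d e f e0 e1.
have -> : e = - (a + c) by lra.
have -> : f = - (b + d) by lra.
lra.
Qed.

(** The sum s = u + v is a unit vector, and u, v, w all have component 1/2 along it. So w - u and w
    - v are orthogonal to s, and they are also orthogonal to each other; in the plane one of them
    must vanish. *)
Lemma unit_pair u v w t : dotp u u = 1 -> dotp v v = 1 -> dotp w w = 1 -> dotp t t = 1 ->
  dotp u v = - 2^-1 -> dotp w t = - 2^-1 -> u + v = w + t ->
  (w = u /\ t = v) \/ (w = v /\ t = u).
Proof.
rewrite !dotpE => u1 v1 w1 t1 uv wt s.
have s0 : u 0 0 + v 0 0 = w 0 0 + t 0 0 by move/rowP : s => /(_ 0); rewrite !mxE.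
have s1 : u 0 1 + v 0 1 = w 0 1 + t 0 1 by move/rowP : s => /(_ 1); rewrite !mxE.
have wuE : w = u -> t = v by move=> wu; move: s; rewrite wu => /addrI.
have wvE : w = v -> t = u by move=> wv; move: s; rewrite wv addrC => /addrI.
suff [wu|wv] : w = u \/ w = v by [left; split=> //; exact: wuE|right; split => //; exact: wvE].
move: (@rv2P _ w u) (@rv2P _ w v) u1 v1 w1 t1 uv wt s0 s1.
move: (w = u) (w = v) (u 0 0) (u 0 1) (v 0 0) (v 0 1) (w 0 0) (w 0 1) (t 0 0) (t 0 1).
move=> wu wv a b c d e f g h {s wuE wvE} Hu Hv u1 v1 w1 t1 uv wt s0 s1.
have gE : g = a + c - e by lra.
have hE : h = b + d - f by lra.
have ss : (a + c) ^+ 2 + (b + d) ^+ 2 = 1 by nra.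
have ws : e * (a + c) + f * (b + d) = 2^-1 by rewrite gE hE in wt; nra.
have Ps : (e - a) * (a + c) + (f - b) * (b + d) = 0 by nra.
have Qs : (e - c) * (a + c) + (f - d) * (b + d) = 0 by nra.
(* The left side is |w|^2 - w.(u + v) + u.v = 1 - 1/2 - 1/2. *)
have PQ : (e - a) * (e - c) + (f - b) * (f - d) = 0 by nra.
have ortho (x y : R) : x * (a + c) + y * (b + d) = 0 -> y * (a + c) - x * (b + d) = 0 -> x = 0 /\ y = 0.
  move=> h1 h2; split.
    rewrite -[x]mulr1 -ss.
    have -> : x * ((a + c) ^+ 2 + (b + d) ^+ 2) = (a + c) * (x * (a + c) + y * (b + d))
       - (b + d) * (y * (a + c) - x * (b + d)) by ring.
    by rewrite h1 h2 !mulr0 subrr.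
  rewrite -[y]mulr1 -ss.
  have -> : y * ((a + c) ^+ 2 + (b + d) ^+ 2) = (b + d) * (x * (a + c) + y * (b + d))
       + (a + c) * (y * (a + c) - x * (b + d)) by ring.
  by rewrite h1 h2 !mulr0 addr0.
(* The factors are the components of w - u and w - v across s; their product is computed by
   Lagrange's identity. *)
have : ((f - b) * (a + c) - (e - a) * (b + d)) * ((f - d) * (a + c) - (e - c) * (b + d)) = 0.
  have -> : ((f - b) * (a + c) - (e - a) * (b + d)) * ((f - d) * (a + c) - (e - c) * (b + d)) =
    ((e - a) * (e - c) + (f - b) * (f - d)) * ((a + c) ^+ 2 + (b + d) ^+ 2) -
    ((e - a) * (a + c) + (f - b) * (b + d)) * ((e - c) * (a + c) + (f - d) * (b + d)) by ring.
  by rewrite PQ Ps !mul0r subrr.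
move/eqP; rewrite mulf_eq0 => /orP[]/eqP lam.
  by left; have [x0 y0] := ortho _ _ Ps lam; apply: Hu; lra.
by right; have [x0 y0] := ortho _ _ Qs lam; apply: Hv; lra.
Qed.

(* The common chord v is within L / 10 of L a and within K / 10 of K b, hence
   almost parallel to both a and b. *)
Lemma opposite_chords (v0 v1 a0 a1 b0 b1 L K : R) : 0 < L -> 0 < K ->
  a0 * a0 + a1 * a1 = 1 -> b0 * b0 + b1 * b1 = 1 -> a0 * b0 + a1 * b1 = - 2^-1 ->
  (v0 - L * a0) ^+ 2 <= L ^+ 2 / 100 -> (v1 - L * a1) ^+ 2 <= L ^+ 2 / 100 ->
  (v0 - K * b0) ^+ 2 <= K ^+ 2 / 100 -> (v1 - K * b1) ^+ 2 <= K ^+ 2 / 100 -> False.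
Proof.
move=> L0 K0 a1E b1E ab.
have scale (c d N : R) : 0 < N -> (c - N * d) ^+ 2 <= N ^+ 2 / 100 ->
    exists e, c = N * (d + e) /\ `|e| <= 10^-1.
  move=> N0 H; exists (c / N - d); split; first by field; rewrite gt_eqF.
  have : (c / N - d) ^+ 2 <= 10^-1 ^+ 2.
    have -> : c / N - d = (c - N * d) / N by field; rewrite gt_eqF.
    rewrite expr_div_n ler_pdivrMr ?exprn_gt0//; apply: (le_trans H); lra.
  by rewrite -(real_normK (num_real (c / N - d))) ler_sqr// nnegrE; lra.
move=> /(scale _ _ _ L0)[e0 [E0 B0]] /(scale _ _ _ L0)[e1 [E1 B1]].
move=> /(scale _ _ _ K0)[f0 [F0 C0]] /(scale _ _ _ K0)[f1 [F1 C1]].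
have vv : 0 <= (a0 + e0) * (b0 + f0) + (a1 + e1) * (b1 + f1).
  rewrite -(pmulr_rge0 _ (mulr_gt0 L0 K0)).
  have -> : L * K * ((a0 + e0) * (b0 + f0) + (a1 + e1) * (b1 + f1)) =
    (L * (a0 + e0)) * (K * (b0 + f0)) + (L * (a1 + e1)) * (K * (b1 + f1)) by ring.
  by rewrite -E0 -F0 -E1 -F1 -!expr2 addr_ge0// sqr_ge0.
have le1 (x y : R) : x * x + y * y = 1 -> `|x| <= 1 /\ `|y| <= 1.
  by move=> H; split; rewrite -(@ler_sqr _ `|_|) ?nnegrE// real_normK ?num_real// expr1n; nra.
have [na0 na1] := le1 _ _ a1E; have [nb0 nb1] := le1 _ _ b1E.
have prod (x y X Y : R) : `|x| <= X -> `|y| <= Y -> x * y <= X * Y.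
  by move=> hx hy; apply: (le_trans (ler_norm _)); rewrite normrM ler_pM.
(* The scalar product in [vv] is at most - 1/2 + 2/10 + 2/10 + 2/100 < 0; relative errors of one
   tenth are small enough for this. *)
have := prod _ _ _ _ na0 C0; have := prod _ _ _ _ na1 C1.
have := prod _ _ _ _ nb0 B0; have := prod _ _ _ _ nb1 B1.
have := prod _ _ _ _ B0 C0; have := prod _ _ _ _ B1 C1.
lra.
Qed.

Lemma tangentE gamma x j : tangent gamma x 0 j = (enorm (dx gamma x))^-1 * dx gamma x 0 j.
Proof. by rewrite mxE. Qed.

Lemma tangent_unit gamma x : enorm (dx gamma x) != 0 ->
  dotp (tangent gamma x) (tangent gamma x) = 1.
Proof.
move=> e0; rewrite dotpE !tangentE; have := enorm_sqrE (dx gamma x).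
move: (enorm _) (dx gamma x 0 0) (dx gamma x 0 1) e0 => e a b e0 E.
have -> : e^-1 * a * (e^-1 * a) + e^-1 * b * (e^-1 * b) = (a ^+ 2 + b ^+ 2) / e ^+ 2.
  by field.
by rewrite -E divff// expf_neq0.
Qed.

Lemma regular_len gamma : constant_speed gamma -> regular gamma <-> 0 < len gamma.
Proof.
move=> cs; rewrite lt0r len_ge0 andbT; split=> [r|l0 x x01]; last by rewrite cs.
by rewrite -(constant_speed0 cs); apply: r; rewrite oo_in zero01.
Qed.

Lemma tangent_osc gamma M j : curve_H2 gamma -> constant_speed gamma -> 0 < len gamma ->
  energy gamma <= M ->
  (tangent gamma 1 0 j - tangent gamma 0 0 j) ^+ 2 <= M * len gamma.
Proof.
move=> H cs L0 EM; have := dx_oscillation j H L0 EM (one01 R).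
rewrite !tangentE (constant_speed0 cs) (cs 1) ?oo_in ?one01//.
move: (len _) (dx _ 1 _ _) (dx _ 0 _ _) L0 => L a b L0 E.
rewrite -mulrBr exprMn exprVn mulrC ler_pdivrMr ?exprn_gt0//.
by apply: (le_trans E); rewrite -mulrA -exprS.
Qed.

Lemma F_ge_energy Gamma i : energy (Gamma i) <= F Gamma.
Proof.
by rewrite /F (bigD1 i)//= lerDl sumr_ge0// => k _; exact: energy_ge0.
Qed.

Lemma theta_unit Gamma i x : theta_network Gamma -> 0 <= x <= 1 ->
  dotp (tangent (Gamma i) x) (tangent (Gamma i) x) = 1.
Proof. by move=> [_ r _ _] x01; apply: tangent_unit; apply: r; rewrite oo_in. Qed.

Lemma theta_len Gamma i : theta_network Gamma -> 0 < len (Gamma i).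
Proof. by move=> [[_ cs _ _] r _ _]; apply/(regular_len (cs i)). Qed.

Lemma theta_dot Gamma i k x : theta_network Gamma -> i != k -> x = 0 \/ x = 1 ->
  dotp (tangent (Gamma i) x) (tangent (Gamma k) x) = - 2^-1.
Proof.
move=> th ik x01; have [l [il kl]] := third_ord3 ik.
have x01' : 0 <= x <= 1 by case: x01 => ->; [exact: (zero01 R)|exact: (one01 R)].
apply: (@unit_dot _ _ (tangent (Gamma l) x)); [exact: theta_unit..|].
rewrite -(sum_ord3 (fun i => tangent (Gamma i) x) ik il kl).
by case: th => _ _ s0 s1; case: x01 => ->.
Qed.

(** The two curves share their chord. The threshold 1/100 turns the chord error M L^3 into at most
    L^2 / 100, the form used by [opposite_chords]. *)
Lemma no_two_short Gamma i k M : theta_network Gamma -> i != k -> F Gamma <= M ->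
  M * len (Gamma i) <= 100^-1 -> M * len (Gamma k) <= 100^-1 -> False.
Proof.
move=> th ik FM si sk; have [[H cs e0 e1] _ _ _] := th.
have Li := theta_len i th; have Lk := theta_len k th.
have est (l : 'I_3) j : M * len (Gamma l) <= 100^-1 ->
    (Gamma i 1 0 j - Gamma i 0 0 j - len (Gamma l) * tangent (Gamma l) 0 0 j) ^+ 2 <=
    len (Gamma l) ^+ 2 / 100.
  move=> sl; have Ll := theta_len l th.
  have := chord_estimate j (H l) Ll (le_trans (F_ge_energy _ l) FM).
  rewrite -(e0 i l) -(e1 i l) tangentE (constant_speed0 (cs l)).
  move: (len _) Ll sl => L L0 sl E.
  rewrite mulrA divff ?gt_eqF// mul1r; apply: (le_trans E).
  by rewrite exprS mulrA mulrC ler_wpM2l// exprn_ge0// ltW.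
have u := theta_unit i th (zero01 R); have v := theta_unit k th (zero01 R).
have uv := theta_dot th ik (or_introl erefl).
rewrite !dotpE in u v uv.
exact: (opposite_chords Li Lk u v uv (est i 0 si) (est i 1 si) (est k 0 sk) (est k 1 sk)).
Qed.

End NetworkLowerBound.

(** * Liminf inequality *)

Section LimitNetworks.
Variable R : realType.
Implicit Types (f h m : R -> R) (a b c M x : R) (gamma : curve R) (u v w : 'rV[R]_2) (Gamma : triple R).

Lemma rowD u v j : (u + v) 0 j = u 0 j + v 0 j.
Proof. by rewrite mxE. Qed.

(** With c = cos (pi / 3) the triple angle formula reads 4 c^3 - 3 c = -1, that is (c + 1) (2 c -
    1)^2 = 0, and c > 0; doubling the angle concludes. *)
Lemma cos_2pi3 : cos (2 * pi / 3) = - 2^-1 :> R.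
Proof.
have pi0 : 0 < pi :> R by exact: pi_gt0.
set t : R := pi / 3; have c0 : 0 < cos t.
  apply: cos_gt0_pihalf; rewrite /t; apply/andP; split; lra.
have E2 : cos (t + t) = 2 * cos t ^+ 2 - 1.
  by rewrite cosD; have := cos2Dsin2 t; nra.
have E3 : cos (t + t + t) = 4 * cos t ^+ 3 - 3 * cos t.
  rewrite cosD E2 sinD; have S := cos2Dsin2 t.
  have -> : (sin t * cos t + cos t * sin t) * sin t = 2 * cos t * (sin t ^+ 2) by ring.
  have -> : sin t ^+ 2 = 1 - cos t ^+ 2 by lra.
  by ring.
have tt : t + t + t = pi by rewrite /t; field.
rewrite tt cospi in E3.
have : (cos t + 1) * (2 * cos t - 1) ^+ 2 = 0 by move: E3; lra.
move/eqP; rewrite mulf_eq0 sqrf_eq0 => /orP[/eqP|/eqP] h; first by lra.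
have -> : 2 * pi / 3 = t + t by rewrite /t; field.
have ct : cos t = 2^-1 by lra.
by rewrite E2 ct; field.
Qed.

Lemma angle_2pi3 u v : dotp u u = 1 -> dotp v v = 1 ->
  angle u v = 2 * pi / 3 <-> dotp u v = - 2^-1.
Proof.
move=> u1 v1; have -> : angle u v = acos (dotp u v).
  by rewrite /angle /enorm u1 v1 sqrtr1 mulr1 divr1.
have pi0 : 0 < pi :> R by exact: pi_gt0.
split=> [H|->]; last by rewrite -cos_2pi3 cosK// in_itv/=; apply/andP; split; lra.
rewrite -cos_2pi3 -H acosK// in_itv/=.
move: u1 v1; rewrite !dotpE; move: (u 0 0) (u 0 1) (v 0 0) (v 0 1) => a b c d h1 h2.
have := sqr_ge0 (a - c); have := sqr_ge0 (b - d).
have := sqr_ge0 (a + c); have := sqr_ge0 (b + d).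
by move=> *; apply/andP; split; nra.
Qed.

Lemma limn_einf_ge (u : nat -> \bar R) (c : \bar R) N :
  (forall n, (N <= n)%N -> (c <= u n)%E) -> (c <= limn_einf u)%E.
Proof.
move=> cu; rewrite limn_einf_lim; apply: lime_ge; first exact: is_cvg_einfs.
exists N => // n /= Nn; apply: le_ereal_inf_tmp => _ [m /= nm] <-.
by apply: cu; exact: leq_trans nm.
Qed.

Lemma limn_einf_ge_lim (u v : nat -> R) (l : R) : v n @[n --> \oo] --> l ->
  (forall n, v n <= u n) -> (l%:E <= limn_einf (fun n => (u n)%:E))%E.
Proof.
move=> vl vu; apply/lee_addgt0Pr => e e0.
rewrite -leeBlDr//.
have /cvgr_gt/(_ (l - e)) := vl; rewrite gtrBl => /(_ e0)[N _ HN].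
apply: (@limn_einf_ge _ _ N) => n /HN/ltW vn.
by rewrite -EFinB lee_fin (le_trans vn).
Qed.

Lemma limn_einf_unbounded (u : nat -> R) :
  (forall M, exists N, forall n, (N <= n)%N -> M <= u n) ->
  limn_einf (fun n => (u n)%:E) = +oo%E.
Proof.
move=> H; apply: eq_infty => M; have [N HN] := H M.
by apply: (@limn_einf_ge _ _ N) => n /HN; rewrite lee_fin.
Qed.

Section Limit.
Variables (Gamma_ : nat -> triple R) (Gamma : triple R).
Hypotheses (wc : weak_cvg_network Gamma_ Gamma) (th : forall n, theta_network (Gamma_ n)).
Hypothesis (net : network3 Gamma).

Let H_ n i : curve_H2 (Gamma_ n i). Proof. by have [[]] := th n. Qed.
Let cs_ n i : constant_speed (Gamma_ n i). Proof. by have [[]] := th n. Qed.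
Let H i : curve_H2 (Gamma i). Proof. by have [] := net. Qed.
Let cs i : constant_speed (Gamma i). Proof. by have [] := net. Qed.

Let cvg_len i : len (Gamma_ n i) @[n --> \oo] --> len (Gamma i).
Proof. exact: (@weak_cvg_len _ _ _ (@wc i) (fun n => @cs_ n i) (@cs i)). Qed.

Let cvg_tangent i j x : 0 < len (Gamma i) -> 0 <= x <= 1 ->
  tangent (Gamma_ n i) x 0 j @[n --> \oo] --> tangent (Gamma i) x 0 j.
Proof. by move=> l0 x01; exact: (@weak_cvg_tangent _ _ _ (@wc i) (@cs i) x j l0 x01). Qed.

Lemma theta_limit : (forall i, 0 < len (Gamma i)) -> theta_network Gamma.
Proof.
move=> L0; have sum0 x : 0 <= x <= 1 -> (forall n, \sum_i tangent (Gamma_ n i) x = 0) ->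
    \sum_i tangent (Gamma i) x = 0.
  move=> x01 s0; apply/rowP => j; rewrite summxE [RHS]mxE.
  have C : \sum_i tangent (Gamma_ n i) x 0 j @[n --> \oo] --> \sum_i tangent (Gamma i) x 0 j.
    by apply: (@cvgn_sum _ _ _ _ xpredT) => i _; exact: cvg_tangent.
  apply: (cvgn_unique C); apply: cvg_near_cst; apply: nearW => n.
  by rewrite -summxE s0 mxE.
split=> //.
- by move=> i; apply/(regular_len (@cs i)).
- by apply: sum0 (zero01 R) _ => n; have [] := th n.
- by apply: sum0 (one01 R) _ => n; have [] := th n.
Qed.

(** Where the limit length is positive the linearized energies converge; the other energies are
    nonnegative and are dropped. The sum obtained is the value of [Fbar] in both finite cases. *)
Lemma energy_liminf : ((\sum_(i | 0 < len (Gamma i)) energy (Gamma i))%:E <=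
  limn_einf (fun n => (F (Gamma_ n))%:E))%E.
Proof.
apply: (@limn_einf_ge_lim _
  (fun n => \sum_(i | 0 < len (Gamma i)) energy_lb (fun n => Gamma_ n i) (Gamma i) n)).
  apply: (@cvgn_sum _ _ (fun i => energy_lb (fun n => Gamma_ n i) (Gamma i))) => i L0.
  exact: (@energy_lb_cvg _ _ _ (@wc i) (fun n => @cs_ n i) (@cs i) (@H i) L0).
move=> n; rewrite /F [leRHS](bigID (fun i => 0 < len (Gamma i)))/=.
apply: ler_wpDr; first by apply: sumr_ge0 => i _; exact: energy_ge0.
apply: ler_sum => i _; exact: (energy_lb_le (fun n => H_ n i) (@H i)).
Qed.

(** If two lengths tended to zero, a late index with energy at most [M] would contradict
    [no_two_short]. Infinitely many bounded energies is exactly what failure of divergence to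
    infinity provides. *)
Lemma one_short M l : (forall N, exists2 n, (N <= n)%N & F (Gamma_ n) <= M) ->
  len (Gamma l) = 0 -> forall i, i != l -> 0 < len (Gamma i).
Proof.
move=> FM l0 i il; rewrite lt0r len_ge0 andbT; apply/eqP => i0.
have small k : len (Gamma k) = 0 -> exists N, forall n, (N <= n)%N ->
    M * len (Gamma_ n k) <= 100^-1.
  move=> k0; have C : M * len (Gamma_ n k) @[n --> \oo] --> (0 : R).
    by rewrite -(mulr0 M) -k0; apply: cvgM; [exact: cvg_cst|exact: (@cvg_len k)].
  have h100 : 0 < 100^-1 :> R by rewrite invr_gt0.
  have /cvgr_le/(_ _ h100)[N _ HN] := C.
  by exists N => n /HN.
have [N1 HN1] := small _ i0; have [N2 HN2] := small _ l0.
have [n Nn Fn] := FM (maxn N1 N2).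
apply: (no_two_short (th n) il Fn); [apply: HN1|apply: HN2].
  by apply: leq_trans Nn; exact: leq_maxl.
by apply: leq_trans Nn; exact: leq_maxr.
Qed.

Lemma perm_of_distinct (i k l : 'I_3) : i != k -> i != l -> k != l ->
  exists s : 'S_3, [/\ s (inord 0) = i, s (inord 1) = k & s (inord 2) = l].
Proof.
move=> ik il kl; pose f (j : 'I_3) := if j == inord 0 then i else if j == inord 1 then k else l.
have fi : injective f.
  move=> a b; rewrite /f; case: a => -[|[|[|//]]] pa; case: b => -[|[|[|//]]] pb;
  rewrite -!val_eqE/= !inordK//= => E; try (by apply: val_inj);
  by move: ik il kl; rewrite E eqxx.
by exists (perm fi); rewrite !permE /f -!val_eqE/= !inordK.
Qed.

Lemma len0_constant gamma : curve_H2 gamma -> constant_speed gamma -> len gamma = 0 ->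
  forall x : R, 0 <= x <= 1 -> gamma x = gamma 0.
Proof.
move=> Hg csg l0; have d0 (y : R) j : 0 <= y <= 1 -> dx gamma y 0 j = 0.
  move=> y01; apply/eqP; rewrite -sqrf_eq0 eq_le sqr_ge0 andbT.
  by apply: (le_trans (coord_le_enorm _ _)); rewrite csg ?oo_in// l0 expr0n.
move=> x x01; apply/rowP => j; have [c L p q] := H2E (Hg j).
rewrite (p x x01) (@eq_prim _ _ (fun=> 0 * 0)) => [|y /oo_cc y01].
  by rewrite (primZ 0 x (itg_cst 0)) mul0r addr0.
by rewrite mul0r; have := d0 y j y01; rewrite mxE.
Qed.

Lemma degenerate_limit M l : (forall N, exists2 n, (N <= n)%N & F (Gamma_ n) <= M) ->
  len (Gamma l) = 0 -> degenerate_theta_network Gamma.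
Proof.
move=> FM l0; have pos := one_short FM l0.
have [i li] : exists i : 'I_3, l != i.
  have [->|ln0] := eqVneq l (inord 0); last by exists (inord 0).
  by exists (inord 1); rewrite -val_eqE/= !inordK.
have [k [lk ik]] := third_ord3 li.
have il : i != l by rewrite eq_sym.
have kl : k != l by rewrite eq_sym.
have Li := pos i il; have Lk := pos k kl.
have [_ _ e0 e1] := net.
split=> //; have [s [s0 s1 s2]] := perm_of_distinct ik il kl.
have Pc := len0_constant (@H l) (@cs l) l0.
exists s, (Gamma l 0); rewrite s0 s1 s2.
have unit j x : 0 < len (Gamma j) -> 0 <= x <= 1 -> dotp (tangent (Gamma j) x) (tangent (Gamma j) x) = 1.
  by move=> /(regular_len (@cs j)) r x01; apply: tangent_unit; apply: r; rewrite oo_in.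
have dot x : x = 0 \/ x = 1 -> dotp (tangent (Gamma i) x) (tangent (Gamma k) x) = - 2^-1.
  move=> x01; have x01' : 0 <= x <= 1 by case: x01 => ->; [exact: zero01|exact: one01].
  have C : dotp (tangent (Gamma_ n i) x) (tangent (Gamma_ n k) x) @[n --> \oo] -->
      dotp (tangent (Gamma i) x) (tangent (Gamma k) x).
    rewrite dotpE; under eq_fun do rewrite dotpE.
    by apply: cvgD; apply: cvgM; exact: cvg_tangent.
  apply: (cvgn_unique C); apply: cvg_near_cst; apply: nearW => n.
  exact: theta_dot.
(* By the junction conditions, the change of the sum of the two tangents between the ends is, up to
   sign, that of the short curve's tangent, whose square is at most [M] times its length. *)
have sumE : tangent (Gamma i) 0 + tangent (Gamma k) 0 = tangent (Gamma i) 1 + tangent (Gamma k) 1.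
  apply/rowP => j; apply/eqP; rewrite -subr_eq0 -sqrf_eq0 eq_le sqr_ge0 andbT !rowD.
  pose D n := (tangent (Gamma_ n i) 0 0 j + tangent (Gamma_ n k) 0 0 j)
    - (tangent (Gamma_ n i) 1 0 j + tangent (Gamma_ n k) 1 0 j).
  have CD : D n @[n --> \oo] --> (tangent (Gamma i) 0 0 j + tangent (Gamma k) 0 0 j)
    - (tangent (Gamma i) 1 0 j + tangent (Gamma k) 1 0 j).
    by apply: cvgB; apply: cvgD; apply: cvg_tangent; rewrite ?zero01 ?one01.
  have CL : D n ^+ 2 - M * len (Gamma_ n l) @[n --> \oo] -->
      ((tangent (Gamma i) 0 0 j + tangent (Gamma k) 0 0 j)
    - (tangent (Gamma i) 1 0 j + tangent (Gamma k) 1 0 j)) ^+ 2 - M * len (Gamma l).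
    apply: cvgB; first exact: cvgn_sqr.
    by apply: cvgM; [exact: cvg_cst|exact: cvg_len].
  rewrite l0 mulr0 subr0 in CL; apply: (cvgn_frequently_le0 CL) => N.
  have [n Nn Fn] := FM N; exists n => //.
  have O := tangent_osc j (H_ n l) (@cs_ n l) (theta_len l (th n))
    (le_trans (F_ge_energy _ l) Fn).
  rewrite subr_le0; apply: le_trans O.
  have [_ _ z0 z1] := th n; move: z0 z1.
  rewrite (sum_ord3 _ ik il kl) (sum_ord3 (fun i => tangent (Gamma_ n i) 1) ik il kl).
  have z (u v w : 'rV[R]_2) : u + v + w = 0 -> u 0 j + v 0 j = - w 0 j.
    by move=> uvw; rewrite -rowD -[u + v](addrK w) uvw sub0r mxE.
  by move=> /z E0 /z E1; rewrite /D E0 E1 opprK addrC.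
split.
- by split; apply/(regular_len (@cs _)).
- by move=> x; rewrite oo_in => /Pc.
- split; rewrite 1?(e0 _ l) 1?(e1 _ l) ?Pc ?one01//.
- by apply/angle_2pi3; [apply: unit => //; exact: zero01..|apply: dot; left].
- have [[-> ->]//|[-> ->]] := unit_pair (unit i 0 Li (zero01 R)) (unit k 0 Lk (zero01 R))
    (unit i 1 Li (one01 R)) (unit k 1 Lk (one01 R)) (dot 0 (or_introl erefl))
    (dot 1 (or_intror erefl)) sumE.
  by rewrite setUC.
Qed.

(** When [Fbar] is infinite the energies must diverge: if they stayed below some [M] infinitely
    often, the limit would be a Theta-network or a degenerate one, according to whether all its
    lengths are positive. *)
Lemma Fbar_le_liminf : (Fbar Gamma <= limn_einf (fun n => (F (Gamma_ n))%:E))%E.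
Proof.
rewrite /Fbar; case: asboolP => [tG|ntG].
  apply: le_trans energy_liminf; rewrite lee_fin /F.
  rewrite [leRHS](eq_bigl xpredT)// => i; exact: theta_len.
case: asboolP => [dG|ndG]; first exact: energy_liminf.
rewrite limn_einf_unbounded// => M; apply: contrapT => HM.
have FM N : exists2 n, (N <= n)%N & F (Gamma_ n) <= M.
  apply: contrapT => HN; apply: HM; exists N => n Nn; rewrite leNgt; apply/negP => /ltW Fn.
  by apply: HN; exists n.
apply: ntG; apply: theta_limit => l; rewrite lt0r len_ge0 andbT; apply/eqP => l0.
exact: ndG (degenerate_limit FM l0).
Qed.

End Limit.

End LimitNetworks.

(** * Contractions of the plane and products with smooth functions *)

(* Matrices are complete, but the join with the normed structure, which Banach's
   fixed point theorem expects, is not declared in the library. *)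
HB.instance Definition _ (R : realType) (m n : nat) := Complete.on (matrix R m.+1 n.+1).

Section Perturbation.
Variable R : realType.
Implicit Types (f g h m phi : R -> R) (a b c M x : R).

Lemma rv_norm_leP (x : 'rV[R]_2) r : 0 <= r -> `|x| <= r <-> `|x 0 0| <= r /\ `|x 0 1| <= r.
Proof.
move=> r0; have E : `|x| = mx_norm x by [].
rewrite E mx_normrE; split=> [H|[H0 H1]].
  have P i : `|x 0 i| <= r.
    by apply: le_trans H; apply: (le_bigmax _ (fun ij : 'I_1 * 'I_2 => `|x ij.1 ij.2|) (0, i)).
  by split.
apply: bigmax_le => // -[i j] _ /=; rewrite (ord1 i).
case: j => -[|[|//]] p; [rewrite (_ : Ordinal p = 0)//|rewrite (_ : Ordinal p = 1)//];
  exact: val_inj.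
Qed.

(** Banach's fixed point theorem on the square of half side [r], a closed ball for the sup norm of
    row vectors, with contraction factor 1/2. *)
Lemma fixpoint2 (r : R) (f g : R -> R -> R) : 0 <= r ->
  (forall a b : R, `|a| <= r -> `|b| <= r -> `|f a b| <= r /\ `|g a b| <= r) ->
  (forall a b a' b' d : R, `|a| <= r -> `|b| <= r -> `|a'| <= r -> `|b'| <= r ->
     `|a - a'| <= d -> `|b - b'| <= d ->
     `|f a b - f a' b'| <= d / 2 /\ `|g a b - g a' b'| <= d / 2) ->
  exists a b : R, [/\ `|a| <= r, `|b| <= r, f a b = a & g a b = b].
Proof.
move=> r0 stab lip; pose U : set 'rV[R]_2 := [set x | `|x| <= r].
pose h (x : 'rV[R]_2) : 'rV[R]_2 :=
  \row_j (if j == 0 then f (x 0 0) (x 0 1) else g (x 0 0) (x 0 1)).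
have hU : set_fun U U h.
  move=> x /(rv_norm_leP _ r0)[x0 x1]; apply/rv_norm_leP => //; rewrite !mxE/=.
  exact: stab.
pose hf : {fun U >-> U} := HB.pack h (isFun.Build _ _ U U h hU).
have ctr : is_contraction hf.
  exists (2^-1)%:nng; split => /=; first by lra.
  move=> [x y] /= [/(rv_norm_leP _ r0)[x0 x1] /(rv_norm_leP _ r0)[y0 y1]].
  have [d0 d1] := (rv_norm_leP (x - y) (normr_ge0 _)).1 (lexx _).
  apply/rv_norm_leP; first by rewrite mulr_ge0.
  rewrite !mxE/= in d0 d1 *; rewrite mulrC.
  exact: lip.
have clU : closed U.
  have -> : U = Num.norm @^-1` [set y : R | y <= r] by [].
  apply: closed_comp; last exact: closed_le.
  by move=> x _; exact: norm_continuous.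
have [|p Up hp] := banach_fixed_point ctr clU.
  by exists 0; rewrite /U /= normr0.
have /(rv_norm_leP _ r0)[p0 p1] := Up.
exists (p 0 0), (p 0 1); split=> //.
  by move/rowP : hp => /(_ 0); rewrite !mxE/=.
by move/rowP : hp => /(_ 1); rewrite !mxE/=.
Qed.

Lemma norm_cosB1_le (x : R) : `|cos x - 1| <= `|x| /\ `|sin x| <= `|x|.
Proof.
have key (f df : R -> R) : (forall x, is_derive x 1 f (df x)) -> (forall x, `|df x| <= 1) ->
    f 0 = 0 -> `|f x| <= `|x|.
  move=> fd bd f0.
  have cf (A : set R) : {within A, continuous f}.
    apply: continuous_subspaceT => y; apply: differentiable_continuous.
    by apply/derivable1_diffP; exact: (fd y).(ex_derive).
  have [x0|x0] := leP 0 x.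
    have [c _] := @MVT_segment R f df 0 x x0 (fun y _ => fd y) (cf _).
    by rewrite f0 !subr0 => ->; rewrite normrM ler_piMl.
  have [c _] := @MVT_segment R f df x 0 (ltW x0) (fun y _ => fd y) (cf _).
  rewrite f0 !sub0r => /eqP; rewrite eqr_oppLR => /eqP ->.
  by rewrite normrN normrM normrN ler_piMl.
split; [apply: (key (fun x => cos x - 1) (fun x => - sin x))|apply: (key _ cos)].
- by move=> y; rewrite -[- sin y]subr0; apply: is_deriveB.
- by move=> y; rewrite normrN; exact: sin_max.
- by rewrite cos0 subrr.
- by move=> y; exact: cos_max.
- exact: sin0.
Qed.

(** The derivatives of sin x - x and of cos x are bounded by |x|, hence by [r]. A Lipschitz constant
    that shrinks with the angle is what makes the displacement equation a contraction. *)
Lemma sin_cos_lip (r s t : R) : `|s| <= r -> `|t| <= r ->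
  `|(sin s - s) - (sin t - t)| <= r * `|s - t| /\ `|cos s - cos t| <= r * `|s - t|.
Proof.
have key (f df : R -> R) : (forall x, is_derive x 1 f (df x)) -> (forall x, `|df x| <= `|x|) ->
    forall s t, `|s| <= r -> `|t| <= r -> `|f s - f t| <= r * `|s - t|.
  move=> fd bd s' t'; wlog st : s' t' / t' <= s'.
    move=> W sr tr; have [/W|/ltW/W] := leP t' s'; first exact.
    by rewrite distrC (distrC s'); exact.
  move=> sr tr.
  have cf : {within `[t', s'], continuous f}.
    apply: continuous_subspaceT => y; apply: differentiable_continuous.
    by apply/derivable1_diffP; exact: (fd y).(ex_derive).
  have [c c01 ->] := @MVT_segment R f df t' s' st (fun y _ => fd y) cf.
  rewrite normrM ler_wpM2r//; apply: (le_trans (bd c)).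
  move: c01 sr tr; rewrite in_itv/= => /andP[tc cs]; rewrite !ler_norml.
  by move=> /andP[s1 s2] /andP[t1 t2]; rewrite (le_trans t1)// (le_trans cs).
move=> sr tr; split.
  apply: (key (fun x => sin x - x) (fun x => cos x - 1)) => //.
  by move=> x; have [] := norm_cosB1_le x.
apply: (key cos (fun x => - sin x)) => // x.
by rewrite normrN; have [] := norm_cosB1_le x.
Qed.

Lemma test_lin c d (phi psi : R -> R) : test_function phi -> test_function psi ->
  test_function (fun x => c * phi x + d * psi x) /\
  (forall x, derive1 (fun x => c * phi x + d * psi x) x = c * derive1 phi x + d * derive1 psi x).
Proof.
move=> [dp cp [a [b [a0 b1 ab]]]] [dq cq [a' [b' [a0' b1' ab']]]].
have D x : is_derive x (1:R) (fun x => c * phi x + d * psi x) (c * derive1 phi x + d * derive1 psi x).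
  have hp : is_derive x (1:R) phi (derive1 phi x) by rewrite derive1E; exact: derivableP.
  have hq : is_derive x (1:R) psi (derive1 psi x) by rewrite derive1E; exact: derivableP.
  have := is_deriveD (is_deriveZ c hp) (is_deriveZ d hq).
  exact.
have E x : derive1 (fun x => c * phi x + d * psi x) x = c * derive1 phi x + d * derive1 psi x.
  by rewrite derive1E; have [_ ->] := D x.
split; last exact: E.
split.
- by move=> x; have [] := D x.
- have -> : derive1 (fun x => c * phi x + d * psi x) = (fun x => c * derive1 phi x + d * derive1 psi x).
    exact/funext.
  move=> x; apply: cvgD; apply: cvgM; [exact: cvg_cst|exact: cp|exact: cvg_cst|exact: cq].
- exists (Num.min a a'), (Num.max b b'); split; rewrite ?lt_min ?gt_max ?a0 ?b1//.
  move=> x; rewrite in_itv/= => xo; rewrite ab ?ab' ?mulr0 ?addr0//.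
    by apply: contra xo; rewrite in_itv/= => /andP[h1 h2]; rewrite ge_min le_max h1 h2 !orbT.
  by apply: contra xo; rewrite in_itv/= => /andP[h1 h2]; rewrite ge_min le_max h1 h2.
Qed.

(** * Product and chain rules with continuously differentiable functions *)

Definition smooth m := (forall x, derivable m x 1) /\ continuous (derive1 m).

Lemma smooth_cont m : smooth m -> {within `[0, 1], continuous m}.
Proof. by move=> [dm _]; apply: cont_within; exact: test_derivable_cont. Qed.

Lemma test_smoothM m phi : smooth m -> test_function phi ->
  test_function (fun x => m x * phi x) /\
  (forall x, derive1 (fun x => m x * phi x) x = m x * derive1 phi x + phi x * derive1 m x).
Proof.
move=> [dm cm] [dp cp [a [b [a0 b1 ab]]]].
have D x : is_derive x (1:R) (fun x => m x * phi x) (m x * derive1 phi x + phi x * derive1 m x).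
  have hp : is_derive x (1:R) phi (derive1 phi x) by rewrite derive1E; exact: derivableP.
  have hq : is_derive x (1:R) m (derive1 m x) by rewrite derive1E; exact: derivableP.
  exact: is_deriveM.
have E x : derive1 (fun x => m x * phi x) x = m x * derive1 phi x + phi x * derive1 m x.
  by rewrite derive1E; have [_ ->] := D x.
have cm0 := test_derivable_cont dm; have cp0 := test_derivable_cont dp.
split; last exact: E.
split.
- by move=> x; have [] := D x.
- have -> : derive1 (fun x => m x * phi x) = (fun x => m x * derive1 phi x + phi x * derive1 m x).
    exact/funext.
  by move=> x; apply: cvgD; apply: cvgM; [exact: cm0|exact: cp|exact: cp0|exact: cm].
- by exists a, b; split=> // x /ab ->; rewrite mulr0.
Qed.

Lemma smooth_bounded m : smooth m ->
  exists2 M : R, 0 <= M & forall x : R, 0 < x < 1 -> `|m x| <= M /\ `|derive1 m x| <= M.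
Proof.
move=> sm; have [dm cm] := sm; have cm0 := smooth_cont sm.
have [M1 M10 H1] := cont_bounded cm0; have [M2 M20 H2] := cont_bounded (cont_within cm).
exists (M1 + M2) => [|x /oo_cc x01]; first exact: addr_ge0.
by split; [apply: (le_trans (H1 _ x01)); rewrite lerDl|apply: (le_trans (H2 _ x01)); rewrite lerDr].
Qed.

(** [m] times a test function is a test function, so the product rule follows by testing the
    derivative of [f] against that product. *)
Lemma primitiveM m f g : smooth m -> L2 g -> primitive_of f g ->
  L2 (fun x => derive1 m x * f x + m x * g x) /\
  primitive_of (fun x => m x * f x) (fun x => derive1 m x * f x + m x * g x).
Proof.
move=> sm Lg fg; have [dm cm] := sm; have cm0 := smooth_cont sm.
have [M M0 HM] := smooth_bounded sm.
have gi := L2_itg Lg; have cf := primitive_cont gi fg; have Lf := L2_cont cf; have fi := L2_itg Lf.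
have L1 : L2 (fun x => derive1 m x * f x).
  apply: (@L2_bM _ _ _ M) => //; first exact: cont_meas (cont_within cm).
  by move=> x /HM[].
have L2' : L2 (fun x => m x * g x).
  apply: (@L2_bM _ _ _ M) => //; first exact: cont_meas.
  by move=> x /HM[].
have L3 := L2D L1 L2'; split=> //.
apply: weak_primitive.
- by move=> x; apply: cvgM; [exact: cm0|exact: cf].
- exact: L2_itg.
move=> phi tphi; rewrite -!/(int01 _).
have [tm dE] := test_smoothM sm tphi.
have W := primitive_weak gi fg tm; rewrite -!/(int01 _) in W.
have [i1 i2] := itg_test fi tm; have [i3 _] := itg_test (L2_itg L1) tphi.
have [i4 _] := itg_test (L2_itg L2') tphi.
have -> : int01 (fun x => m x * f x * derive1 phi x) =
    int01 (fun x => f x * derive1 (fun y => m y * phi y) x) - int01 (fun x => derive1 m x * f x * phi x).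
  by rewrite -int01B//; apply: eq_int01 => x _; rewrite dE; move: (derive1 m x) (derive1 phi x) => s t; ring.
have -> : int01 (fun x => (derive1 m x * f x + m x * g x) * phi x) =
    int01 (fun x => derive1 m x * f x * phi x) + int01 (fun x => g x * (m x * phi x)).
  rewrite -int01D//; last by apply: eq_itg i4 => x _; ring.
  by apply: eq_int01 => x _; move: (derive1 m x) => s; ring.
by rewrite W opprD addrC.
Qed.

Lemma smooth_comp (f df : R -> R) m : (forall x, is_derive x 1 f (df x)) -> continuous df ->
  smooth m -> smooth (f \o m) /\ forall x, derive1 (f \o m) x = df (m x) * derive1 m x.
Proof.
move=> fd cdf [dm cm]; have cm0 := test_derivable_cont dm.
have D x : is_derive x (1:R) (f \o m) (df (m x) * derive1 m x).
  have hm : is_derive x (1:R) m (derive1 m x) by rewrite derive1E; exact: derivableP.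
  exact: (is_derive1_comp (fd (m x)) hm).
have E x : derive1 (f \o m) x = df (m x) * derive1 m x.
  by rewrite derive1E; have [_ ->] := D x.
split; last exact: E.
split; first by move=> x; have [] := D x.
have -> : derive1 (f \o m) = (fun x => df (m x) * derive1 m x) by exact/funext.
move=> x; apply: cvgM; last exact: cm.
by apply: continuous_comp; [exact: cm0|exact: cdf].
Qed.

End Perturbation.

(** * Perturbation of a closed unit tangent field *)

Section Loop.
Variable R : realType.
Implicit Types (f g h m phi : R -> R) (a b c M x : R).

Lemma prim_cst0 x : prim (cst (0:R)) x = 0.
Proof.
rewrite (@eq_prim _ _ (fun=> 0 * 0)) => [|y _]; last by rewrite mul0r.
by rewrite (primZ 0 x (itg_cst 0)) mul0r.
Qed.

(** By the intermediate value theorem such a function cannot change sign, so it is a nonzero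
    constant. *)
Lemma sqr_const_sign f (k : R) : {within `[0, 1], continuous f} -> 0 < k ->
  (forall x : R, 0 <= x <= 1 -> f x ^+ 2 = k) -> int01 f <> 0.
Proof.
move=> cf k0 fk.
have fc (x : R) : 0 <= x <= 1 -> f x = f 0.
  move=> /andP[x0 x1].
  have h0 : f 0 ^+ 2 = k by apply: fk; rewrite lexx ler01.
  have hx : f x ^+ 2 = k by apply: fk; rewrite x0.
  have /eqP : f x ^+ 2 = f 0 ^+ 2 by rewrite hx.
  rewrite eqf_sqr => /orP[/eqP//|/eqP fN]; exfalso.
  have cx : {within `[0, x], continuous f}.
    by apply: continuous_subspaceW cf; apply: subset_itvl; rewrite bnd_simp.
  have [|c] := @IVT R f 0 x 0 x0 cx.
    by rewrite fN ge_min le_max; have [h|/ltW h] := leP 0 (f 0); rewrite ?oppr_le0 ?oppr_ge0 h ?orbT.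
  rewrite in_itv/= => /andP[c0 cx'] fc0.
  have : f c ^+ 2 = k by apply: fk; rewrite c0 (le_trans cx').
  by rewrite fc0 expr0n/= => kk; rewrite -kk ltxx in k0.
rewrite (@eq_int01 _ f (fun=> f 0)) => [|x /oo_cc/fc//]; rewrite int01_cst => f00.
have : f 0 ^+ 2 = k by apply: fk; rewrite lexx ler01.
by rewrite f00 expr0n/= => kk; rewrite -kk ltxx in k0.
Qed.

Section UnitLoop.
Variables T0 T1 D0 D1 : R -> R.
Hypotheses (LD0 : L2 D0) (LD1 : L2 D1).
Hypotheses (P0 : primitive_of T0 D0) (P1 : primitive_of T1 D1).
Hypothesis unitT : forall x : R, 0 <= x <= 1 -> T0 x ^+ 2 + T1 x ^+ 2 = 1.
Hypotheses (loop0 : int01 T0 = 0) (loop1 : int01 T1 = 0).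

Let c0 : {within `[0, 1], continuous T0}. Proof. exact: (primitive_cont (L2_itg LD0) P0). Qed.
Let c1 : {within `[0, 1], continuous T1}. Proof. exact: (primitive_cont (L2_itg LD1) P1). Qed.
Let i0 : itg T0. Proof. exact: cont_itg. Qed.
Let i1 : itg T1. Proof. exact: cont_itg. Qed.

Let bT (x : R) : 0 <= x <= 1 -> `|T0 x| <= 1 /\ `|T1 x| <= 1.
Proof.
move=> /unitT; move: (T0 x) (T1 x) => s t H.
have := sqr_ge0 s; have := sqr_ge0 t.
by split; rewrite -(@ler_sqr _ `|_|) ?nnegrE// real_normK ?num_real// expr1n; lra.
Qed.

(* If every pairing vanished, a T0 + b T1 would be zero, so T would be constant
   and could not have zero mean. *)
Lemma test_pairing (a b : R) : a ^+ 2 + b ^+ 2 != 0 ->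
  exists2 phi, test_function phi &
    a * int01 (fun x => T0 x * phi x) + b * int01 (fun x => T1 x * phi x) != 0.
Proof.
move=> ab0; apply: contrapT => H.
pose f x := a * T0 x + b * T1 x.
have fi : itg f by apply: itgD; exact: itgZ.
have cf : {within `[0, 1], continuous f}.
  by move=> x; apply: cvgD; (apply: cvgM; first exact: cvg_cst); [exact: c0|exact: c1].
have W : weak_derivative (cst 0) f.
  move=> phi tphi; rewrite -!/(int01 _).
  have [j0 _] := itg_test i0 tphi; have [j1 _] := itg_test i1 tphi.
  have -> : int01 (fun x => f x * phi x) =
      a * int01 (fun x => T0 x * phi x) + b * int01 (fun x => T1 x * phi x).
    rewrite -!int01Z// -int01D; [|exact: itgZ..].
    by apply: eq_int01 => x _; rewrite /f; ring.
  have -> : a * int01 (fun x => T0 x * phi x) + b * int01 (fun x => T1 x * phi x) = 0.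
    by apply: contrapT => /eqP N; apply: H; exists phi.
  by rewrite (@eq_int01 _ _ (fun=> 0)) ?int01_cst ?oppr0// => x _; rewrite mul0r.
have cc : {within `[0, 1], continuous (cst 0 : R -> R)} by move=> x; exact: cvg_cst.
have pf := weak_primitive cc fi W.
have f0 : forall x : R, 0 <= x <= 1 -> f x = 0.
  apply: cont_ae0 => //; apply: prim_const_ae0 => // x y /oo_cc x01 /oo_cc y01.
  by have := pf x x01; have := pf y y01; rewrite /= !add0r => <- <-.
(* The component of T along (- b, a), orthogonal to (a, b). Since [f] vanishes, its square is a^2 +
   b^2. *)
pose g x := a * T1 x + - b * T0 x.
have gi : int01 g = 0 by rewrite int01D ?int01Z// ?loop0 ?loop1 ?mulr0 ?addr0//; exact: itgZ.
apply: (@sqr_const_sign g (a ^+ 2 + b ^+ 2)) gi.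
- by move=> x; apply: cvgD; (apply: cvgM; first exact: cvg_cst); [exact: c1|exact: c0].
- by rewrite lt_neqAle eq_sym ab0 addr_ge0 ?sqr_ge0.
- move=> x x01; have := f0 x x01; have := unitT x01; rewrite /f /g.
  move: (T0 x) (T1 x) => s t E1 E2.
  rewrite -[RHS]mulr1 -E1.
  have -> : (a ^+ 2 + b ^+ 2) * (s ^+ 2 + t ^+ 2) =
    (a * t + - b * s) ^+ 2 + (a * s + b * t) ^+ 2 by ring.
  by rewrite E2 expr0n addr0.
Qed.

(* Rotating T by a small angle p adds p (- T1, T0) to first order: p moves the
   endpoint along the first axis, and q along the second. *)
Lemma dual_test_functions : exists p q, [/\ test_function p, test_function q,
  int01 (fun x => T0 x * p x) = 0 /\ int01 (fun x => T1 x * p x) = -1 &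
  int01 (fun x => T0 x * q x) = 1 /\ int01 (fun x => T1 x * q x) = 0].
Proof.
have [|f tf] := @test_pairing 1 0; first by rewrite expr1n expr0n addr0 oner_eq0.
set A0 := int01 _; set A1 := int01 _; rewrite mul1r mul0r addr0 => A00.
(* This vector is orthogonal to (A0, A1), so the nonzero pairing is the determinant of the linear
   system for the coefficients of [f] and [g]. *)
have [|g tg] := @test_pairing (- A1) A0.
  rewrite sqrrN; have := sqr_ge0 A1; have : 0 < A0 ^+ 2 by rewrite lt_neqAle eq_sym sqrf_eq0 A00 sqr_ge0.
  by move=> *; rewrite gt_eqF// ltr_wpDl.
set B0 := int01 _; set B1 := int01 _ => det.
have [j0 _] := itg_test i0 tf; have [j1 _] := itg_test i1 tf.
have [k0 _] := itg_test i0 tg; have [k1 _] := itg_test i1 tg.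
have E0 a b : int01 (fun x => T0 x * (a * f x + b * g x)) = a * A0 + b * B0.
  rewrite /A0 /B0 -!int01Z// -int01D; [|exact: itgZ..].
  by apply: eq_int01 => x _; ring.
have E1 a b : int01 (fun x => T1 x * (a * f x + b * g x)) = a * A1 + b * B1.
  rewrite /A1 /B1 -!int01Z// -int01D; [|exact: itgZ..].
  by apply: eq_int01 => x _; ring.
move: (A0) (A1) (B0) (B1) det E0 E1 => a0 a1 b0 b1 det E0 E1.
set d := - a1 * b0 + a0 * b1 in det.
(* Cramer's rule, with determinant [d]. *)
exists (fun x => b0 / d * f x + (- a0 / d) * g x), (fun x => b1 / d * f x + (- a1 / d) * g x).
split; [by have [] := test_lin (b0 / d) (- a0 / d) tf tg|
  by have [] := test_lin (b1 / d) (- a1 / d) tf tg| |];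
  rewrite E0 E1; split; rewrite /d; field; exact: det.
Qed.

Lemma primitiveD f g f' g' : itg g -> itg g' -> primitive_of f g -> primitive_of f' g' ->
  primitive_of (fun x => f x + f' x) (fun x => g x + g' x).
Proof. by move=> gi gi' fg fg' x x01; rewrite fg// fg'// primD// addrACA. Qed.

Lemma primitiveZ (c : R) f g : itg g -> primitive_of f g ->
  primitive_of (fun x => c * f x) (fun x => c * g x).
Proof. by move=> gi fg x x01; rewrite fg// primZ// mulrDr. Qed.

Section Rotation.
Variables (p q : R -> R).
Hypotheses (tp : test_function p) (tq : test_function q).
Hypotheses (p0 : int01 (fun x => T0 x * p x) = 0) (p1 : int01 (fun x => T1 x * p x) = -1).
Hypotheses (q0 : int01 (fun x => T0 x * q x) = 1) (q1 : int01 (fun x => T1 x * q x) = 0).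

Let al a b x := a * p x + b * q x.

Variable M : R.
Hypothesis M0 : 0 <= M.
Hypothesis Mp : forall x : R, 0 <= x <= 1 -> `|p x| <= M /\ `|derive1 p x| <= M.
Hypothesis Mq : forall x : R, 0 <= x <= 1 -> `|q x| <= M /\ `|derive1 q x| <= M.

Lemma lincomb_le (a b r y z : R) : `|a| <= r -> `|b| <= r -> `|y| <= M -> `|z| <= M ->
  `|a * y + b * z| <= 2 * M * r.
Proof.
move=> ar br yM zM; apply: (le_trans (ler_normD _ _)); rewrite !normrM.
by have := ler_pM (normr_ge0 a) (normr_ge0 y) ar yM;
  have := ler_pM (normr_ge0 b) (normr_ge0 z) br zM; nra.
Qed.

Let al_le a b (r : R) (x : R) : `|a| <= r -> `|b| <= r -> 0 <= x <= 1 -> `|al a b x| <= 2 * M * r.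
Proof.
by move=> ar br x01; apply: lincomb_le => //; [have [] := Mp x01|have [] := Mq x01].
Qed.

Let al_dist a b a' b' (d : R) (x : R) : `|a - a'| <= d -> `|b - b'| <= d -> 0 <= x <= 1 ->
  `|al a b x - al a' b' x| <= 2 * M * d.
Proof.
move=> ad bd x01; have -> : al a b x - al a' b' x = (a - a') * p x + (b - b') * q x.
  by rewrite /al; ring.
by apply: lincomb_le => //; [have [] := Mp x01|have [] := Mq x01].
Qed.

Let sal a b : smooth (al a b).
Proof. by have [[d c _] _] := test_lin a b tp tq. Qed.

Let scos a b : smooth (cos \o al a b) /\
  forall x, derive1 (cos \o al a b) x = - sin (al a b x) * derive1 (al a b) x.
Proof.
have Hc : continuous (fun x : R => - sin x).
  by move=> x; apply: continuousN; exact: continuous_sin.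
exact: (smooth_comp (@is_derive_cos R) Hc (sal a b)).
Qed.

Let ssin a b : smooth (sin \o al a b) /\
  forall x, derive1 (sin \o al a b) x = cos (al a b x) * derive1 (al a b) x.
Proof. exact: (smooth_comp (@is_derive_sin R) (@continuous_cos R) (sal a b)). Qed.

(** Rotated field minus T minus the first order variation al (- T1, T0): its first coordinate here,
    its second in [e1]. *)
Let e0 a b x := (cos (al a b x) - 1) * T0 x - (sin (al a b x) - al a b x) * T1 x.
Let e1 a b x := (sin (al a b x) - al a b x) * T0 x + (cos (al a b x) - 1) * T1 x.

Let ccos a b : {within `[0, 1], continuous (fun x => cos (al a b x))}.
Proof. exact: (smooth_cont (scos a b).1). Qed.
Let csin a b : {within `[0, 1], continuous (fun x => sin (al a b x))}.
Proof. exact: (smooth_cont (ssin a b).1). Qed.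
Let cal a b : {within `[0, 1], continuous (al a b)}.
Proof. exact: smooth_cont. Qed.

Let i_e0 a b : itg (e0 a b).
Proof.
apply: cont_itg => x; apply: cvgB; apply: cvgM.
- by apply: cvgB; [exact: ccos|exact: cvg_cst].
- exact: c0.
- by apply: cvgB; [exact: csin|exact: cal].
- exact: c1.
Qed.

Let i_e1 a b : itg (e1 a b).
Proof.
apply: cont_itg => x; apply: cvgD; apply: cvgM.
- by apply: cvgB; [exact: csin|exact: cal].
- exact: c0.
- by apply: cvgB; [exact: ccos|exact: cvg_cst].
- exact: c1.
Qed.

(** Angles are at most 2 M r and differ by at most 2 M d, so each trigonometric factor of the
    remainder varies by at most 4 M^2 r d; two such factors are multiplied by coordinates of a unit
    vector. *)
Let e_lip a b a' b' (r d : R) : `|a| <= r -> `|b| <= r -> `|a'| <= r -> `|b'| <= r ->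
  `|a - a'| <= d -> `|b - b'| <= d ->
  `|int01 (e0 a b) - int01 (e0 a' b')| <= 8 * M ^+ 2 * r * d /\
  `|int01 (e1 a b) - int01 (e1 a' b')| <= 8 * M ^+ 2 * r * d.
Proof.
move=> ar br ar' br' ad bd.
have pw (x : R) : 0 < x < 1 -> `|e0 a b x - e0 a' b' x| <= 8 * M ^+ 2 * r * d /\
    `|e1 a b x - e1 a' b' x| <= 8 * M ^+ 2 * r * d.
  move=> /oo_cc x01; have [t0 t1] := bT x01.
  have [S C] := sin_cos_lip (al_le ar br x01) (al_le ar' br' x01).
  have D := al_dist ad bd x01.
  have r0 : 0 <= r by exact: le_trans (normr_ge0 a) ar.
  have X : 2 * M * r * `|al a b x - al a' b' x| <= 4 * M ^+ 2 * r * d.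
    apply: (le_trans (ler_wpM2l _ D)); first by rewrite !mulr_ge0.
    by rewrite le_eqVlt; apply/orP; left; apply/eqP; ring.
  have comb (s t u v : R) : `|s| <= 4 * M ^+ 2 * r * d -> `|t| <= 4 * M ^+ 2 * r * d ->
      `|u| <= 1 -> `|v| <= 1 -> `|s * u + t * v| <= 8 * M ^+ 2 * r * d.
    move=> hs ht hu hv; apply: (le_trans (ler_normD _ _)); rewrite !normrM.
    have h1 := ler_pM (normr_ge0 s) (normr_ge0 u) hs hu.
    have h2 := ler_pM (normr_ge0 t) (normr_ge0 v) ht hv.
    by apply: (le_trans (lerD h1 h2)); rewrite !mulr1 -!mulrDl -natrD.
  have S' := le_trans S X; have C' := le_trans C X.
  split.
    have -> : e0 a b x - e0 a' b' x = (cos (al a b x) - cos (al a' b' x)) * T0 x +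
        - ((sin (al a b x) - al a b x) - (sin (al a' b' x) - al a' b' x)) * T1 x.
      by rewrite /e0; move: (cos (al a b x)) (cos (al a' b' x)) (sin (al a b x)) (sin (al a' b' x)) (al a b x) (al a' b' x) => *; ring.
    by apply: comb => //; rewrite normrN.
  have -> : e1 a b x - e1 a' b' x =
      ((sin (al a b x) - al a b x) - (sin (al a' b' x) - al a' b' x)) * T0 x +
      (cos (al a b x) - cos (al a' b' x)) * T1 x.
    by rewrite /e1; move: (cos (al a b x)) (cos (al a' b' x)) (sin (al a b x)) (sin (al a' b' x)) (al a b x) (al a' b' x) => *; ring.
  exact: comb.
rewrite -!int01B//; split; apply: norm_int01_le; [exact: itgB|by move=> x /pw[]|exact: itgB|by move=> x /pw[]].
Qed.

Let e00 : int01 (e0 0 0) = 0 /\ int01 (e1 0 0) = 0.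
Proof.
by split; (rewrite -[RHS](int01_cst 0); apply: eq_int01 => x _;
  rewrite /e0 /e1 /al !mul0r addr0 cos0 sin0 !subrr !mul0r ?subr0 ?addr0).
Qed.

(** T has zero mean and p, q are dual to it, so the displacement is exactly (a, b) plus the integral
    of the remainder: (a, b) is a fixed point of v minus that integral. The bound on [r] gives the
    factor 1/2, and the bounds on v leave r / 2 for the remainder. *)
Lemma rotation_displacement (r v0 v1 : R) : 0 <= r -> 16 * M ^+ 2 * r <= 1 ->
  `|v0| <= r / 2 -> `|v1| <= r / 2 ->
  exists a b, [/\ `|a| <= r, `|b| <= r,
    int01 (fun x => cos (al a b x) * T0 x + - 1 * (sin (al a b x) * T1 x)) = v0 &
    int01 (fun x => sin (al a b x) * T0 x + cos (al a b x) * T1 x) = v1].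
Proof.
move=> r0 r1 v0r v1r.
have [//||| a [b [ar br fa fb]]] := @fixpoint2 _ r (fun a b => v0 - int01 (e0 a b)) (fun a b => v1 - int01 (e1 a b)).
- move=> a b ar br; have z : `|0 : R| <= r by rewrite normr0.
  have [|| L0 L1] := @e_lip a b 0 0 r r ar br z z; rewrite ?subr0//.
  rewrite e00.1 e00.2 !subr0 in L0 L1.
  have K : 8 * M ^+ 2 * r * r <= r / 2 by move: r1 r0; move: (M ^+ 2) => m; nra.
  split; apply: (le_trans (ler_normB _ _)).
    by have := le_trans L0 K; lra.
  by have := le_trans L1 K; lra.
- move=> a b a' b' d ar br ar' br' ad bd.
  have [L0 L1] := e_lip ar br ar' br' ad bd.
  have d0 : 0 <= d by exact: le_trans (normr_ge0 _) ad.
  have K : 8 * M ^+ 2 * r * d <= d / 2 by move: r1 d0; move: (M ^+ 2 * r) (M ^+ 2) => m n; nra.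
  split.
    have -> : v0 - int01 (e0 a b) - (v0 - int01 (e0 a' b')) = - (int01 (e0 a b) - int01 (e0 a' b')) by ring.
    by rewrite normrN (le_trans L0).
  have -> : v1 - int01 (e1 a b) - (v1 - int01 (e1 a' b')) = - (int01 (e1 a b) - int01 (e1 a' b')) by ring.
  by rewrite normrN (le_trans L1).
exists a, b.
have [j0 _] := itg_test i0 tp; have [j1 _] := itg_test i1 tp.
have [k0 _] := itg_test i0 tq; have [k1 _] := itg_test i1 tq.
have w0 := itgZ a j0; have w1 := itgZ (- a) j1; have w2 := itgZ b k0; have w3 := itgZ (- b) k1.
split=> //.
- transitivity (int01 (fun x => e0 a b x + (T0 x + (- a * (T1 x * p x) + - b * (T1 x * q x))))).
    by apply: eq_int01 => x _; rewrite /e0 /al; move: (cos _) (sin _) => s t; ring.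
  rewrite (int01D (i_e0 a b) (itgD i0 (itgD w1 w3))) (int01D i0 (itgD w1 w3)) (int01D w1 w3).
  rewrite (int01Z (- a) j1) (int01Z (- b) k1) loop0 p1 q1.
  by move: fa; move: (int01 _) => s; lra.
- transitivity (int01 (fun x => e1 a b x + (T1 x + (a * (T0 x * p x) + b * (T0 x * q x))))).
    by apply: eq_int01 => x _; rewrite /e1 /al; move: (cos _) (sin _) => s t; ring.
  rewrite (int01D (i_e1 a b) (itgD i1 (itgD w0 w2))) (int01D i1 (itgD w0 w2)) (int01D w0 w2).
  rewrite (int01Z a j0) (int01Z b k0) loop1 p0 q0.
  by move: fb; move: (int01 _) => s; lra.
Qed.

Let al0 a b : al a b 0 = 0 /\ al a b 1 = 0.
Proof.
have [p00 p11] := test_function_end tp; have [q00 q11] := test_function_end tq.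
by rewrite /al p00 p11 q00 q11 !mulr0 addr0.
Qed.

Let dal_le a b (r : R) (x : R) : `|a| <= r -> `|b| <= r -> 0 <= x <= 1 ->
  `|derive1 (al a b) x| <= 2 * M * r.
Proof.
move=> ar br x01; have [_ ->] := test_lin a b tp tq.
by apply: lincomb_le => //; [have [] := Mp x01|have [] := Mq x01].
Qed.

Lemma four_term_bound (e c c' y y' A t t' d d' : R) : `|c| <= 1 -> `|c'| <= 1 ->
  `|t| <= 1 -> `|t'| <= 1 -> `|A| <= e -> `|y| <= e -> `|y'| <= e ->
  `|c * A * t + y * d + (c' * A * t' + y' * d')| <= e * (2 + `|d| + `|d'|).
Proof.
move=> h1 h2 h3 h4 hA hy hy'.
have P (x z w : R) : `|x| <= 1 -> `|z| <= 1 -> `|w| <= e -> `|x * w * z| <= e.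
  move=> hx hz hw; rewrite !normrM -[leRHS]mulr1 ler_pM ?mulr_ge0//.
  by rewrite -[leRHS]mul1r ler_pM.
have Q (x w : R) : `|w| <= e -> `|w * x| <= e * `|x|.
  by move=> hw; rewrite normrM ler_wpM2r.
apply: (le_trans (ler_normD _ _)).
have B1 := le_trans (ler_normD (c * A * t) (y * d)) (lerD (P _ _ _ h1 h3 hA) (Q d _ hy)).
have B2 := le_trans (ler_normD (c' * A * t') (y' * d')) (lerD (P _ _ _ h2 h4 hA) (Q d' _ hy')).
apply: (le_trans (lerD B1 B2)); rewrite le_eqVlt; apply/orP; left; apply/eqP; ring.
Qed.

(** The derivatives come from the product and chain rules, and the ends are fixed because the angle
    vanishes there. The weight 2 + |D0| + |D1| reflects that D is only square integrable. The
    difference is written with a factor -1 so that [primitiveZ] applies. *)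
Lemma rotation_frame a b r : 0 <= r -> `|a| <= r -> `|b| <= r ->
  exists G0 G1 : R -> R,
  let S0 := fun x => cos (al a b x) * T0 x + - 1 * (sin (al a b x) * T1 x) in
  let S1 := fun x => sin (al a b x) * T0 x + cos (al a b x) * T1 x in
  [/\ L2 G0 /\ L2 G1, primitive_of S0 G0 /\ primitive_of S1 G1,
    forall x : R, 0 <= x <= 1 -> S0 x ^+ 2 + S1 x ^+ 2 = 1 /\
      (`|S0 x - T0 x| <= 4 * M * r /\ `|S1 x - T1 x| <= 4 * M * r),
    [/\ S0 0 = T0 0, S1 0 = T1 0, S0 1 = T0 1 & S1 1 = T1 1] &
    forall x : R, 0 < x < 1 ->
      `|G0 x - D0 x| <= 2 * M * r * (2 + `|D0 x| + `|D1 x|) /\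
      `|G1 x - D1 x| <= 2 * M * r * (2 + `|D0 x| + `|D1 x|)].
Proof.
move=> r0 ar br.
have [sc dc] := scos a b; have [ss ds] := ssin a b.
have [L1 Q1] := primitiveM sc LD0 P0; have [L2' Q2] := primitiveM ss LD1 P1.
have [L3 Q3] := primitiveM ss LD0 P0; have [L4 Q4] := primitiveM sc LD1 P1.
exists (fun x => (derive1 (cos \o al a b) x * T0 x + (cos \o al a b) x * D0 x) +
  -1 * (derive1 (sin \o al a b) x * T1 x + (sin \o al a b) x * D1 x)).
exists (fun x => (derive1 (sin \o al a b) x * T0 x + (sin \o al a b) x * D0 x) +
  (derive1 (cos \o al a b) x * T1 x + (cos \o al a b) x * D1 x)).
move=> S0 S1; split.
- by split; [apply: L2D => //; exact: L2Z|exact: L2D].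
- split; first by apply: primitiveD (primitiveZ _ _ _); [exact: L2_itg|apply: itgZ; exact: L2_itg|exact: Q1|exact: L2_itg|exact: Q2].
  by apply: primitiveD; [exact: L2_itg|exact: L2_itg|exact: Q3|exact: Q4].
- move=> x x01; have [t0 t1] := bT x01; have A := al_le ar br x01.
  have [c1' s1'] := norm_cosB1_le (al a b x).
  split.
    have := unitT x01; have := cos2Dsin2 (al a b x); rewrite /S0 /S1.
    move: (cos _) (sin _) (T0 x) (T1 x) => c s t t' h1 h2.
    have -> : (c * t + -1 * (s * t')) ^+ 2 + (s * t + c * t') ^+ 2 =
      (c ^+ 2 + s ^+ 2) * (t ^+ 2 + t' ^+ 2) by ring.
    by rewrite h1 h2 mulr1.
  have e0' := le_trans c1' A; have e1' := le_trans s1' A.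
  have comb (y z t t' : R) : `|y| <= 2 * M * r -> `|z| <= 2 * M * r -> `|t| <= 1 -> `|t'| <= 1 ->
      `|y * t + z * t'| <= 4 * M * r.
    move=> hy hz ht ht'; apply: (le_trans (ler_normD _ _)); rewrite !normrM.
    have := ler_pM (normr_ge0 y) (normr_ge0 t) hy ht.
    have := ler_pM (normr_ge0 z) (normr_ge0 t') hz ht'.
    by lra.
  split.
    have -> : S0 x - T0 x = (cos (al a b x) - 1) * T0 x + - sin (al a b x) * T1 x.
      by rewrite /S0; move: (cos _) (sin _) => *; ring.
    by apply: comb; rewrite ?normrN.
  have -> : S1 x - T1 x = sin (al a b x) * T0 x + (cos (al a b x) - 1) * T1 x.
    by rewrite /S1; move: (cos _) (sin _) => *; ring.
  exact: comb.
- have [a0 a1] := al0 a b.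
  by rewrite /S0 /S1 a0 a1 cos0 sin0 !mul0r !mul1r mulr0 !addr0 !add0r.
- move=> x /oo_cc x01; have [t0 t1] := bT x01; have A := al_le ar br x01.
  have A' := dal_le ar br x01.
  have [c1' s1'] := norm_cosB1_le (al a b x).
  have e0' := le_trans c1' A; have e1' := le_trans s1' A.
  have bc := cos_max (al a b x); have bs := sin_max (al a b x).
  rewrite dc ds /=; split.
    have -> : - sin (al a b x) * derive1 (al a b) x * T0 x + cos (al a b x) * D0 x +
        -1 * (cos (al a b x) * derive1 (al a b) x * T1 x + sin (al a b x) * D1 x) - D0 x =
        - sin (al a b x) * derive1 (al a b) x * T0 x + (cos (al a b x) - 1) * D0 x +
        (- cos (al a b x) * derive1 (al a b) x * T1 x + - sin (al a b x) * D1 x).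
      by move: (cos _) (sin _) (derive1 _ x) => *; ring.
    by apply: four_term_bound; rewrite ?normrN.
  have -> : cos (al a b x) * derive1 (al a b) x * T0 x + sin (al a b x) * D0 x +
      (- sin (al a b x) * derive1 (al a b) x * T1 x + cos (al a b x) * D1 x) - D1 x =
      cos (al a b x) * derive1 (al a b) x * T0 x + sin (al a b x) * D0 x +
      (- sin (al a b x) * derive1 (al a b) x * T1 x + (cos (al a b x) - 1) * D1 x).
    by move: (cos _) (sin _) (derive1 _ x) => *; ring.
  by apply: four_term_bound; rewrite ?normrN.
Qed.

End Rotation.

(** Integrate (2 + t + u)^2 <= 3 (4 + t^2 + u^2). *)
Lemma sqr_int_bound (e : R) g : itg (fun x => g x ^+ 2) ->
  (forall x : R, 0 < x < 1 -> `|g x| <= e * (2 + `|D0 x| + `|D1 x|)) ->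
  int01 (fun x => g x ^+ 2) <=
  e ^+ 2 * 3 * (4 + int01 (fun x => D0 x ^+ 2) + int01 (fun x => D1 x ^+ 2)).
Proof.
move=> gi ge; have s0 := L2_sqr LD0; have s1 := L2_sqr LD1.
have s01 := itgD (itgD (itg_cst 4) s0) s1.
have -> : 4 + int01 (fun x => D0 x ^+ 2) + int01 (fun x => D1 x ^+ 2) =
    int01 (fun x => 4 + D0 x ^+ 2 + D1 x ^+ 2).
  by rewrite (int01D (itgD (itg_cst 4) s0) s1) (int01D (itg_cst 4) s0) int01_cst.
rewrite -(int01Z _ s01); apply: le_int01 => //; first exact: itgZ.
move=> x /ge; rewrite -(real_normK (num_real (g x))) -(real_normK (num_real (D0 x))) -(real_normK (num_real (D1 x))).
move: (normr_ge0 (g x)); move: `|g x| `|D0 x| `|D1 x| => s t u s0' H.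
have : s ^+ 2 <= (e * (2 + t + u)) ^+ 2 by rewrite ler_sqr// nnegrE (le_trans s0').
move=> /le_trans; apply; rewrite exprMn -mulrA ler_wpM2l ?sqr_ge0//.
have := sqr_ge0 (t - u); have := sqr_ge0 (t - 2); have := sqr_ge0 (u - 2); nra.
Qed.

Lemma unit_loop_perturbation : exists r0 K : R, [/\ 0 < r0, 0 <= K &
  forall r v0 v1 : R, 0 <= r -> r <= r0 -> `|v0| <= r / 2 -> `|v1| <= r / 2 ->
  exists S0 S1 G0 G1 : R -> R,
  [/\ L2 G0 /\ L2 G1, primitive_of S0 G0 /\ primitive_of S1 G1,
    forall x : R, 0 <= x <= 1 -> S0 x ^+ 2 + S1 x ^+ 2 = 1 /\
      (`|S0 x - T0 x| <= K * r /\ `|S1 x - T1 x| <= K * r),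
    [/\ S0 0 = T0 0, S1 0 = T1 0, S0 1 = T0 1 & S1 1 = T1 1] &
    (int01 S0 = v0 /\ int01 S1 = v1) /\
    (int01 (fun x => (G0 x - D0 x) ^+ 2) <= K * r ^+ 2 /\
     int01 (fun x => (G1 x - D1 x) ^+ 2) <= K * r ^+ 2)]].
Proof.
have [p [q [tp tq [p0 p1] [q0 q1]]]] := dual_test_functions.
have [Mp Mp0 HMp] := test_function_bounded tp; have [Mq Mq0 HMq] := test_function_bounded tq.
pose M := Mp + Mq; have M0 : 0 <= M by exact: addr_ge0.
have HMp' (x : R) : 0 <= x <= 1 -> `|p x| <= M /\ `|derive1 p x| <= M.
  by move=> /HMp[h1 h2]; split; [apply: (le_trans h1)|apply: (le_trans h2)]; rewrite lerDl.
have HMq' (x : R) : 0 <= x <= 1 -> `|q x| <= M /\ `|derive1 q x| <= M.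
  by move=> /HMq[h1 h2]; split; [apply: (le_trans h1)|apply: (le_trans h2)]; rewrite lerDr.
pose A := 4 + int01 (fun x => D0 x ^+ 2) + int01 (fun x => D1 x ^+ 2).
have A0 : 0 <= A by rewrite !addr_ge0//; apply: int01_ge0 => x _; exact: sqr_ge0.
have M2 : 0 <= M ^+ 2 by exact: sqr_ge0.
(* The radius enforces 16 M^2 r <= 1. In the second constant, 4 M accounts for the change of T and
   12 M^2 A = (2 M)^2 3 A for that of its derivative. *)
exists (16 * M ^+ 2 + 1)^-1, (4 * M + 12 * M ^+ 2 * A).
have K1 : 0 <= 12 * M ^+ 2 * A by rewrite !mulr_ge0.
have K2 : 0 <= 4 * M by rewrite mulr_ge0.
split; [by rewrite invr_gt0 ltr_wpDl ?mulr_ge0|exact: addr_ge0|].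
move=> r v0 v1 r0 rr0 v0r v1r.
have r1 : 16 * M ^+ 2 * r <= 1.
  have c : 0 < 16 * M ^+ 2 + 1 by rewrite ltr_wpDl ?mulr_ge0.
  rewrite -[_^-1]mul1r ler_pdivlMr// in rr0.
  by apply: le_trans rr0; rewrite mulrC ler_wpM2l// lerDl.
have [a [b [ar br e0 e1]]] := rotation_displacement tp tq p0 p1 q0 q1 M0 HMp' HMq' r0 r1 v0r v1r.
have [G0 [G1 [[LG0 LG1] [pG0 pG1] pw ends GD]]] := rotation_frame tp tq HMp' HMq' r0 ar br.
exists (fun x => cos (a * p x + b * q x) * T0 x + - 1 * (sin (a * p x + b * q x) * T1 x)).
exists (fun x => sin (a * p x + b * q x) * T0 x + cos (a * p x + b * q x) * T1 x).
exists G0, G1; split=> //.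
- move=> x /pw[u [h0 h1]]; split=> //.
  by split; [apply: (le_trans h0)|apply: (le_trans h1)]; rewrite ler_wpM2r// lerDl.
- split=> //.
  have fin g : L2 g -> (forall x : R, 0 < x < 1 -> `|g x| <= 2 * M * r * (2 + `|D0 x| + `|D1 x|)) ->
      int01 (fun x => g x ^+ 2) <= (4 * M + 12 * M ^+ 2 * A) * r ^+ 2.
    move=> Lg /(sqr_int_bound (L2_sqr Lg)) /le_trans; apply.
    rewrite -/A; have -> : (2 * M * r) ^+ 2 * 3 * A = 12 * M ^+ 2 * A * r ^+ 2 by ring.
    by rewrite ler_wpM2r ?sqr_ge0// lerDr.
  by split; apply: fin; [exact: L2B|by move=> x /GD[]|exact: L2B|by move=> x /GD[]].
Qed.

End UnitLoop.

End Loop.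

(** * Curves of prescribed tangent, strong convergence *)

Section RecoveryCurves.
Variable R : realType.
Implicit Types (f g h : R -> R) (a c x : R) (gamma : curve R) (P : 'rV[R]_2).

Local Notation mu := (@lebesgue_measure R).

Lemma ord2P (Q : 'I_2 -> Prop) : Q 0 -> Q 1 -> forall j, Q j.
Proof.
move=> Q0 Q1 [[|[|//]] p]; [rewrite (_ : Ordinal p = 0)//|rewrite (_ : Ordinal p = 1)//];
  exact: val_inj.
Qed.

Definition frame_curve P (L : R) (S : 'I_2 -> R -> R) : curve R :=
  fun x => \row_j (P 0 j + L * prim (S j) x).

Section FrameCurve.
Variables (P : 'rV[R]_2) (L : R) (S G : 'I_2 -> R -> R).
Hypotheses (L0 : 0 < L) (LG : forall j, L2 (G j)) (SG : forall j, primitive_of (S j) (G j)).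
Hypothesis unitS : forall x : R, 0 <= x <= 1 -> S 0 x ^+ 2 + S 1 x ^+ 2 = 1.

Let c := frame_curve P L S.

Let Si j : itg (S j).
Proof. by apply: cont_itg; exact: (primitive_cont (L2_itg (LG j)) (SG j)). Qed.

Lemma frame_curve_H2 j : [/\ H2 (fun x => c x 0 j),
  forall x : R, 0 <= x <= 1 -> deriv1 (fun x => c x 0 j) x = L * S j x &
  ae01 (deriv2 (fun x => c x 0 j)) (fun x => L * G j x)].
Proof.
apply: H2I.
- exact: L2Z.
- by move=> x _; rewrite !mxE prim0 mulr0 addr0 primZ.
- by move=> x x01; rewrite SG// mulrDr primZ//; exact: L2_itg.
Qed.

Lemma frame_curve_dx x j : 0 <= x <= 1 -> dx c x 0 j = L * S j x.
Proof. by move=> x01; rewrite mxE; have [_ E _] := frame_curve_H2 j; exact: E. Qed.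

Lemma frame_curve_speed x : 0 <= x <= 1 -> enorm (dx c x) = L.
Proof.
move=> x01; apply/eqP; rewrite -(@eqrXn2 _ 2) ?enorm_ge0 ?(ltW L0)//; apply/eqP.
rewrite enorm_sqrE !frame_curve_dx//; have := unitS x01.
move: (S 0 x) (S 1 x) => s t h.
by have -> : (L * s) ^+ 2 + (L * t) ^+ 2 = L ^+ 2 * (s ^+ 2 + t ^+ 2); [ring|rewrite h mulr1].
Qed.

Lemma frame_curve_len : len c = L.
Proof.
rewrite /len -/(int01 _) -[RHS](int01_cst L); apply: eq_int01 => x /oo_cc.
exact: frame_curve_speed.
Qed.

Lemma frame_curve_cs : constant_speed c.
Proof. by move=> x; rewrite oo_in frame_curve_len; exact: frame_curve_speed. Qed.

Lemma frame_curve_tangent x j : 0 <= x <= 1 -> tangent c x 0 j = S j x.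
Proof.
by move=> x01; rewrite tangentE frame_curve_speed// frame_curve_dx// mulKf// gt_eqF.
Qed.

Lemma frame_curve0 : c 0 = P.
Proof. by apply/rowP => j; rewrite mxE prim0 mulr0 addr0. Qed.

Lemma frame_curve1 j : c 1 0 j = P 0 j + L * int01 (S j).
Proof. by rewrite mxE prim1. Qed.

End FrameCurve.

(** This form matches the linearity clause of [dual_H2] with coefficient -1. *)
Definition curve_sub gamma1 gamma2 : curve R := fun x => -1 *: gamma2 x + gamma1 x.

Lemma curve_sub_H2 gamma1 gamma2 j : curve_H2 gamma1 -> curve_H2 gamma2 ->
  [/\ H2 (fun x => curve_sub gamma1 gamma2 x 0 j),
    forall x : R, 0 <= x <= 1 -> deriv1 (fun x => curve_sub gamma1 gamma2 x 0 j) x =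
      dx gamma1 x 0 j - dx gamma2 x 0 j &
    ae01 (deriv2 (fun x => curve_sub gamma1 gamma2 x 0 j))
      (fun x => deriv2 (fun x => gamma1 x 0 j) x - deriv2 (fun x => gamma2 x 0 j) x)].
Proof.
move=> H1 H2'; have [h e a] := H2_lin (-1) (H2' j) (H1 j).
have E : (fun x => curve_sub gamma1 gamma2 x 0 j) = (fun x => -1 * gamma2 x 0 j + gamma1 x 0 j).
  by apply/funext => x; rewrite !mxE.
rewrite E; split=> //.
  by move=> x x01; rewrite e// mulN1r addrC !mxE.
apply: ae01_trans a _; apply: aeW => x _; by rewrite mulN1r addrC.
Qed.

Lemma int01_sqr_bound f (A : R) : L2 f -> (forall x : R, 0 < x < 1 -> `|f x| <= A) ->
  int01 (fun x => f x ^+ 2) <= A ^+ 2.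
Proof.
move=> Lf fA; rewrite -[leRHS]int01_cst; apply: le_int01; [exact: L2_sqr|exact: itg_cst|].
move=> x /fA; rewrite -(real_normK (num_real (f x))) => h.
by rewrite ler_sqr// nnegrE (le_trans _ h).
Qed.

(** The 6 counts two coordinates times three orders of differentiation. *)
Lemma norm_curve_sub_le gamma1 gamma2 (A : R) : curve_H2 gamma1 -> curve_H2 gamma2 ->
  (forall (x : R) j, 0 <= x <= 1 -> `|gamma1 x 0 j - gamma2 x 0 j| <= A) ->
  (forall (x : R) j, 0 <= x <= 1 -> `|dx gamma1 x 0 j - dx gamma2 x 0 j| <= A) ->
  (forall j, int01 (fun x => (deriv2 (fun x => gamma1 x 0 j) x -
     deriv2 (fun x => gamma2 x 0 j) x) ^+ 2) <= A ^+ 2) ->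
  norm_H2 (curve_sub gamma1 gamma2) ^+ 2 <= 6 * A ^+ 2.
Proof.
move=> H1 H2' h0 h1 h2.
have CH : curve_H2 (curve_sub gamma1 gamma2).
  by move=> j; have [] := curve_sub_H2 j H1 H2'.
rewrite norm_H2_sqr//.
have B j : int01 (fun x => curve_sub gamma1 gamma2 x 0 j ^+ 2) +
   int01 (fun x => deriv1 (fun y => curve_sub gamma1 gamma2 y 0 j) x ^+ 2) +
   int01 (fun x => deriv2 (fun y => curve_sub gamma1 gamma2 y 0 j) x ^+ 2) <= 3 * A ^+ 2.
  have [hH hd ha] := curve_sub_H2 j H1 H2'.
  have [c L p q] := H2E hH.
  have B0 : int01 (fun x => curve_sub gamma1 gamma2 x 0 j ^+ 2) <= A ^+ 2.
    apply: int01_sqr_bound; first by have [cc _] := hH; exact: L2_cont.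
    by move=> x /oo_cc x01; rewrite !mxE mulN1r addrC; exact: h0.
  have B1 : int01 (fun x => deriv1 (fun y => curve_sub gamma1 gamma2 y 0 j) x ^+ 2) <= A ^+ 2.
    apply: int01_sqr_bound; first exact: L2_cont.
    by move=> x /oo_cc x01; rewrite hd//; exact: h1.
  have B2 : int01 (fun x => deriv2 (fun y => curve_sub gamma1 gamma2 y 0 j) x ^+ 2) <= A ^+ 2.
    apply: le_trans (h2 j); rewrite le_eqVlt; apply/orP; left; apply/eqP.
    have [_ L1 _ _] := H2E (H1 j); have [_ L2' _ _] := H2E (H2' j).
    apply: ae_int01.
    - exact: (itg_meas (L2_sqr L)).
    - exact: (itg_meas (L2_sqr (L2B L1 L2'))).
    - by apply: filterS ha; [exact: (ae_filter_ringOfSetsType mu)|move=> x H /H ->].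
  apply: (le_trans (lerD (lerD B0 B1) B2)); rewrite le_eqVlt; apply/orP; left; apply/eqP; ring.
apply: (le_trans (ler_sum _ (fun j _ => B j))).
by rewrite big_ord_recl big_ord1; move: (A ^+ 2) => a; lra.
Qed.

Lemma int01_sqr_sub f g : L2 f -> L2 g -> int01 (fun x => f x ^+ 2) =
  2 * int01 (fun x => f x * g x) - int01 (fun x => g x ^+ 2) + int01 (fun x => (f x - g x) ^+ 2).
Proof.
move=> Lf Lg; have fg := L2M Lf Lg; have g2 := L2_sqr Lg; have d2 := L2_sqr (L2B Lf Lg).
have e1 := int01Z 2 fg; have e2 := int01B (itgZ 2 fg) g2.
have e3 := int01D (itgB (itgZ 2 fg) g2) d2.
rewrite -e1 -e2 -e3; apply: eq_int01 => x _; ring.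
Qed.

(** Along a converging sequence, the term linear in [gamma1] is handled by weak convergence and the
    last one by the H2 norm. *)
Lemma bending_sub gamma1 gamma2 : curve_H2 gamma1 -> curve_H2 gamma2 ->
  bending gamma1 = 2 * bilin gamma1 gamma2 - bending gamma2 + bending (curve_sub gamma1 gamma2).
Proof.
move=> H1 H2'.
have CH : curve_H2 (curve_sub gamma1 gamma2).
  by move=> j; have [] := curve_sub_H2 j H1 H2'.
rewrite !bendingE// /bilin mulr_sumr -sumrB -big_split/=; apply: eq_bigr => j _.
have [_ _ ha] := curve_sub_H2 j H1 H2'.
have [_ L _ _] := H2E (CH j); have [_ L1 _ _] := H2E (H1 j); have [_ L2' _ _] := H2E (H2' j).
apply: (etrans (int01_sqr_sub L1 L2')); apply: congr1.
apply: (ae_int01 _ _ (ae01_sym _)).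
- exact: (itg_meas (L2_sqr (L2B L1 L2'))).
- exact: (itg_meas (L2_sqr L)).
- by apply: filterS ha; [exact: (ae_filter_ringOfSetsType mu)|move=> x H /H ->].
Qed.

Lemma bending_ge0 gamma : 0 <= bending gamma.
Proof. by apply: int01_ge0 => x _; exact: sqr_ge0. Qed.

Lemma bending_le_norm gamma : curve_H2 gamma -> bending gamma <= norm_H2 gamma ^+ 2.
Proof.
move=> H; rewrite bendingE// norm_H2_sqr//; apply: ler_sum => j _.
by rewrite lerDr addr_ge0//; apply: int01_ge0 => x _; exact: sqr_ge0.
Qed.

Section StrongConvergence.
Variables (gamma_ : nat -> curve R) (gamma : curve R) (a_ : nat -> R).
Hypotheses (H_ : forall n, curve_H2 (gamma_ n)) (H : curve_H2 gamma).
Hypothesis na : forall n, norm_H2 (curve_sub (gamma_ n) gamma) ^+ 2 <= a_ n.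
Hypothesis a0 : a_ n @[n --> \oo] --> (0 : R).

Lemma strong_weak_cvg : weak_cvg_H2 gamma_ gamma.
Proof.
move=> l [lin [C lC]].
have sq : Num.sqrt (a_ n) @[n --> \oo] --> (0 : R).
  by rewrite -[X in _ --> X]sqrtr0; apply: continuous_cvg a0; exact: sqrt_continuous.
have sC : `|C| * Num.sqrt (a_ n) @[n --> \oo] --> (0 : R).
  by rewrite -(mulr0 `|C|); apply: cvgM => //; exact: cvg_cst.
apply/cvgrPdist_le => e e0.
have /cvgr_le/(_ e e0)[N _ HN] := sC.
exists N => // n /HN/= he; rewrite distrC; apply: le_trans he.
have -> : l (gamma_ n) - l gamma = l (curve_sub (gamma_ n) gamma).
  by rewrite (lin (-1) gamma (gamma_ n) H (H_ n)) mulN1r addrC.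
have CH : curve_H2 (curve_sub (gamma_ n) gamma).
  by move=> j; have [] := curve_sub_H2 j (H_ n) H.
have n0 : 0 <= norm_H2 (curve_sub (gamma_ n) gamma) by exact: sqrtr_ge0.
apply: (le_trans (lC _ CH)); apply: (le_trans (ler_wpM2r n0 (ler_norm C))).
rewrite ler_wpM2l//; apply: le_trans (ler_wsqrtr (na n)).
by rewrite sqrtr_sqr ger0_norm.
Qed.

Lemma strong_bending_cvg : bending (gamma_ n) @[n --> \oo] --> bending gamma.
Proof.
have E : (fun n => bending (gamma_ n)) = (fun n => 2 * bilin (gamma_ n) gamma - bending gamma +
    bending (curve_sub (gamma_ n) gamma)).
  by apply/funext => n; apply: bending_sub; [exact: H_|exact: H].
rewrite E.
have CH n : curve_H2 (curve_sub (gamma_ n) gamma).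
  by move=> j; have [] := curve_sub_H2 j (H_ n) H.
have B0 : bending (curve_sub (gamma_ n) gamma) @[n --> \oo] --> (0 : R).
  apply: (@squeeze_cvgr _ _ _ _ (fun=> 0) a_); last first.
  - exact: a0.
  - exact: cvg_cst.
  - by apply: nearW => n; rewrite bending_ge0/=; apply: le_trans (na n); exact: bending_le_norm.
have Q := weak_cvg_bilin strong_weak_cvg H.
have lim : 2 * bending gamma - bending gamma + 0 = bending gamma.
  by rewrite addr0 mulrDl mul1r addrK.
rewrite -[X in _ --> X]lim; apply: cvgD => //; apply: cvgB; last exact: cvg_cst.
by apply: cvgM => //; exact: cvg_cst.
Qed.

End StrongConvergence.

End RecoveryCurves.

(** * Recovery sequences *)

Section Recovery.
Variable R : realType.
Implicit Types (f h m : R -> R) (a b c x : R) (gamma : curve R) (u v w P : 'rV[R]_2) (Gamma : triple R).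

Local Notation mu := (@lebesgue_measure R).

(** The derivative divided by the length is a unit field of zero mean, to which
    [unit_loop_perturbation] applies. The new curve is the primitive of the perturbed field times
    the same length, so its endpoint moves by the length times [v]. *)
Lemma loop_recovery gamma : curve_H2 gamma -> constant_speed gamma -> 0 < len gamma ->
  gamma 0 = gamma 1 ->
  exists r0 C : R, [/\ 0 < r0, 0 <= C & forall r v, 0 <= r -> r <= r0 ->
    (forall j, `|v 0 j| <= r / 2) -> exists c : curve R,
    [/\ curve_H2 c, constant_speed c,
      len c = len gamma /\ (c 0 = gamma 0 /\ c 1 = gamma 0 + len gamma *: v),
      tangent c 0 = tangent gamma 0 /\ tangent c 1 = tangent gamma 1 &
      norm_H2 (curve_sub c gamma) ^+ 2 <= C * r ^+ 2]].
Proof.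
move=> H cs L0 loop; have [L LE] : exists L, len gamma = L by exists (len gamma).
rewrite LE in L0 *.
have Ln : L != 0 by rewrite gt_eqF.
pose T (j : 'I_2) x := L^-1 * deriv1 (fun y => gamma y 0 j) x.
pose D (j : 'I_2) x := L^-1 * deriv2 (fun y => gamma y 0 j) x.
have LD j : L2 (D j) by have [_ Ld _ _] := H2E (H j); exact: L2Z.
have TD j : primitive_of (T j) (D j).
  by have [_ Ld _ q] := H2E (H j); apply: primitiveZ => //; exact: L2_itg.
have TL x j : 0 <= x <= 1 -> tangent gamma x 0 j = T j x.
  by move=> x01; rewrite tangentE cs ?oo_in// LE mxE.
have unitT x : 0 <= x <= 1 -> T 0 x ^+ 2 + T 1 x ^+ 2 = 1.
  move=> x01; rewrite -!TL//; have := @tangent_unit _ gamma x.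
  by rewrite dotpE !expr2; apply; rewrite cs ?oo_in// LE.
have loopT j : int01 (T j) = 0.
  have [cd _ p _] := H2E (H j).
  rewrite int01Z; last exact: cont_itg.
  have := p 1 (one01 R); rewrite prim1 -loop => /eqP.
  by rewrite -subr_eq0 opprD addrA subrr add0r oppr_eq0 => /eqP ->; rewrite mulr0.
have [r0 [K [r00 K0 Hloop]]] := unit_loop_perturbation (LD 0) (LD 1) (TD 0) (TD 1) unitT (loopT 0) (loopT 1).
(* In each coordinate [L * (K + 1) * r] bounds the change of position, of first derivative and, in
   L2 norm, of second derivative; the last uses K <= (K + 1)^2. *)
have C0 : 0 <= 6 * (L * (K + 1)) ^+ 2 := mulr_ge0 (ler0n _ 6) (sqr_ge0 _).
exists r0, (6 * (L * (K + 1)) ^+ 2); split; [exact: r00|exact: C0|].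
move=> r v rge rle vr.
have [S0 [S1 [G0 [G1 [[LG0 LG1] [pG0 pG1] unitS [s00 s10 s01 s11] [[v0 v1] [g0 g1]]]]]]] :=
  Hloop r (v 0 0) (v 0 1) rge rle (vr 0) (vr 1).
pose S (j : 'I_2) := if j == 0 then S0 else S1.
pose G (j : 'I_2) := if j == 0 then G0 else G1.
have LG : forall j, L2 (G j) by apply: ord2P; [exact: LG0|exact: LG1].
have SG : forall j, primitive_of (S j) (G j) by apply: ord2P; [exact: pG0|exact: pG1].
have uS x : 0 <= x <= 1 -> S 0 x ^+ 2 + S 1 x ^+ 2 = 1 by move=> /unitS[].
have Sv : forall j, int01 (S j) = v 0 j by apply: ord2P; [exact: v0|exact: v1].
have S0E : forall j, S j 0 = T j 0 by apply: ord2P; [exact: s00|exact: s10].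
have S1E : forall j, S j 1 = T j 1 by apply: ord2P; [exact: s01|exact: s11].
have Sd x : 0 <= x <= 1 -> forall j, `|S j x - T j x| <= K * r.
  by move=> /unitS[_ [h0 h1]]; apply: ord2P; [exact: h0|exact: h1].
have Gd : forall j, int01 (fun x => (G j x - D j x) ^+ 2) <= K * r ^+ 2 by apply: ord2P; [exact: g0|exact: g1].
move: S G LG SG uS Sv S0E S1E Sd Gd => {S0 S1 G0 G1 LG0 LG1 pG0 pG1 unitS s00 s10 s01 s11 v0 v1 g0 g1} S G LG SG uS Sv S0E S1E Sd Gd.
have Si j : itg (S j) by apply: cont_itg; exact: (primitive_cont (L2_itg (LG j)) (SG j)).
have Ti j : itg (T j) by apply: cont_itg; exact: (primitive_cont (L2_itg (LD j)) (TD j)).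
set c := frame_curve (gamma 0) L S.
have Hc j := @frame_curve_H2 _ (gamma 0) L S G LG SG j.
have Hc2 : curve_H2 c by move=> j; have [] := Hc j.
exists c; split.
- exact: Hc2.
- exact: (@frame_curve_cs _ (gamma 0) L S G L0 LG SG uS).
- split; first exact: (@frame_curve_len _ (gamma 0) L S G L0 LG SG uS).
  split; first exact: frame_curve0.
  by apply/rowP => j; rewrite frame_curve1 Sv !mxE.
- split; apply/rowP => j.
    by rewrite (@frame_curve_tangent _ (gamma 0) L S G L0 LG SG uS _ _ (zero01 R)) TL ?zero01.
  by rewrite (@frame_curve_tangent _ (gamma 0) L S G L0 LG SG uS _ _ (one01 R)) TL ?one01.
have -> : 6 * (L * (K + 1)) ^+ 2 * r ^+ 2 = 6 * (L * (K + 1) * r) ^+ 2.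
  by move: (L * (K + 1)) => t; ring.
have Kr : K * r <= (K + 1) * r by rewrite ler_wpM2r// lerDl.
have LKr : L * (K * r) <= L * (K + 1) * r by rewrite -mulrA ler_wpM2l// ltW.
apply: (norm_curve_sub_le Hc2 H).
- move=> x j x01; have [cd _ p _] := H2E (H j).
  have E : c x 0 j - gamma x 0 j = L * prim (fun x => S j x - T j x) x.
    have -> : gamma x 0 j = gamma 0 0 j + L * prim (T j) x.
      rewrite (p x x01) primZ ?mulrA ?divff ?mul1r//; exact: cont_itg.
    have -> : prim (fun x => S j x - T j x) x = prim (S j) x - prim (T j) x.
      rewrite (@eq_prim _ _ (fun x => S j x + -1 * T j x)) => [|y _]; last by rewrite mulN1r.
      by rewrite (primD x (Si j) (itgZ (-1) (Ti j))) (primZ (-1) x (Ti j)) mulN1r.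
    by rewrite mxE; move: (prim (S j) x) (prim (T j) x) => s t; ring.
  rewrite E normrM (ger0_norm (ltW L0)); apply: le_trans LKr.
  rewrite ler_wpM2l ?(ltW L0)//; have ST := itgB (Si j) (Ti j).
  apply: (le_trans (prim_le _ ST)); rewrite -[leRHS](int01_cst (K * r)).
  apply: le_int01; [exact: itg_norm|exact: itg_cst|].
  by move=> y /oo_cc y01; exact: Sd.
- move=> x j x01; rewrite (@frame_curve_dx _ (gamma 0) L S G LG SG _ _ x01).
  have -> : dx gamma x 0 j = L * T j x by rewrite mxE /T mulrA divff ?mul1r.
  rewrite -mulrBr normrM (ger0_norm (ltW L0)); apply: le_trans LKr.
  by rewrite ler_wpM2l ?(ltW L0)//; exact: Sd.
- move=> j; have [_ _ ha] := Hc j.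
  have [_ Lc _ _] := H2E (Hc2 j); have [_ Lg _ _] := H2E (H j).
  have -> : int01 (fun x => (deriv2 (fun y => c y 0 j) x - deriv2 (fun y => gamma y 0 j) x) ^+ 2) =
      L ^+ 2 * int01 (fun x => (G j x - D j x) ^+ 2).
    have GD := L2B (LG j) (LD j).
    rewrite -(int01Z _ (L2_sqr GD)); apply: ae_int01.
    + exact: (itg_meas (L2_sqr (L2B Lc Lg))).
    + exact: (itg_meas (itgZ _ (L2_sqr GD))).
    + apply: filterS ha; first exact: (ae_filter_ringOfSetsType mu).
      move=> x Hx /Hx ->; rewrite /D; move: (deriv2 _ x) => d.
      by field.
  apply: (le_trans (ler_wpM2l (sqr_ge0 L) (Gd j))).
  have Kle : K <= (K + 1) ^+ 2.
    by move: K0 {Hloop C0 Sd Gd Kr LKr}; move: K => k k0; have := sqr_ge0 k; nra.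
  apply: (le_trans (ler_wpM2l (sqr_ge0 L) (ler_wpM2r (sqr_ge0 r) Kle))).
  by rewrite le_eqVlt; apply/orP; left; apply/eqP; ring.
Qed.

Lemma const_curve gamma P : (forall x : R, 0 <= x <= 1 -> gamma x = P) ->
  [/\ forall (x : R) j, 0 <= x <= 1 -> dx gamma x 0 j = 0,
      forall j, ae01 (deriv2 (fun y => gamma y 0 j)) (cst 0) & len gamma = 0].
Proof.
move=> gP.
have Lz : L2 (cst 0 : R -> R) by apply: (@L2_bounded _ _ 0) => // x _; rewrite normr0.
have h j : [/\ H2 (fun x => gamma x 0 j),
    forall x : R, 0 <= x <= 1 -> deriv1 (fun x => gamma x 0 j) x = cst 0 x &
    ae01 (deriv2 (fun x => gamma x 0 j)) (cst 0)].
  apply: H2I => // [x x01|x _]; last by rewrite prim_cst0 addr0.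
  by rewrite gP// gP ?zero01// prim_cst0 addr0.
have d0 (x : R) j : 0 <= x <= 1 -> dx gamma x 0 j = 0.
  by move=> x01; rewrite mxE; have [_ E _] := h j; exact: E.
split=> //; first by move=> j; have [] := h j.
rewrite /len -/(int01 _) -(int01_cst (0 : R)); apply: eq_int01 => x /oo_cc x01.
by apply/eqP; rewrite -sqrf_eq0 enorm_sqrE !d0// expr0n addr0.
Qed.

(** Seen from the constant curve, position and first derivative move by at most [e] in each
    coordinate and the second derivative not at all. *)
Lemma segment_recovery gamma P w (e : R) : curve_H2 gamma ->
  (forall x : R, 0 <= x <= 1 -> gamma x = P) -> dotp w w = 1 -> 0 < e ->
  exists c : curve R, [/\ curve_H2 c, constant_speed c,
    len c = e /\ bending c = 0, (c 0 = P /\ c 1 = P + e *: w) /\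
     (tangent c 0 = w /\ tangent c 1 = w) &
    norm_H2 (curve_sub c gamma) ^+ 2 <= 6 * e ^+ 2].
Proof.
move=> H gP w1 e0.
have [dg ag lg] := const_curve gP.
have Lz : L2 (cst 0 : R -> R) by apply: (@L2_bounded _ _ 0) => // x _; rewrite normr0.
pose S (j : 'I_2) : R -> R := cst (w 0 j); pose G (j : 'I_2) : R -> R := cst 0.
have LG j : L2 (G j) by [].
have SG j : primitive_of (S j) (G j) by move=> x _; rewrite prim_cst0 addr0.
have uS x : 0 <= x <= 1 -> S 0 x ^+ 2 + S 1 x ^+ 2 = 1.
  by move=> _; rewrite /S /= -w1 dotpE !expr2.
have wj j : `|w 0 j| <= 1.
  rewrite -(@ler_sqr _ `|_|) ?nnegrE// real_normK ?num_real// expr1n -w1 -enorm_sqr.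
  exact: coord_le_enorm.
set c := frame_curve P e S.
have Hc j := @frame_curve_H2 _ P e S G LG SG j.
have Hc2 : curve_H2 c by move=> j; have [] := Hc j.
have ac j : ae01 (deriv2 (fun y => c y 0 j)) (cst 0).
  have [_ _ ha] := Hc j; apply: ae01_trans ha _; apply: aeW => x _.
  by rewrite /G /= mulr0.
exists c; split.
- exact: Hc2.
- exact: (@frame_curve_cs _ P e S G e0 LG SG uS).
- split; first exact: (@frame_curve_len _ P e S G e0 LG SG uS).
  rewrite bendingE// big1// => j _; have [_ Lc _ _] := H2E (Hc2 j).
  rewrite -[RHS](int01_cst 0); apply: ae_int01 => //.
    exact: (itg_meas (L2_sqr Lc)).
  by apply: filterS (ac j); [exact: (ae_filter_ringOfSetsType mu)|move=> x h /h ->; rewrite /= expr0n].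
- split; first split; first exact: frame_curve0.
    by apply/rowP => j; rewrite frame_curve1 /S int01_cst !mxE.
  split; apply/rowP => j.
    by rewrite (@frame_curve_tangent _ P e S G e0 LG SG uS _ _ (zero01 R)).
  by rewrite (@frame_curve_tangent _ P e S G e0 LG SG uS _ _ (one01 R)).
apply: (norm_curve_sub_le Hc2 H).
- move=> x j x01; rewrite gP// mxE addrC addKr normrM (gtr0_norm e0).
  rewrite -[leRHS]mulr1 ler_wpM2l ?(ltW e0)//; apply: (le_trans (prim_le _ (itg_cst _))).
  by rewrite int01_cst.
- move=> x j x01; rewrite (@frame_curve_dx _ P e S G LG SG _ _ x01) dg// subr0 normrM (gtr0_norm e0).
  rewrite -[leRHS]mulr1; apply: ler_wpM2l; [exact: ltW|exact: wj].
- move=> j; have [_ Lc _ _] := H2E (Hc2 j); have [_ Lg _ _] := H2E (H j).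
  rewrite (_ : int01 _ = 0) ?sqr_ge0//.
  rewrite -[RHS](int01_cst 0); apply: ae_int01 => //.
    exact: (itg_meas (L2_sqr (L2B Lc Lg))).
  apply: filterS2 (ac j) (ag j); first exact: (ae_filter_ringOfSetsType mu).
  by move=> x h1 h2 xI; rewrite h1// h2//= subrr expr0n.
Qed.

Lemma ord3_cases (i k l : 'I_3) : i != k -> i != l -> k != l ->
  forall j, [\/ j = i, j = k | j = l].
Proof.
move=> ik il kl j; have [->|ji] := eqVneq j i; first by constructor 1.
have [->|jk] := eqVneq j k; first by constructor 2.
constructor 3; apply/eqP; apply: contraT => jl; exfalso.
move: ik il kl ji jk jl.
by case: i => -[|[|[|//]]] ?; case: k => -[|[|[|//]]] ?; case: l => -[|[|[|//]]] ?;
  case: j => -[|[|[|//]]] ?.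
Qed.

(** Equality of unordered pairs enters only through the sum, whose opposite is the tangent of the
    third curve. *)
Lemma pair_sum u v w t : u <> v -> [set u; v] = [set w; t] -> w + t = u + v.
Proof.
move=> uv E.
have /= : [set u; v] w by rewrite E; left.
have /= : [set u; v] t by rewrite E; right.
have Hu : [set w; t] u by rewrite -E; left.
have Hv : [set w; t] v by rewrite -E; right.
move=> [tE|tE] [wE|wE]; rewrite tE wE in Hu Hv *.
- by case: Hv => /= E'; case: uv.
- exact: addrC.
- by [].
- by case: Hu => /= E'; case: uv.
Qed.

Lemma energy_cvg (gamma_ : nat -> curve R) gamma : (forall n, len (gamma_ n) = len gamma) ->
  bending (gamma_ n) @[n --> \oo] --> bending gamma ->
  energy (gamma_ n) @[n --> \oo] --> energy gamma.
Proof.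
move=> lg bg; rewrite energyE.
have -> : (fun n => energy (gamma_ n)) = (fun n => (len gamma ^+ 3)^-1 * bending (gamma_ n) + len gamma).
  by apply/funext => n; rewrite energyE lg.
by apply: cvgD; [apply: cvgM => //; exact: cvg_cst|exact: cvg_cst].
Qed.

Lemma one_neq_Nhalf : (1 : R) <> - 2^-1.
Proof. by lra. Qed.

(** Eliminates the relabeling and the angle in favour of a single vector w completing the tangents
    at both ends; it is a unit vector because the sum of the other two has squared norm 1 + 1 -
    1. *)
Lemma degenerate_data Gamma : degenerate_theta_network Gamma ->
  exists i k l P, [/\ [/\ i != k, i != l & k != l],
    0 < len (Gamma i) /\ 0 < len (Gamma k),
    forall x : R, 0 <= x <= 1 -> Gamma l x = P,
    [/\ Gamma i 0 = P, Gamma i 1 = P, Gamma k 0 = P & Gamma k 1 = P] &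
    exists2 w, dotp w w = 1 &
      tangent (Gamma i) 0 + tangent (Gamma k) 0 + w = 0 /\
      tangent (Gamma i) 1 + tangent (Gamma k) 1 + w = 0].
Proof.
move=> [[H cs e0 e1] [s [P]]].
have inj (a b : nat) : (a < 3)%N -> (b < 3)%N -> a != b -> s (inord a) != s (inord b).
  move=> a3 b3; apply: contra => /eqP/perm_inj/(congr1 val); rewrite /= !inordK// => ->.
  exact: eqxx.
move: (inj 0%N 1%N isT isT isT) (inj 0%N 2%N isT isT isT) (inj 1%N 2%N isT isT isT).
move: (s (inord 0)) (s (inord 1)) (s (inord 2)) => i k l ik il kl.
move=> [[ri rk] lP [i0P i1P k0P k1P] ang pairE].
have z01 := zero01 R.
have ui : dotp (tangent (Gamma i) 0) (tangent (Gamma i) 0) = 1.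
  by apply: tangent_unit; apply: ri; rewrite oo_in.
have uk : dotp (tangent (Gamma k) 0) (tangent (Gamma k) 0) = 1.
  by apply: tangent_unit; apply: rk; rewrite oo_in.
have dik := (angle_2pi3 ui uk).1 ang.
exists i, k, l, P; split.
- by [].
- by split; apply/(regular_len (@cs _)).
- by move=> x x01; apply: lP; rewrite oo_in.
- by [].
exists (- (tangent (Gamma i) 0 + tangent (Gamma k) 0)); last first.
  split; first exact: subrr.
  rewrite (@pair_sum _ _ _ _ _ pairE) ?subrr// => E.
  by apply: one_neq_Nhalf; rewrite -dik -E ui.
have wj j : (- (tangent (Gamma i) 0 + tangent (Gamma k) 0) : 'rV[R]_2) 0 j =
    - (tangent (Gamma i) 0 0 j + tangent (Gamma k) 0 0 j) by rewrite mxE rowD.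
rewrite dotpE !wj; move: ui uk dik; rewrite !dotpE.
move: (tangent _ _ _ _) (tangent _ _ _ _) (tangent _ _ _ _) (tangent _ _ _ _) => a b c d.
lra.
Qed.

(** [r] measures the perturbation of the two loops, of lengths A and B, and [e] is the length of the
    segment. The bounds on [e] make (e / A) w and (e / B) w admissible displacements. *)
Lemma radii_to0 (r1 r2 A B : R) : 0 < r1 -> 0 < r2 -> 0 < A -> 0 < B ->
  exists r e : nat -> R, [/\ forall n, [/\ 0 < r n, r n <= r1 & r n <= r2],
    forall n, [/\ 0 < e n, e n <= r n / 2 * A & e n <= r n / 2 * B],
    r n @[n --> \oo] --> (0 : R) & e n @[n --> \oo] --> (0 : R)].
Proof.
move=> r10 r20 A0 B0.
pose m := Num.min r1 r2; pose N := Num.min A B.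
have m0 : 0 < m by rewrite lt_min r10.
have N0 : 0 < N by rewrite lt_min A0.
pose r n : R := m * n.+1%:R^-1.
have r0 n : 0 < r n by rewrite mulr_gt0.
have rm n : r n <= m by rewrite ler_piMr ?(ltW m0)// invf_le1// ler1n.
have r2p n : 0 <= r n / 2 by rewrite divr_ge0// ltW.
have rcv : r n @[n --> \oo] --> (0 : R).
  by rewrite -(mulr0 m); apply: cvgM; [exact: cvg_cst|exact: cvg_harmonic].
exists r, (fun n => r n / 2 * N); split.
- by move=> n; split=> //; apply: (le_trans (rm n)); rewrite ge_min lexx ?orbT.
- move=> n; split; first by rewrite mulr_gt0// divr_gt0.
  + by rewrite ler_wpM2l// ge_min lexx.
  + by rewrite ler_wpM2l// ge_min lexx orbT.
- exact: rcv.
- have -> : (0 : R) = 0 / 2 * N by rewrite !mul0r.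
  by apply: cvgM; [apply: cvgM => //|]; exact: cvg_cst.
Qed.

Lemma cvgn_scaled_sqr (C : R) (u : nat -> R) : u n @[n --> \oo] --> (0 : R) ->
  C * u n ^+ 2 @[n --> \oo] --> (0 : R).
Proof.
move=> u0; rewrite -(mulr0 C) -[X in C * X](expr0n _ 2).
by apply: cvgM; [exact: cvg_cst|exact: cvgn_sqr].
Qed.

Lemma coord_scaled_le (e L q : R) w j : 0 < e -> 0 < L -> e <= q * L -> `|w 0 j| <= 1 ->
  `|((e / L) *: w : 'rV[R]_2) 0 j| <= q.
Proof.
move=> e0 L0 eq wj; have eL : 0 <= e / L by rewrite divr_ge0 ?ltW.
rewrite mxE normrM ger0_norm// -[leRHS]mulr1; apply: ler_pM => //.
by rewrite ler_pdivrMr.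
Qed.

Lemma scaler_div (e L : R) w : 0 < L -> L *: ((e / L) *: w) = e *: (w : 'rV[R]_2).
Proof. by move=> L0; rewrite scalerA mulrC mulfVK// gt_eqF. Qed.

Lemma sum_ord3_cond (Q : pred 'I_3) (f : 'I_3 -> R) i k l : i != k -> i != l -> k != l ->
  Q i -> Q k -> ~~ Q l -> \sum_(j | Q j) f j = f i + f k + 0.
Proof.
move=> ik il kl Qi Qk Ql.
by rewrite big_mkcond (sum_ord3 _ ik il kl) /= Qi Qk (negbTE Ql).
Qed.

Lemma limn_einf_EFin (u : nat -> R) (l : R) : u n @[n --> \oo] --> l ->
  limn_einf (fun n => (u n)%:E) = l%:E.
Proof.
move=> ul.
have ule : (u n)%:E @[n --> \oo] --> l%:E by apply: cvg_EFin; [exact: nearW|exact: ul].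
by have [-> _] := cvg_limn_einf_sup ule.
Qed.

Lemma degenerate_recovery Gamma : degenerate_theta_network Gamma ->
  exists Gamma_ : nat -> triple R, [/\ weak_cvg_network Gamma_ Gamma,
    forall n, theta_network (Gamma_ n) &
    F (Gamma_ n) @[n --> \oo] --> \sum_(i | 0 < len (Gamma i)) energy (Gamma i)].
Proof.
move=> dG; have [[H cs e0 e1] _] := dG.
have [i [k [l [P [[ik il kl] [Li Lk] lP [i0P i1P k0P k1P] [w w1 [sum0 sum1]]]]]]] := degenerate_data dG.
have [_ _ Ll] := const_curve lP.
have [r1 [C1 [r10 C10 Hi]]] := loop_recovery (@H i) (@cs i) Li (etrans i0P (esym i1P)).
have [r2 [C2 [r20 C20 Hk]]] := loop_recovery (@H k) (@cs k) Lk (etrans k0P (esym k1P)).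
have wj j : `|w 0 j| <= 1.
  rewrite -(@ler_sqr _ `|_|) ?nnegrE// real_normK ?num_real// expr1n -w1 -enorm_sqr.
  exact: coord_le_enorm.
have [r [e [rb eb rcv ecv]]] := radii_to0 r10 r20 Li Lk.
have r_ge0 n : 0 <= r n by have [/ltW ? _ _] := rb n.
have rr1 n : r n <= r1 by have [_ ? _] := rb n.
have rr2 n : r n <= r2 by have [_ _ ?] := rb n.
have e_gt0 n : 0 < e n by have [? _ _] := eb n.
have e1_le n : e n <= r n / 2 * len (Gamma i) by have [_ ? _] := eb n.
have e2_le n : e n <= r n / 2 * len (Gamma k) by have [_ _ ?] := eb n.
(* [loop_recovery] multiplies the displacement by the length; dividing by it here makes both loops
   end exactly at P + e w, where the segment ends. *)
have /choice[c1 Hc1] := fun n => Hi (r n) ((e n / len (Gamma i)) *: w) (r_ge0 n) (rr1 n)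
  (fun j => coord_scaled_le (e_gt0 n) Li (e1_le n) (wj j)).
have /choice[c2 Hc2] := fun n => Hk (r n) ((e n / len (Gamma k)) *: w) (r_ge0 n) (rr2 n)
  (fun j => coord_scaled_le (e_gt0 n) Lk (e2_le n) (wj j)).
have /choice[c3 Hc3] := fun n => segment_recovery (@H l) lP w1 (e_gt0 n).
pose Gamma_ n : triple R := fun j => if j == i then c1 n else if j == k then c2 n else c3 n.
have Gi n : Gamma_ n i = c1 n by rewrite /Gamma_ eqxx.
have Gk n : Gamma_ n k = c2 n by rewrite /Gamma_ eq_sym (negbTE ik) eqxx.
have Gl n : Gamma_ n l = c3 n.
  by rewrite /Gamma_ eq_sym (negbTE il) eq_sym (negbTE kl).
have H1 n : curve_H2 (c1 n) by have [] := Hc1 n.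
have H2' n : curve_H2 (c2 n) by have [] := Hc2 n.
have H3 n : curve_H2 (c3 n) by have [] := Hc3 n.
have N1 n : norm_H2 (curve_sub (c1 n) (Gamma i)) ^+ 2 <= C1 * r n ^+ 2 by have [] := Hc1 n.
have N2 n : norm_H2 (curve_sub (c2 n) (Gamma k)) ^+ 2 <= C2 * r n ^+ 2 by have [] := Hc2 n.
have N3 n : norm_H2 (curve_sub (c3 n) (Gamma l)) ^+ 2 <= 6 * e n ^+ 2 by have [] := Hc3 n.
have l1 n : len (c1 n) = len (Gamma i) by have [_ _ []] := Hc1 n.
have l2 n : len (c2 n) = len (Gamma k) by have [_ _ []] := Hc2 n.
have l3 n : len (c3 n) = e n by have [_ _ []] := Hc3 n.
have cases := ord3_cases ik il kl.
exists Gamma_; split.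
- move=> j; have [->|->|->] := cases j.
  + have -> : (fun n => Gamma_ n i) = c1 by apply/funext.
    exact: (strong_weak_cvg H1 (@H i) N1 (@cvgn_scaled_sqr C1 r rcv)).
  + have -> : (fun n => Gamma_ n k) = c2 by apply/funext.
    exact: (strong_weak_cvg H2' (@H k) N2 (@cvgn_scaled_sqr C2 r rcv)).
  + have -> : (fun n => Gamma_ n l) = c3 by apply/funext.
    exact: (strong_weak_cvg H3 (@H l) N3 (@cvgn_scaled_sqr 6 e ecv)).
- move=> n.
  have [_ cs1 [_ [s1 t1]] [ts1 tt1] _] := Hc1 n.
  have [_ cs2 [_ [s2 t2]] [ts2 tt2] _] := Hc2 n.
  have [_ cs3 _ [[s3 t3] [ts3 tt3]] _] := Hc3 n.
  have cs' j : constant_speed (Gamma_ n j).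
    by have [->|->|->] := cases j; rewrite ?Gi ?Gk ?Gl.
  have start j : Gamma_ n j 0 = P.
    by have [->|->|->] := cases j; rewrite ?Gi ?Gk ?Gl ?s1 ?s2 ?s3.
  have finish j : Gamma_ n j 1 = P + e n *: w.
    have [->|->|->] := cases j.
    + by rewrite Gi t1 i0P (scaler_div _ _ Li).
    + by rewrite Gk t2 k0P (scaler_div _ _ Lk).
    + by rewrite Gl.
  split.
  + split=> //.
    * by move=> j; have [->|->|->] := cases j; rewrite ?Gi ?Gk ?Gl.
    * by move=> j j'; rewrite !start.
    * by move=> j j'; rewrite !finish.
  + move=> j; apply/(regular_len (@cs' j)); have [->|->|->] := cases j.
    * by rewrite Gi l1.
    * by rewrite Gk l2.
    * by rewrite Gl l3.
  + by rewrite (sum_ord3 _ ik il kl) Gi Gk Gl ts1 ts2 ts3.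
  + by rewrite (sum_ord3 _ ik il kl) Gi Gk Gl tt1 tt2 tt3.
have -> : \sum_(j | 0 < len (Gamma j)) energy (Gamma j) = energy (Gamma i) + energy (Gamma k) + 0.
  apply: (@sum_ord3_cond (fun j => 0 < len (Gamma j)) (fun j => energy (Gamma j)) i k l ik il kl Li Lk).
  by rewrite Ll ltxx.
rewrite (_ : (fun n => F (Gamma_ n)) = (fun n => energy (c1 n) + energy (c2 n) + energy (c3 n))); last first.
  by apply/funext => n; rewrite /F (sum_ord3 (fun j => energy (Gamma_ n j)) ik il kl) Gi Gk Gl.
apply: cvgD; [apply: cvgD|].
- exact: (energy_cvg l1 (strong_bending_cvg H1 (@H i) N1 (@cvgn_scaled_sqr C1 r rcv))).
- exact: (energy_cvg l2 (strong_bending_cvg H2' (@H k) N2 (@cvgn_scaled_sqr C2 r rcv))).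
(* The energy of the segment is its length, which tends to the last term 0 of the sum. *)
have -> : (fun n => energy (c3 n)) = e.
  apply/funext => n; rewrite energyE l3; have [_ _ [_ ->] _ _] := Hc3 n.
  by rewrite mulr0 add0r.
exact: ecv.
Qed.

End Recovery.

Theorem theorem3p3 (R : realType) (Gamma : triple R) (hGamma : network3 Gamma) :
  Fbar Gamma = relaxation Gamma.
Proof.
apply/eqP; rewrite eq_le; apply/andP; split.
  apply: le_ereal_inf_tmp => _ [Gamma_ [wc th] <-].
  exact: Fbar_le_liminf.
rewrite /Fbar; case: asboolP => [tG|_].
  (* A Theta-network is its own recovery sequence. *)
  apply: ereal_inf_lbound; exists (fun=> Gamma); first by split=> // i l _; exact: cvg_cst.
  by have [-> _] := cvg_limn_einf_sup (@cvg_cst _ (F Gamma)%:E _ \oo _).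
case: asboolP => [dG|_]; last exact: leey.
have [Gamma_ [wc th Fcv]] := degenerate_recovery dG.
apply: ereal_inf_lbound; exists Gamma_; first by split.
exact: limn_einf_EFin.
Qed.
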